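(* For $1\le p<\infty$, the operator $\mathbf{T}_a$ satisfies the transmutation property $$\mathbf{L}_a\mathbf{T}_au=\mathbf{T}_aD^2u\qquad\forall u\in W^{3,p}(-\ell,\ell).$$
   Context: Let $\ell>0$, $I=(-\ell,\ell)$, and let $a\in W^{1,\infty}(-\ell,\ell)$ be positive with $a,\frac1a\in L^2(-\ell,\ell)$ and $a(0)=1$. Write $D=\frac{d}{dx}$ and $\mathbf{L}_au:=\frac{1}{a^2}(a^2u')'$, defined for $u\in W^{1,1}(I)$ with $a^2u'$ absolutely continuous on $\overline I$ and $\frac{(a^2u')'}{a^2}\in L^p_a(I)$, where $L^p_a(I)$ is the $L^p$ space with respect to the measure $a^2(x)dx$. For $\rho\in\mathbb{C}$, $e_a(\rho,\cdot)$ denotes the unique solution of $-\frac1{a^2}(a^2u')'=\rho^2u$ on $I$ with $u(0)=1$, $(a^2u')(0)=i\rho$. It is known that there is a kernel $K_a\in W^{1,\infty}(\Omega)$, $\Omega=(-\ell,\ell)\times(-\ell,\ell)$, such that $e_a(\rho,x)=e^{i\rho x}-i\rho\int_{-x}^{x}K_a(x,t)e^{i\rho t}\,dt$ for all $x\in[-\ell,\ell]$, $\rho\in\mathbb{C}$, and $K_a(x,x)=1-\frac1{a(x)}$, $K_a(x,-x)=0$ for $x\in[-\ell,\ell]$. (The representation determines $K_a$ on $|t|\le|x|$.) The operator $\mathbf{T}_a$ is $\mathbf{T}_au(x):=u(x)-\int_{-x}^xK_a(x,t)u'(t)\,dt$, $-\ell\le x\le\ell$, for $u\in W^{1,p}(-\ell,\ell)$.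 For $x<0$, $\int_{-x}^x$ is the oriented integral. *)

(* Defs.v *)
(* MathComp-Analysis, over an arbitrary [R : realType]; complex numbers are
   [R[i]] from mathcomp-real-closed. *)
From HB Require Import structures.
From mathcomp Require Import all_boot all_order all_algebra.
From mathcomp Require Import all_classical all_reals all_analysis.
From mathcomp Require Import complex.
Set Implicit Arguments.
Unset Strict Implicit.
Unset Printing Implicit Defensive.
Import Order.TTheory GRing.Theory Num.Theory.
Import numFieldNormedType.Exports.
Local Open Scope classical_set_scope.
Local Open Scope complex_scope.
Local Open Scope ring_scope.

(* the R-valued projections, not the R[i]-valued ['Re] and ['Im] of ssrnum *)
Local Notation Re := complex.Re.
Local Notation Im := complex.Im.

Section Complex_valued_functions.
Context {R : realType}.

Definition Cmod (z : R[i]) : R := ComplexField.Normc.normc z.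

Definition Cexp (z : R[i]) : R[i] :=
  (expR (Re z))%:C * (cos (Im z) +i* sin (Im z)).

Definition Cmeasurable_fun d (T : measurableType d) (D : set T)
    (f : T -> R[i]) : Prop :=
  measurable_fun D (fun x => Re (f x)) /\ measurable_fun D (fun x => Im (f x)).

Definition Ccontinuous_on (T : topologicalType) (A : set T)
    (f : T -> R[i]) : Prop :=
  {within A, continuous (fun x => Re (f x))} /\
  {within A, continuous (fun x => Im (f x))}.

Definition Cint d (T : measurableType d) (mu : {measure set T -> \bar R})
    (D : set T) (f : T -> R[i]) : R[i] :=
  (\int[mu]_(x in D) Re (f x)) +i* (\int[mu]_(x in D) Im (f x)).

Definition Cint_oriented (a b : R) (f : R -> R[i]) : R[i] :=
  if a <= b then Cint lebesgue_measure `[a, b] f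
  else - Cint lebesgue_measure `[b, a] f.

Definition LpC d (T : measurableType d) (mu : {measure set T -> \bar R})
    (D : set T) (p : \bar R) (f : T -> R[i]) : Prop :=
  Cmeasurable_fun D f /\
  ('N[mu]_p[((fun x => (Cmod (f x))%:E) \_ D)] < +oo)%E.

End Complex_valued_functions.

Section Test_functions.
Context {R : realType} {V : normedModType R}.

(* C^oo: every iterated directional derivative exists and is differentiable *)
Definition smooth (phi : V -> R) : Prop :=
  forall (vs : seq V) (x : V),
    differentiable (foldr (fun v (g : V -> R) => 'D_v g) phi vs) x.

Definition test_function (Om : set V) (phi : V -> R) : Prop :=
  smooth phi /\
  exists C : set V, [/\ compact C, C `<=` Om & forall x, ~ C x -> phi x = 0].

End Test_functions.

Section Sobolev_interval.
Context {R : realType} (l : R).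
Local Notation mu := (@lebesgue_measure R).
Local Notation I := (`]- l, l[%classic : set R).
Local Notation Ibar := (`[- l, l]%classic : set R).

Definition weak_derivative (f g : R -> R[i]) : Prop :=
  [/\ locally_integrable I (fun x => Re (f x)),
      locally_integrable I (fun x => Im (f x)),
      locally_integrable I (fun x => Re (g x)),
      locally_integrable I (fun x => Im (g x)) &
      forall phi : R -> R, test_function I phi ->
        Cint mu I (fun x => f x * ('D_1 phi x)%:C) =
        - Cint mu I (fun x => g x * (phi x)%:C)].

Definition weakly_differentiable (f : R -> R[i]) : Prop :=
  exists g, weak_derivative f g.

(* A representative of the weak derivative, which is unique up to a.e.
   equality on ]-l, l[; a junk value if [f] is not weakly differentiable. *)
Definition weakD (f : R -> R[i]) : R -> R[i] :=
  xget (fun=> 0) [set g | weak_derivative f g].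

(* W^{k,p}(-l, l); membership does not depend on the representative of [u]. *)
Definition Sobolev (k : nat) (p : \bar R) (u : R -> R[i]) : Prop :=
  (forall j, (j < k)%N -> weakly_differentiable (iter j weakD u)) /\
  (forall j, (j <= k)%N -> LpC mu I p (iter j weakD u)).

Definition abs_continuous (f : R -> R[i]) : Prop :=
  forall eps : R, 0 < eps -> exists2 delta : R, 0 < delta &
    forall (n : nat) (s t : 'I_n -> R),
      (forall i, - l <= s i /\ s i <= t i /\ t i <= l) ->
      trivIset setT (fun i => [set` `]s i, t i[]) ->
      \sum_(i < n) (t i - s i) < delta ->
      \sum_(i < n) Cmod (f (t i) - f (s i)) < eps.

Definition ae_eq_I (f g : R -> R[i]) : Prop :=
  {ae mu, forall x, I x -> f x = g x}.

End Sobolev_interval.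

Section Sobolev_square.
Context {R : realType} (l : R).
Local Notation mu2 := ((@lebesgue_measure R) \x (@lebesgue_measure R))%E.

Definition square : set (R * R) := `]- l, l[%classic `*` `]- l, l[%classic.
Definition closed_square : set (R * R) :=
  `[- l, l]%classic `*` `[- l, l]%classic.

Definition weak_partial (v : R * R) (f g : R * R -> R[i]) : Prop :=
  forall phi : R * R -> R, test_function square phi ->
    Cint mu2 square (fun z => f z * ('D_v phi z)%:C) =
    - Cint mu2 square (fun z => g z * (phi z)%:C).

Definition W1oo_square (f : R * R -> R[i]) : Prop :=
  [/\ LpC mu2 square +oo%E f,
      exists2 g, weak_partial (1, 0) f g & LpC mu2 square +oo%E g &
      exists2 g, weak_partial (0, 1) f g & LpC mu2 square +oo%E g].

End Sobolev_square.

Section Transmutation.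
Context {R : realType} (l : R).
Local Notation mu := (@lebesgue_measure R).
Local Notation I := (`]- l, l[%classic : set R).
Local Notation Ibar := (`[- l, l]%classic : set R).

(* [a] is taken as its continuous representative on [-l, l]; it is only
   required to be positive on the open interval. *)
Definition admissible (a : R -> R) : Prop :=
  [/\ Sobolev l 1 +oo%E (fun x => (a x)%:C) /\ {within Ibar, continuous a},
      forall x, I x -> 0 < a x,
      LpC mu I 2%:E (fun x => (a x)%:C),
      LpC mu I 2%:E (fun x => ((a x)^-1)%:C) &
      a 0 = 1].

Definition quasiD (a : R -> R) (u : R -> R[i]) : R -> R[i] :=
  fun x => (a x ^+ 2)%:C * weakD l u x.

Definition opL (a : R -> R) (u : R -> R[i]) : R -> R[i] :=
  fun x => ((a x ^+ 2)^-1)%:C * weakD l (quasiD a u) x.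

Definition Lp_weighted (a : R -> R) (p : R) (f : R -> R[i]) : Prop :=
  Cmeasurable_fun I f /\
  (\int[mu]_(x in I) ((Cmod (f x)) `^ p * a x ^+ 2)%:E < +oo)%E.

(* [v] is the absolutely continuous representative of a^2 u' on [-l, l].  The
   third clause, automatic once [v] exists, says that the weak derivative used
   in [opL] is not the junk value of [weakD]. *)
Definition quasi_derivative (a : R -> R) (u v : R -> R[i]) : Prop :=
  [/\ abs_continuous l v, ae_eq_I l (quasiD a u) v &
      weakly_differentiable l (quasiD a u)].

Definition domL (a : R -> R) (p : R) (u : R -> R[i]) : Prop :=
  [/\ Sobolev l 1 1%:E u, exists v, quasi_derivative a u v &
      Lp_weighted a p (opL a u)].

(* [e] is taken as its continuous representative on [-l, l]; the initial
   conditions and the values in the kernel representation are pointwise. *)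
Definition is_ea (a : R -> R) (rho : R[i]) (e : R -> R[i]) : Prop :=
  [/\ Sobolev l 1 1%:E e, Ccontinuous_on Ibar e, e 0 = 1,
      exists2 v, quasi_derivative a e v & v 0 = 'i%C * rho &
      ae_eq_I l (fun x => - opL a e x) (fun x => rho ^+ 2 * e x)].

(* [K] is taken as its continuous representative on the closed square. *)
Definition transmutation_kernel (a : R -> R) (e : R[i] -> R -> R[i])
    (K : R -> R -> R[i]) : Prop :=
  [/\ W1oo_square l (fun z => K z.1 z.2),
      Ccontinuous_on (closed_square l) (fun z => K z.1 z.2),
      forall (rho : R[i]) (x : R), Ibar x ->
        e rho x = Cexp ('i%C * rho * x%:C)
          - 'i%C * rho * Cint_oriented (- x) x
              (fun t => K x t * Cexp ('i%C * rho * t%:C)),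
      forall x, Ibar x -> K x x = (1 - (a x)^-1)%:C &
      forall x, Ibar x -> K x (- x) = 0].

Definition opT (K : R -> R -> R[i]) (u : R -> R[i]) : R -> R[i] :=
  fun x => u x - Cint_oriented (- x) x (fun t => K x t * weakD l u t).

End Transmutation.

(* Main.v *)
(* The theorem follows from the integral equation
     T_a u (x) = u(0) + u'(0) A(x)
                 + \int_0^x a^-2(s) \int_0^s a^2(r) T_a u'' (r) dr ds
   with A(x) = \int_0^x a^-2, whose right-hand side can be differentiated twice.
   For u = e^{st} it is the integrated form of the equation solved by
   e_a(-is, .) = T_a e^{st}.  For fixed x, the difference of the two sides is of
   the form c1 u'(0) + c2 u''(0) + M(u''') with M a bounded linear functional on
   L^1(-l, l); since it vanishes on all exponentials, letting s tend to 0 gives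
   c1 = c2 = 0, and then M(e^{st}) = 0 for all s.  Phragmen's argument shows M = 0:
   exp(-e^{N(t - x)}) is a locally uniformly convergent series of exponentials
   e^{Nkt} and tends boundedly to the indicator of t < x, so M vanishes on
   half-lines, hence on measurable sets, hence on L^1.  For complex K, this is
   applied to eps u - \int_{-x}^x k u' in place of T_a u, with (eps, k) equal to
   (1, Re K) and to (0, Im K). *)
Require Import Defs.
From mathcomp Require Import all_boot all_order all_algebra.
From mathcomp Require Import all_classical all_reals all_analysis.
From mathcomp Require Import complex.
From mathcomp Require Import measurable_realfun finmap ring lra.
Set Implicit Arguments.
Unset Strict Implicit.
Unset Printing Implicit Defensive.
Import Order.TTheory GRing.Theory Num.Theory.
Import numFieldNormedType.Exports.
Import HBNNSimple.
Local Open Scope classical_set_scope.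
Local Open Scope complex_scope.
Local Open Scope ring_scope.

(** * Uniqueness of the Laplace transform *)

(** Differentiating T_a u twice under the integral sign would require second derivatives of K, whose
    regularity stops at W^{1,oo}. In the integrated equation the derivatives fall on explicit
    primitives, and K enters only through operators that send L^1 to bounded functions continuous on
    ]-l, l[. The three terms of the difference come from Taylor's formula with integral remainder:
    u(0) cancels, and u = e^{st} has u'(0) = s, u''(0) = s^2 and u''' = s^3 e^{st}, so the identity
    on exponentials reads s c1 + s^2 c2 + s^3 M(e^{st}) = 0. With rho = -is and s real, the
    exponentials in the kernel representation are real; Re K then goes with the initial data (1, s)
    and Im K with (0, 0), which is the meaning of eps. On a bounded interval W^{3,p} embeds in
    W^{3,1}, so one argument with u''' in L^1 serves every p. Weak derivatives are exchanged for
    primitives by testing against smooth approximations of indicators and passing to the limit at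
    Lebesgue points. *)

Section integrable_on_interval.
Context {R : realType} (l : R).
Local Notation mu := (@lebesgue_measure R).
Local Notation I := (`]- l, l[%classic : set R).

Implicit Types f g : R -> R.

Definition L1I (f : R -> R) : Prop := mu.-integrable I (EFin \o f).

Definition normL1 (f : R -> R) : R := \int[mu]_(x in I) `|f x|.

Lemma measure_oitv_fin : (mu I < +oo)%E.
Proof. by rewrite lebesgue_measure_itv/=; case: ifPn => // _; rewrite -EFinB ltry. Qed.

Lemma measure_oitv : 0 < l -> mu I = (2 * l)%:E.
Proof.
move=> l0; rewrite lebesgue_measure_itv/= lte_fin gtrN// -EFinB.
by congr EFin; lra.
Qed.

Lemma L1I_measurable f : L1I f -> measurable_fun I f.
Proof. by move=> /integrableP[/measurable_EFinP]. Qed.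

Lemma L1I_cst c : L1I (cst c).
Proof.
apply: measurable_bounded_integrable => //; first exact: measure_oitv_fin.
by exists `|c|; split => // M /ltW cM x _.
Qed.

Lemma L1ID f g : L1I f -> L1I g -> L1I (fun x => f x + g x).
Proof. by move=> If Ig; by have := integrableD _ If Ig => /(_ (measurable_itv _)). Qed.

Lemma L1IB f g : L1I f -> L1I g -> L1I (fun x => f x - g x).
Proof. by move=> If Ig; by have := integrableB _ If Ig => /(_ (measurable_itv _)). Qed.

Lemma L1IZ c f : L1I f -> L1I (fun x => c * f x).
Proof. by move=> If; by have := integrableZl _ c If => /(_ (measurable_itv _)). Qed.

Lemma L1I_le f g : measurable_fun I f -> (forall x, I x -> `|f x| <= g x) ->
  L1I g -> L1I f.
Proof.
move=> mf fg Ig; apply: (@le_integrable _ _ _ mu _ _ _ (EFin \o g)) => //.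
  exact/measurable_EFinP.
by move=> x Ix /=; rewrite lee_fin (le_trans (fg _ Ix))// ler_norm.
Qed.

Lemma L1I_bounded f C : measurable_fun I f -> (forall x, I x -> `|f x| <= C) ->
  L1I f.
Proof. by move=> mf fC; apply: (L1I_le mf fC); exact: L1I_cst. Qed.

Lemma L1IM f g C : L1I f -> measurable_fun I g ->
  (forall x, I x -> `|g x| <= C) -> L1I (fun x => f x * g x).
Proof.
move=> If mg gC; apply: (L1I_le (g := fun x => C * `|f x|)).
- by apply: measurable_funM => //; exact: L1I_measurable.
- move=> x Ix; rewrite normrM mulrC ler_wpM2r// gC//.
- by apply: L1IZ; exact: integrable_norm.
Qed.

Lemma normL1_ge0 f : 0 <= normL1 f.
Proof. exact: Rintegral_ge0. Qed.

Lemma normL1_cst c : 0 < l -> normL1 (cst c) = `|c| * (2 * l).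
Proof.
move=> l0; rewrite /normL1 [LHS](@Rintegral_cst _ _ _ mu I _ `|c|)//; congr (_ * _).
rewrite -[RHS]/(fine (2 * l)%:E); congr fine; exact: measure_oitv.
Qed.

Lemma normL1_le f g : L1I f -> L1I g -> (forall x, I x -> `|f x| <= g x) ->
  normL1 f <= \int[mu]_(x in I) g x.
Proof. by move=> If Ig fg; apply: le_Rintegral => //; exact: integrable_norm. Qed.

(** Convergence in [normL1], and not just of the integrals, is what every functional bounded by
    [normL1] can use. *)
Lemma normL1_dominated (f_ : (R -> R)^nat) f g :
  (forall n, measurable_fun I (f_ n)) -> measurable_fun I f ->
  {ae mu, forall x, I x -> f_ ^~ x @ \oo --> f x} -> L1I g ->
  (forall n x, I x -> `|f_ n x| <= g x) ->
  L1I f /\ normL1 (fun x => f_ n x - f x) @[n --> \oo] --> (0:R).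
Proof.
move=> mf_ mf ff Ig fg.
have [] := @dominated_convergence _ _ _ mu I _
  (fun n => EFin \o f_ n) (EFin \o f) (EFin \o g).
- exact: measurable_itv.
- by move=> n; apply/measurable_EFinP; exact: mf_.
- by apply/measurable_EFinP; exact: mf.
- move: ff; apply: filterS; first exact: (ae_filter_ringOfSetsType mu).
  by move=> x + Ix => /(_ Ix) fx; apply/fine_cvgP; split => //; exact: nearW.
- exact: Ig.
- by apply: nearW => x n Ix; rewrite lee_fin fg.
move=> If cv _; split => //.
rewrite -(fine0) in cv *; exact: fine_cvg cv.
Qed.

End integrable_on_interval.

Section exponential_uniqueness.
Context {R : realType} (l : R).
Local Notation mu := (@lebesgue_measure R).
Local Notation I := (`]- l, l[%classic : set R).
Implicit Types f g : R -> R.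

(** Linearity is asked on integrable functions only, since integrals take default values elsewhere.
    Functions are not identified modulo null sets; the bound by [normL1] makes [M] blind to them. *)
Definition bounded_functional (M : (R -> R) -> R) : Prop :=
  [/\ forall f g, L1I l f -> L1I l g -> M (fun x => f x + g x) = M f + M g,
      forall c f, L1I l f -> M (fun x => c * f x) = c * M f &
      exists C, forall f, L1I l f -> `|M f| <= C * normL1 l f].

Variable M : (R -> R) -> R.
Hypothesis bM : bounded_functional M.

Lemma functionalD f g : L1I l f -> L1I l g ->
  M (fun x => f x + g x) = M f + M g.
Proof. by case: bM => + _ _; exact. Qed.

Lemma functionalZ c f : L1I l f -> M (fun x => c * f x) = c * M f.
Proof. by case: bM => _ + _; exact. Qed.

Lemma functionalB f g : L1I l f -> L1I l g ->
  M (fun x => f x - g x) = M f - M g.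
Proof.
move=> If Ig; rewrite -(mulN1r (M g)) -functionalZ// -functionalD//.
  by under eq_fun do rewrite -mulN1r.
exact: L1IZ.
Qed.

Lemma functional0 : M (fun=> 0) = 0.
Proof.
rewrite (_ : (fun=> 0) = (fun x : R => 0 * (cst 0 : R -> R) x)).
  by rewrite functionalZ ?mul0r //; apply: (L1I_cst l 0).
by apply/funext => x; rewrite mul0r.
Qed.

Lemma functional_sum (J : Type) (s : seq J) (f : J -> R -> R) :
  (forall j, L1I l (f j)) ->
  L1I l (fun x => \sum_(j <- s) f j x) /\
  M (fun x => \sum_(j <- s) f j x) = \sum_(j <- s) M (f j).
Proof.
move=> If; elim: s => [|j s [Is Ms]].
  split; last first.
    rewrite big_nil -[RHS]functional0; congr M; apply/funext => x.
    by rewrite big_nil.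
  by under eq_fun do rewrite big_nil; exact: L1I_cst.
split; first by under eq_fun do rewrite big_cons; exact: L1ID.
by under eq_fun do rewrite big_cons; rewrite functionalD// Ms big_cons.
Qed.

Lemma functional_cvg (f_ : (R -> R)^nat) f g :
  (forall n, measurable_fun I (f_ n)) -> measurable_fun I f ->
  {ae mu, forall x, I x -> f_ ^~ x @ \oo --> f x} -> L1I l g ->
  (forall n x, I x -> `|f_ n x| <= g x) -> M (f_ n) @[n --> \oo] --> M f.
Proof.
move=> mf_ mf ff Ig fg.
have [If cvf] := normL1_dominated mf_ mf ff Ig fg.
case: bM => _ _ [C MC].
apply/subr_cvg0; apply: norm_cvg0.
have If_ n : L1I l (f_ n) by apply: L1I_le (fg n) Ig.
apply: (@squeeze_cvgr _ _ _ _ (fun=> 0)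
  (fun n => C * normL1 l (fun x => f_ n x - f x))).
- apply: nearW => n; rewrite normr_ge0/= -functionalB//; apply: MC.
  exact: L1IB.
- exact: cvg_cst.
- by rewrite -(mulr0 C); apply: cvgMr.
Qed.

Definition expo (s : R) : R -> R := fun x => expR (s * x).

Lemma measurable_expo s (D : set R) : measurable_fun D (expo s).
Proof.
apply: measurable_funTS; apply: continuous_measurable_fun => x.
by apply: continuous_comp; [exact: mulrl_continuous|exact: continuous_expR].
Qed.

Lemma expo_le s x : I x -> `|expo s x| <= expR (`|s| * l).
Proof.
move=> /=; rewrite in_itv/= => /andP[lx xl]; rewrite ger0_norm ?expR_ge0//.
rewrite ler_expR (le_trans (ler_norm _))// normrM ler_wpM2l//.
by rewrite ler_norml; lra.
Qed.

Lemma L1I_expo s : L1I l (expo s).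
Proof. by apply: L1I_bounded (@expo_le s); exact: measurable_expo. Qed.

Hypothesis Mexpo : forall n : nat, M (expo n%:R) = 0.

(* For large [N], [exp(-e^{N(t-x)})], a uniformly convergent series of
   exponentials [e^{Nkt}], is close to the indicator of [t < x]. *)
Let phragmen (x : R) (N : nat) (t : R) : R := expR (- expR (N%:R * (t - x))).

Let functional_phragmen x N : M (phragmen x N) = 0.
Proof.
pose y t := - expR (N%:R * (t - x)).
pose f_ n t := series (exp_coeff (y t)) n.
pose c k : R := k`!%:R^-1 * (- expR (- (N%:R * x))) ^+ k.
have fE n : f_ n = fun t => \sum_(k <- index_iota 0 n) c k * expo (k * N)%:R t.
  apply/funext => t.
  rewrite /f_ /series/=; apply: eq_bigr => k _.
  rewrite exp_coeffE /c -mulrA; congr (_ * _).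
  have -> : expo (k * N)%:R t = expR (N%:R * t) ^+ k.
    by rewrite /expo natrM -expRM_natr; congr expR; ring.
  rewrite -exprMn; congr (_ ^+ k).
  by rewrite mulNr -expRD /y mulrBr addrC.
have Ic k : L1I l (fun t => c k * expo (k * N)%:R t).
  by apply: L1IZ; exact: L1I_expo.
have If_ n : L1I l (f_ n) by rewrite fE; have [] := functional_sum (index_iota 0 n) Ic.
have Mf_ n : M (f_ n) = 0.
  rewrite fE; have [_ ->] := functional_sum (index_iota 0 n) Ic.
  by rewrite big1// => k _; rewrite functionalZ ?Mexpo ?mulr0//; exact: L1I_expo.
have yM t : I t -> `|y t| <= expR (N%:R * (l - x)).
  rewrite /= in_itv/= => /andP[_ tl].
  rewrite normrN ger0_norm ?expR_ge0// ler_expR ler_wpM2l//; lra.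
have : M (f_ n) @[n --> \oo] --> M (phragmen x N).
  (* The partial sums at [y t] are bounded by exp |y t|, and |y t| <= e^{N(l - x)} on the
     interval. *)
  apply: (functional_cvg (g := cst (expR (expR (N%:R * (l - x)))))).
  - by move=> n; exact: L1I_measurable.
  - apply: measurable_funTS; apply: continuous_measurable_fun => t.
    apply: continuous_comp; last exact: continuous_expR.
    apply: continuousN; apply: continuous_comp; last exact: continuous_expR.
    apply: cvgMr; apply: cvgB; [exact: cvg_id|exact: cvg_cst].
  - by apply: nearW => t _; exact: is_cvg_series_exp_coeff.
  - exact: L1I_cst.
  - move=> n t It; apply: (@le_trans _ _ (expR `|y t|)); last first.
      by rewrite ler_expR yM.
    have : nondecreasing_seq (series (exp_coeff `|y t|)).
      by apply: nondecreasing_series => k _ _; exact: exp_coeff_ge0.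
    move=> /nondecreasing_cvgn_le /(_ (is_cvg_series_exp_coeff _) n).
    apply: le_trans; rewrite -normed_series_exp_coeff.
    exact: ler_norm_sum.
have -> : (fun n => M (f_ n)) = cst 0 by apply/funext => n; exact: Mf_.
by move=> /(cvg_unique _ (cvg_cst _)) => ->.
Qed.

Let functional_indic_lt x : M \1_(`]-oo, x[%classic) = 0.
Proof.
have : M (phragmen x N) @[N --> \oo] --> M \1_(`]-oo, x[%classic).
  apply: (functional_cvg (g := cst 1)).
  - move=> N; apply: measurable_funTS; apply: continuous_measurable_fun => t.
    apply: continuous_comp; last exact: continuous_expR.
    apply: continuousN; apply: continuous_comp; last exact: continuous_expR.
    apply: cvgMr; apply: cvgB; [exact: cvg_id|exact: cvg_cst].
  - exact: measurable_indic.
  (* At t = x the sequence is constantly e^{-1}, which is not the value of the indicator. *)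
  - exists [set x]; split; first exact: measurable_set1.
      exact: lebesgue_measure_set1.
    move=> t; apply: contra_notP => /eqP tx _.
    have eE N : phragmen x N t = expR (- expR (t - x) ^+ N).
      by rewrite /phragmen mulrC expRM_natr.
    rewrite (_ : phragmen x ^~ t = fun N => expR (- expR (t - x) ^+ N)); last first.
      by apply/funext.
    rewrite indicE mem_setE in_itv/=.
    have [tltx|xltt|/eqP] := ltgtP t x; last by rewrite (negbTE tx).
    + rewrite -expR0 -oppr0.
      apply: continuous_cvg; first exact: continuous_expR.
      apply: cvgN; apply: cvg_expr.
      by rewrite ger0_norm ?expR_ge0// -expR0 ltr_expR subr_lt0.
    (* With q = e^{t - x} > 1, the inequality 1 + q^N <= exp(q^N) gives exp(-q^N) <= q^{-N}. *)
    + apply: (@squeeze_cvgr _ _ _ _ (fun=> 0) (fun N => (expR (x - t)) ^+ N)).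
      * apply: nearW => N; rewrite expR_ge0/= expRN -(opprB t x) expRN exprVn.
        rewrite lef_pV2 ?posrE ?expR_gt0 ?exprn_gt0 ?expR_gt0//.
        by rewrite (le_trans _ (expR_ge1Dx _))// lerDr.
      * exact: cvg_cst.
      * by apply: cvg_expr; rewrite ger0_norm ?expR_ge0// -expR0 ltr_expR subr_lt0.
  - exact: L1I_cst.
  - move=> N t _; rewrite ger0_norm ?expR_ge0//.
    by rewrite -expR0 ler_expR oppr_le0 expR_ge0.
have -> : (fun N => M (phragmen x N)) = cst 0.
  by apply/funext => N; exact: functional_phragmen.
by move=> /(cvg_unique _ (cvg_cst _)) => ->.
Qed.

Lemma L1I_indic (A : set R) : measurable A -> L1I l \1_A.
Proof.
move=> mA; apply: (@L1I_bounded _ _ _ 1); first exact: measurable_indic.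
by move=> x _; rewrite indicE; case: (_ \in _); rewrite ?normr1 ?normr0.
Qed.

(** Open half-lines are stable under intersection and generate the Borel sets, so Dynkin's theorem
    applies. Complements need [M] to vanish on the constant 1, which is the exponential of rate
    0. *)
Let functional_indic (A : set R) : measurable A -> M \1_A = 0.
Proof.
have M1 : M (cst 1) = 0.
  by rewrite -[RHS](Mexpo 0); congr M; apply/funext => x; rewrite /expo mul0r expR0.
move=> mA.
have sA : (@RGenInftyO.G R).-sigma.-measurable A.
  by rewrite -RGenInftyO.measurableE; exact: mA.
move: A sA {mA}.
apply: (@dynkin_induction _ _ (@RGenInftyO.G R) (fun A => M \1_A = 0)).
- exact: RGenInftyO.measurableE.
- move=> _ _ [x ->] [y ->]; exists (Num.min x y).
  by apply/seteqP; split => t /=; rewrite !in_itv/= lt_min => /andP.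
- by rewrite -[RHS]M1; congr M; apply/funext => x; rewrite indicT.
- by move=> _ [x ->]; exact: functional_indic_lt.
- move=> S mS MS; rewrite (_ : \1_(~` S) = fun x => cst 1 x - \1_S x).
    by rewrite functionalB ?M1 ?MS ?subr0//; [exact: L1I_cst|exact: L1I_indic].
  apply/funext => x; rewrite indicC indicE.
  by case: (x \in S); rewrite /= ?subrr ?subr0.
- move=> F mF tF MF.
  have : M (fun x => \sum_(k <- index_iota 0 n) \1_(F k) x) @[n --> \oo] -->
      M \1_(\bigcup_k F k).
    have IF k : L1I l \1_(F k) by exact: L1I_indic.
    apply: (functional_cvg (g := cst 1)).
    + by move=> n; have [/L1I_measurable] := functional_sum (index_iota 0 n) IF.
    + by apply: measurable_indic; exact: bigcup_measurable.
    + apply: nearW => x _.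
      suff : (\sum_(k <- index_iota 0 n) (\1_(F k) x : R))%:E @[n --> \oo] -->
          (\1_(\bigcup_k F k) x : R)%:E by move=> h; have [] := (fine_cvgP _ _).1 h.
      rewrite indic_bigcup//; under eq_fun do rewrite -sumEFin.
      by apply: is_cvg_nneseries => k _ _; rewrite lee_fin.
    + exact: L1I_cst.
    + move=> n x _; rewrite ger0_norm ?sumr_ge0//.
      rewrite (@le_trans _ _ (\1_(\bigcup_k F k) x))//; last first.
        by rewrite indicE; case: (_ \in _).
      rewrite -lee_fin indic_bigcup// -sumEFin.
      by apply: nneseries_lim_ge => k _ _; rewrite lee_fin.
  rewrite (_ : (fun n => _) = cst 0).
    by move=> /(cvg_unique _ (cvg_cst _)) => ->.
  apply/funext => n; have [_ ->] := functional_sum (index_iota 0 n) (fun k => L1I_indic (mF k)).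
  by rewrite big1.
Qed.

(** The simple approximations increase to [f], so [f] itself dominates them. *)
Let functional_ge0 f : L1I l f -> (forall x, I x -> 0 <= f x) -> M f = 0.
Proof.
move=> If f0.
have mf : measurable_fun I (EFin \o f).
  by apply/measurable_EFinP; exact: L1I_measurable.
have mI : measurable I by exact: measurable_itv.
pose f_ n : R -> R := nnsfun_approx mI mf n.
have cvf x : I x -> f_ ^~ x @ \oo --> f x.
  move=> Ix; have f0' t : I t -> (0 <= (EFin \o f) t)%E.
    by move=> It; rewrite lee_fin f0.
  have h := cvg_nnsfun_approx mI mf f0' Ix.
  by have [] := (fine_cvgP _ _).1 h.
have f_le n x : I x -> `|f_ n x| <= f x.
  move=> Ix; rewrite ger0_norm; last exact: fun_ge0.
  rewrite -(cvg_lim _ (cvf _ Ix))//; apply: nondecreasing_cvgn_le.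
    by move=> a b /(nd_nnsfun_approx mI mf)/lefP/(_ x).
  by apply/cvg_ex; exists (f x); exact: cvf.
have : M (f_ n) @[n --> \oo] --> M f.
  apply: (functional_cvg (g := f)) => //.
  - by move=> n; apply: measurable_funTS; exact: measurable_funPT.
  - exact: L1I_measurable.
  - exact: nearW.
rewrite (_ : (fun n => _) = cst 0).
  by move=> /(cvg_unique _ (cvg_cst _)) => ->.
apply/funext => n; rewrite /f_; set g := nnsfun_approx _ _ _.
pose h (y : R) := fun x => y * \1_(g @^-1` [set y]) x.
have Ih y : L1I l (h y).
  by apply: L1IZ; apply: L1I_indic; exact: measurable_sfunP.
rewrite (_ : (g : R -> R) = fun x => \sum_(y <- fset_set (range g)) h y x).
  have [_ ->] := functional_sum (fset_set (range g)) Ih.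
  rewrite big1// => y _; rewrite functionalZ.
    by rewrite functional_indic ?mulr0//; exact: measurable_sfunP.
  by apply: L1I_indic; exact: measurable_sfunP.
by apply/funext => x; rewrite fimfunE fsbig_finite.
Qed.

Lemma functional_expo_eq0 f : L1I l f -> M f = 0.
Proof.
move=> If; rewrite (_ : f = fun x => f^\+ x - f^\- x).
  have Ip : L1I l f^\+ by apply: integrable_funrpos => //; exact: measurable_itv.
  have In : L1I l f^\- by apply: integrable_funrneg => //; exact: measurable_itv.
  by rewrite functionalB// !functional_ge0 ?subrr// => x _;
    rewrite ?funrpos_ge0 ?funrneg_ge0.
by rewrite -[LHS](funrposBneg f).
Qed.

End exponential_uniqueness.

(** Taking s = 1 shows B >= 0; then s = min(1, e / (B + 1)) brings the bound below e. It serves to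
    read off the coefficients of an expansion as s tends to 0. *)
Lemma norm_le_small {R : realType} (x B : R) :
  (forall s, 0 < s -> s <= 1 -> `|x| <= s * B) -> x = 0.
Proof.
move=> h; apply/eqP; rewrite -normr_le0; apply/ler_addgt0Pr => e e0.
have B0 : 0 <= B by have := le_trans (normr_ge0 x) (h 1 ltr01 (lexx _)); rewrite mul1r.
pose s := Num.min 1 (e / (B + 1)).
have s0 : 0 < s by rewrite lt_min ltr01/= divr_gt0// ltr_wpDl.
rewrite add0r (le_trans (h s s0 _)) ?ge_min ?lexx//.
rewrite (@le_trans _ _ (e / (B + 1) * B))//.
  by rewrite ler_wpM2r// ge_min lexx orbT.
by rewrite mulrAC ler_pdivrMr ?ltr_wpDl// ler_wpM2l ?(ltW e0)// lerDl.
Qed.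

(** On 0 < s <= 1 the numbers [M (expo s)] stay bounded, so dividing by s and then by s^2 bounds
    [D1] and then [D2] by a multiple of s. What remains is s^3 [M (expo s)] = 0. *)
Lemma functional_expansion_eq0 {R : realType} (l D1 D2 : R)
    (M : (R -> R) -> R) : 0 < l -> bounded_functional l M ->
  (forall s, s * D1 + s ^+ 2 * D2 + s ^+ 3 * M (expo s) = 0) ->
  [/\ D1 = 0, D2 = 0 & forall f, L1I l f -> M f = 0].
Proof.
move=> l0 bM h.
have [B MB] : exists B, forall s, 0 < s -> s <= 1 -> `|M (expo s)| <= B.
  case: bM => _ _ [C MC]; exists (`|C| * (expR l * (2 * l))) => s s0 s1.
  rewrite (le_trans (MC _ (L1I_expo _ _)))//.
  rewrite (le_trans (ler_wpM2r (normL1_ge0 _ _) (ler_norm C)))// ler_wpM2l//.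
  rewrite (le_trans (normL1_le (L1I_expo _ _) (L1I_cst l (expR l)) _))//.
    move=> x Ix; rewrite (le_trans (expo_le _ Ix))// ler_expR.
    by rewrite gtr0_norm// ler_piMl// ltW.
  have := normL1_cst (expR l) l0; rewrite /normL1 /= ger0_norm ?expR_ge0// => <-.
  exact: lexx.
have B0 : 0 <= B by rewrite (le_trans _ (MB 1 _ _)).
have D10 : D1 = 0.
  apply: (@norm_le_small _ _ (`|D2| + B)) => s s0 s1.
  have -> : D1 = - (s * (D2 + s * M (expo s))).
    apply: (mulfI (lt0r_neq0 s0)); apply/eqP; rewrite -subr_eq0.
    by apply/eqP; rewrite -[RHS](h s); ring.
  rewrite normrN normrM gtr0_norm// ler_wpM2l ?(ltW s0)// (le_trans (ler_normD _ _))//.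
  rewrite lerD2l normrM gtr0_norm// (le_trans _ (MB s _ _))//.
  by rewrite ler_piMl.
have D20 : D2 = 0.
  apply: (@norm_le_small _ _ B) => s s0 s1.
  have -> : D2 = - (s * M (expo s)).
    apply: (mulfI (lt0r_neq0 (exprn_gt0 2 s0))); apply/eqP; rewrite -subr_eq0.
    by apply/eqP; rewrite -[RHS](h s) D10; ring.
  by rewrite normrN normrM gtr0_norm// ler_wpM2l ?MB ?(ltW s0).
have Ms s : s != 0 -> M (expo s) = 0.
  move=> s0; apply: (mulfI (expf_neq0 3 s0)).
  by rewrite mulr0 -[RHS](h s) D10 D20; ring.
split => // f If; apply: functional_expo_eq0 If => //; case=> [|n]; last first.
  by apply: Ms; rewrite pnatr_eq0.
(* The rate 0 is lost in the division by s^3; it is recovered as the limit of the rates 1/(n +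
   1). *)
have : M (expo n.+1%:R^-1) @[n --> \oo] --> M (expo 0).
  apply: (functional_cvg bM (g := cst (expR l))).
  - by move=> n; exact: measurable_expo.
  - exact: measurable_expo.
  - apply: nearW => x _; apply: continuous_cvg; first exact: continuous_expR.
    by apply: cvgMl; exact: cvg_harmonic.
  - exact: L1I_cst.
  - move=> n x Ix; rewrite (le_trans (expo_le _ Ix))// ler_expR.
    rewrite ger0_norm ?invr_ge0// ler_piMl//; first exact: ltW.
    by rewrite invf_le1 ?ltr0n// ler1n.
rewrite (_ : (fun n => _) = cst 0).
  by move=> /(cvg_unique _ (cvg_cst _)) => ->.
by apply/funext => n; rewrite Ms// invr_eq0 pnatr_eq0.
Qed.

(** * Integral operators with bounded kernels *)

Section kernel_operators.
Context {R : realType} (l : R).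
Local Notation mu := (@lebesgue_measure R).
Local Notation I := (`]- l, l[%classic : set R).
Implicit Types (f g : R -> R) (kap : R -> R -> R).

(** Continuity in the first variable is asked for almost every t only, because the kernels below
    jump across t = x or t = -x. *)
Definition good_kernel kap : Prop :=
  [/\ exists C, forall x t, `|kap x t| <= C,
      forall x, measurable_fun I (kap x) &
      forall x, I x -> {ae mu, forall t, I t -> {for x, continuous (kap ^~ t)}}].

Definition kop kap f : R -> R := fun x => \int[mu]_(t in I) (kap x t * f t).

Lemma kop_eq kap f g : (forall x, I x -> f x = g x) -> kop kap f = kop kap g.
Proof.
move=> fg; apply/funext => x; apply: eq_Rintegral => t /set_mem It.
by rewrite fg.
Qed.

(** The bound is uniform in x and holds at every point, not almost everywhere: such an operator maps
    L^1 into bounded functions, and its evaluation at each point is a bounded functional. *)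
Definition bounded_operator (P : (R -> R) -> R -> R) : Prop :=
  [/\ forall f g x, L1I l f -> L1I l g ->
        P (fun t => f t + g t) x = P f x + P g x,
      forall c f x, L1I l f -> P (fun t => c * f t) x = c * P f x,
      exists C, forall f x, L1I l f -> `|P f x| <= C * normL1 l f &
      forall f, L1I l f -> measurable_fun I (P f)].

Section one_kernel.
Variable kap : R -> R -> R.
Hypothesis hkap : good_kernel kap.

Lemma L1I_kernel f x : L1I l f -> L1I l (fun t => kap x t * f t).
Proof.
case: hkap => -[C kC] mk _ If.
rewrite (_ : (fun t => _) = fun t => f t * kap x t); last first.
  by apply/funext => t; rewrite mulrC.
by apply: (@L1IM _ _ _ _ C).
Qed.

(** For fixed x the exceptional t form a null set, so along any sequence tending to x dominated
    convergence applies with bound C |f|. *)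
Lemma kop_continuous f x : L1I l f -> I x -> {for x, continuous (kop kap f)}.
Proof.
move=> If Ix; have [[C kC] mk ck] := hkap.
apply/continuous_withinNx; apply/cvgr_dnbhsP => u [ux cu].
have IC : L1I l (fun t => C * `|f t|) by apply: L1IZ; exact: integrable_norm.
have m_ n : measurable_fun I (fun t => kap (u n) t * f t).
  by apply: (@L1I_measurable _ l); exact: L1I_kernel.
have m : measurable_fun I (fun t => kap x t * f t).
  by apply: (@L1I_measurable _ l); exact: L1I_kernel.
have ae : {ae mu, forall t, I t ->
    (fun n => kap (u n) t * f t) @ \oo --> kap x t * f t}.
  move: (ck x Ix); apply: filterS; first exact: (ae_filter_ringOfSetsType mu).
  move=> t + It => /(_ It) ct; apply: cvgMl.
  exact: (@cvg_comp _ _ _ u (kap ^~ t) _ _ _ cu ct).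
have bd n t : I t -> `|kap (u n) t * f t| <= C * `|f t|.
  by move=> It; rewrite normrM ler_wpM2r.
have [_ cv] := normL1_dominated m_ m ae IC bd.
apply/subr_cvg0; apply: norm_cvg0.
apply: (@squeeze_cvgr _ _ _ _ (fun=> 0)
  (fun n => normL1 l (fun t => kap (u n) t * f t - kap x t * f t))).
- apply: nearW => n; rewrite normr_ge0/= /kop -RintegralB//;
    [|exact: L1I_kernel|exact: L1I_kernel].
  have Id : L1I l (fun t => kap (u n) t * f t - kap x t * f t).
    by apply: L1IB; exact: L1I_kernel.
  by rewrite (le_trans (le_normr_Rintegral _ Id))//; exact: measurable_itv.
- exact: cvg_cst.
- exact: cv.
Qed.

Lemma kop_bounded_operator : bounded_operator (kop kap).
Proof.
split.
- move=> f g x If Ig; rewrite /kop -RintegralD//;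
    [|exact: L1I_kernel|exact: L1I_kernel].
  by apply: eq_Rintegral => t _; rewrite mulrDr.
- move=> c f x If; rewrite /kop -RintegralZl//;
    [|exact: L1I_kernel].
  by apply: eq_Rintegral => t _; rewrite mulrCA.
- have [[C kC] mk _] := hkap; exists C => f x If.
  rewrite /kop (le_trans (le_normr_Rintegral _ (L1I_kernel x If)))//.
  rewrite /normL1 -RintegralZl//; last exact: integrable_norm.
  apply: le_Rintegral => //.
  + by apply: integrable_norm; exact: L1I_kernel.
  + by apply: L1IZ; exact: integrable_norm.
  + by move=> t _; rewrite normrM ler_wpM2r.
- move=> f If; apply: open_continuous_measurable_fun; first exact: interval_open.
  by move=> x /set_mem; exact: kop_continuous.
Qed.

End one_kernel.

Lemma bounded_operator_L1I P f : bounded_operator P -> L1I l f -> L1I l (P f).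
Proof.
by case=> _ _ [C PC] mP If; apply: (@L1I_bounded _ _ _ (C * normL1 l f)) => //; auto.
Qed.

Lemma bounded_operator_L1IM P al f : bounded_operator P -> L1I l al -> L1I l f ->
  L1I l (fun t => al t * P f t).
Proof.
by case=> _ _ [C PC] mP Ial If; apply: (@L1IM _ _ _ _ (C * normL1 l f)) => //; auto.
Qed.

(** Since [Q f] is bounded, an integrable multiplier [al] brings it back to L^1. The multiplier a^-2
    is handled as an integrable function, with no bound up to the endpoints. *)
Lemma bounded_operator_comp P Q al :
  bounded_operator P -> bounded_operator Q -> L1I l al ->
  bounded_operator (fun f => P (fun t => al t * Q f t)).
Proof.
move=> bP bQ Ial; have IalQ f : L1I l f -> L1I l (fun t => al t * Q f t).
  by move=> If; exact: bounded_operator_L1IM.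
have [PD PZ [C PC] mP] := bP; have [QD QZ [C' QC] mQ] := bQ.
split.
- move=> f g x If Ig; rewrite -PD; [|exact: IalQ|exact: IalQ].
  by congr (P _ x); apply/funext => t; rewrite QD// mulrDr.
- move=> c f x If; rewrite -PZ; last exact: IalQ.
  by congr (P _ x); apply/funext => t; rewrite QZ// mulrCA.
- exists (`|C| * (`|C'| * normL1 l al)) => f x If.
  rewrite (le_trans (PC _ _ (IalQ _ If)))//.
  rewrite (le_trans (ler_wpM2r (normL1_ge0 _ _) (ler_norm C)))//.
  rewrite -!mulrA ler_wpM2l// (mulrC (normL1 l al)) mulrA.
  rewrite [leRHS]mulrC /normL1 -[leRHS]mulrC -[X in X * _]/(`|C'| * normL1 l f).
  rewrite -RintegralZl//; last exact: integrable_norm.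
  apply: normL1_le; first exact: IalQ.
    by apply: L1IZ; exact: integrable_norm.
  move=> t It; rewrite normrM mulrC ler_wpM2r// (le_trans (QC _ _ If))//.
  by rewrite ler_wpM2r ?normL1_ge0// ler_norm.
- by move=> f If; apply: mP; exact: IalQ.
Qed.

Lemma bounded_operator_lincomb c d P Q :
  bounded_operator P -> bounded_operator Q ->
  bounded_operator (fun f x => c * P f x + d * Q f x).
Proof.
move=> [PD PZ [C PC] mP] [QD QZ [C' QC] mQ]; split.
- by move=> f g x If Ig; rewrite PD// QD//; ring.
- by move=> k f x If; rewrite PZ// QZ//; ring.
- exists (`|c| * C + `|d| * C') => f x If.
  rewrite (le_trans (ler_normD _ _))// !normrM mulrDl -!mulrA.
  by rewrite lerD// ler_wpM2l; auto.
- by move=> f If; apply: measurable_funD; apply: measurable_funM => //; auto.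
Qed.

Lemma bounded_operator_at P x : bounded_operator P ->
  bounded_functional l (fun f => P f x).
Proof. by move=> [PD PZ [C PC] mP]; split; [auto|auto|exists C; auto]. Qed.

End kernel_operators.

(** * The oriented primitive and the fundamental theorem of calculus *)

Section primitive.
Context {R : realType} (l : R).
Local Notation mu := (@lebesgue_measure R).
Local Notation I := (`]- l, l[%classic : set R).
Implicit Types (f g : R -> R) (x y C : R).

Lemma near_indic_le (x t : R) : t != x ->
  \forall y \near x, (t <= y) = (t <= x) /\ (y < t) = (x < t).
Proof.
move=> tx; have d0 : 0 < `|t - x| by rewrite normr_gt0 subr_eq0.
near=> y.
have : `|x - y| < `|t - x|.
  by near: y; apply: (@cvgr_dist_lt _ _ _ (nbhs x) _ id x) => //; exact: cvg_id.
have [tltx|xltt|/eqP] := ltgtP t x; last by rewrite (negbTE tx).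
- rewrite (ltr0_norm (x := t - x)) ?subr_lt0// opprB ltr_norml => /andP[_ h].
  have -> : t <= y by lra.
  by have -> : (y < t) = false by apply/negbTE; rewrite -leNgt; lra.
- rewrite (gtr0_norm (x := t - x)) ?subr_gt0// ltr_norml => /andP[h _].
  have -> : y < t by lra.
  by have -> : (t <= y) = false by apply/negbTE; rewrite -ltNge; lra.
Unshelve. all: by end_near. Qed.

(* The kernel of [f |-> \int_0^x f], the integral being oriented and [f] being
   cut off outside ]-l, l[. *)
Definition prim_kernel (x t : R) : R := \1_(`]0, x]) t - \1_(`]x, 0]) t.

Lemma good_prim_kernel : good_kernel l prim_kernel.
Proof.
split.
- exists 2 => x t; rewrite /prim_kernel !indicE.
  by rewrite (le_trans (ler_normB _ _))//; do 2 case: (_ \in _);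
    rewrite ?normr1 ?normr0; lra.
- by move=> x; apply: measurable_funB; exact: measurable_indic.
- move=> x Ix; exists [set x]; split; first exact: measurable_set1.
    exact: lebesgue_measure_set1.
  move=> t; apply: contra_notP => /eqP tx _.
  apply: cvg_near_cst.
  have := near_indic_le tx; apply: filterS => y [e1 e2].
  by rewrite /prim_kernel !indicE !mem_setE !in_itv/= e1 e2.
Qed.

Definition prim f : R -> R := kop l prim_kernel f.

Lemma prim_diff f x y : L1I l f -> x <= y ->
  prim f y - prim f x = \int[mu]_(t in I) (\1_(`]x, y]) t * f t).
Proof.
move=> If xy; have Ik z := L1I_kernel good_prim_kernel z If.
rewrite /prim /kop -RintegralB//; [|exact: Ik|exact: Ik].
apply: eq_Rintegral => t _; rewrite -mulrBl; congr (_ * _).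
rewrite /prim_kernel !indicE !mem_setE !in_itv/=.
have [t0|t0] := ltP 0 t; have [ty|ty] := leP t y; have [tx|tx] := leP t x => /=;
  rewrite ?(subr0, sub0r, subrr, opprK, addr0, oppr0)//; lra.
Qed.

Lemma prim0 f : prim f 0 = 0.
Proof.
rewrite /prim /kop (_ : (\int[_]_(_ in _) _) = \int[mu]_(t in I) 0); last first.
  by apply: eq_Rintegral => t _; rewrite /prim_kernel subrr mul0r.
by rewrite Rintegral_cst// mul0r.
Qed.

Lemma prim_diff_itv f x y : L1I l f -> I x -> I y -> x <= y ->
  prim f y - prim f x = \int[mu]_(t in `[x, y]) f t.
Proof.
move=> If; rewrite /= !in_itv/= => /andP[lx xl] /andP[ly yl] xy.
have sub : `]x, y] `<=` I.
  by move=> t; rewrite /= !in_itv/= => /andP[xt ty]; apply/andP; split; lra.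
have If' : mu.-integrable `]x, y] (EFin \o f).
  by apply: integrableS If => //; exact: measurable_itv.
rewrite prim_diff// -Rintegral_itv_obnd_cbnd//.
rewrite -[in RHS](setIidr sub) Rintegral_mkcondr.
apply: eq_Rintegral => t _; rewrite indicE patchE.
by case: ifPn => _; rewrite ?mul1r ?mul0r.
Qed.

(** As the integrand is cut off outside the interval, the estimate holds for all real x <= y. This
    is what later gives absolute continuity up to the endpoints. *)
Lemma prim_lipschitz f C x y : L1I l f -> (forall t, I t -> `|f t| <= C) ->
  x <= y -> 0 <= C -> `|prim f y - prim f x| <= C * (y - x).
Proof.
move=> If fC xy C0; rewrite prim_diff//.
have I1 : L1I l (\1_(`]x, y])) by apply: L1I_indic; exact: measurable_itv.
have I1f : L1I l (fun t => \1_(`]x, y]) t * f t).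
  rewrite (_ : (fun t => _) = (fun t => f t * \1_(`]x, y]) t)); last first.
    by apply/funext => t; rewrite mulrC.
  apply: (@L1IM _ _ _ _ 1) => //.
  by move=> t _; rewrite indicE; case: (_ \in _); rewrite ?normr1 ?normr0.
rewrite (le_trans (le_normr_Rintegral _ I1f))//.
apply: (@le_trans _ _ (\int[mu]_(t in I) (C * \1_(`]x, y]) t))).
  apply: le_Rintegral => //.
  - exact: integrable_norm.
  - exact: L1IZ.
  - move=> t It; have t0 : 0 <= \1_(`]x, y]) t :> R by rewrite indicE ler0n.
    by rewrite normrM (ger0_norm t0) mulrC ler_wpM2r// fC.
rewrite RintegralZl//.
rewrite ler_wpM2l// /Rintegral integral_indic//.
rewrite -[leRHS]/(fine (y - x)%:E).
have muxy : mu `]x, y] = (y - x)%:E.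
  rewrite lebesgue_measure_itv/= lte_fin; case: ltP => [_|yx]; first by rewrite EFinB.
  by have -> : x = y; [apply/eqP; rewrite eq_le xy yx|rewrite subrr].
have le : (mu (`]x, y] `&` I) <= mu `]x, y])%E.
  apply: le_measure; [apply/mem_set|apply/mem_set|exact: subIsetl].
    by apply: measurableI; exact: measurable_itv.
  exact: measurable_itv.
rewrite -[X in _ <= fine X]muxy; apply: fine_le => //; last by rewrite muxy.
by rewrite ge0_fin_numE// (le_lt_trans le)// muxy ltry.
Qed.

Lemma prim_derive f x : L1I l f -> I x -> {for x, continuous f} ->
  is_derive x 1 (prim f) (f x).
Proof.
move=> If Ix cf.
pose g := f \_ I.
have Ig : mu.-integrable setT (EFin \o g).
  rewrite /g -restrict_EFin; apply: (integrable_mkcond _ _).1 => //.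
(* Integrating from -oo gives one formula on both sides of 0, and [prim l f] is [F] minus the
   constant [F 0]. *)
pose F y := \int[mu]_(t in [set` `]-oo, y]]) g t.
have FE y : F y = \int[mu]_(t in I) (\1_(`]-oo, y]) t * f t).
  rewrite /F /g -Rintegral_mkcondr Rintegral_mkcondl.
  apply: eq_Rintegral => t _; rewrite indicE patchE.
  by case: ifPn => _; rewrite ?mul1r ?mul0r.
have I1f y : L1I l (fun t => \1_(`]-oo, y]) t * f t).
  rewrite (_ : (fun t => _) = (fun t => f t * \1_(`]-oo, y]) t)); last first.
    by apply/funext => t; rewrite mulrC.
  apply: (@L1IM _ _ _ _ 1) => //.
  by move=> t _; rewrite indicE; case: (_ \in _); rewrite ?normr1 ?normr0.
have primE : prim f = fun y => F y - F 0.
  apply/funext => y; rewrite !FE -RintegralB//; [|exact: I1f|exact: I1f].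
  apply: eq_Rintegral => t _; rewrite -mulrBl; congr (_ * _).
  rewrite /prim_kernel !indicE !mem_setE !in_itv/=.
  by have [t0|t0] := ltP 0 t; have [ty|ty] := leP t y;
    rewrite ?(subr0, sub0r, subrr).
have nI : \forall t \near x, I t.
  exact: near_in_itvoo.
have cg : {for x, continuous g}.
  have gx : g x = f x by rewrite /g patchE mem_set.
  rewrite /prop_for /continuous_at gx.
  apply: cvg_trans cf; apply: near_eq_cvg.
  by apply: filterS nI => t It; rewrite /g patchE mem_set.
have xx1 : x < x + 1 by rewrite ltrDl.
have Ig' : mu.-integrable [set` `]-oo, (x + 1)]] (EFin \o g).
  by apply: integrableS Ig => //; exact: measurable_itv.
have [dF F'] := continuous_FTC1 xx1 Ig' (ltNyr _) cg.
have dF' : is_derive x 1 F (g x).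
  by apply: DeriveDef; [exact: dF|rewrite -derive1E F'].
have gx : g x = f x by rewrite /g patchE mem_set.
rewrite primE; move: dF'; rewrite gx; move: F (F 0) {FE primE dF F'} => F c dF'.
have -> : (fun y => F y - c) = F - cst c by [].
by rewrite -[f x]subr0; apply: is_deriveB.
Qed.

End primitive.

Section fundamental_theorem.
Context {R : realType}.
Local Notation mu := (@lebesgue_measure R).

Lemma Rintegral_derive (F f : R -> R) (a b : R) : a <= b ->
  (forall x, a <= x <= b -> is_derive x 1 F (f x)) ->
  (forall x, a <= x <= b -> {for x, continuous f}) ->
  \int[mu]_(x in `[a, b]) f x = F b - F a.
Proof.
rewrite le_eqVlt => /predU1P[<- _ _|ab dF cf].
  by rewrite set_itv1 Rintegral_set1 subrr.
have cF x : a <= x <= b -> F @ x --> F x.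
  move=> /dF Fx; apply: differentiable_continuous; apply/derivable1_diffP.
  exact: ex_derive.
rewrite /Rintegral (@continuous_FTC2 _ f F)//=.
- apply: continuous_in_subspaceT => x /set_mem /=; rewrite in_itv/=.
  exact: cf.
- split.
  + move=> x; rewrite in_itv/= => /andP[ax xb].
    by have /dF dFx : a <= x <= b by rewrite !ltW.
  + by apply: cvg_at_right_filter; apply: cF; rewrite lexx ltW.
  + by apply: cvg_at_left_filter; apply: cF; rewrite lexx ltW.
- move=> x; rewrite in_itv/= => /andP[ax xb].
  have /dF dFx : a <= x <= b by rewrite !ltW.
  by rewrite derive1E derive_val.
Qed.

Arguments Rintegral_derive : clear implicits.

Lemma prim_of_derivative (l : R) (F f : R -> R) : L1I l f ->
  (forall x, - l < x < l -> is_derive x 1 F (f x)) ->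
  (forall x, - l < x < l -> {for x, continuous f}) ->
  forall x, - l < x < l -> prim l f x = F x - F 0.
Proof.
move=> If dF cf x /andP[lx xl].
have Ix : `]-l, l[%classic x by rewrite /= in_itv/= lx.
have I0 : `]-l, l[%classic (0:R) by rewrite /= in_itv/=; apply/andP; split; lra.
have [x0|/ltW x0] := leP 0 x.
  rewrite (_ : prim l f x = prim l f x - prim l f 0); last by rewrite prim0 subr0.
  rewrite prim_diff_itv//.
  by apply: (@Rintegral_derive F f) => // y /andP[y0 yx]; [apply: dF|apply: cf];
    apply/andP; split; lra.
rewrite (_ : prim l f x = - (prim l f 0 - prim l f x)); last first.
  by rewrite prim0 sub0r opprK.
rewrite prim_diff_itv//.
suff -> : \int[mu]_(t in `[x, 0]) f t = F 0 - F x by rewrite opprB.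
by apply: (Rintegral_derive F f) => // y /andP[y0 yx]; [apply: dF|apply: cf];
  apply/andP; split; lra.
Qed.

Lemma is_derive_expo (s x : R) : is_derive x 1 (expo s) (s * expo s x).
Proof.
rewrite /expo.
have h : is_derive x 1 (fun y : R => s * y) s.
  have := @is_deriveZ R R R id s x 1 1 (is_derive_id x 1).
  by rewrite /GRing.scale/= mulr1.
by rewrite mulrC; exact: (is_derive1_comp (is_derive_expR (s * x)) h).
Qed.

Lemma continuous_expo (s : R) : continuous (expo s).
Proof.
move=> x; apply: continuous_comp; [exact: mulrl_continuous|exact: continuous_expR].
Qed.

Lemma expo_prim (l s x : R) : - l < x < l ->
  expo s x = 1 + s * prim l (expo s) x.
Proof.
move=> lxl.
have Ise : L1I l (fun y => s * expo s y) by apply: L1IZ; exact: L1I_expo.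
have cse y : - l < y < l -> {for y, continuous (fun z => s * expo s z)}.
  by move=> _; apply: cvgMr; exact: continuous_expo.
have := prim_of_derivative Ise (fun y _ => is_derive_expo s y) cse lxl.
have [_ pZ _ _] := kop_bounded_operator (good_prim_kernel l).
rewrite /prim pZ; last exact: L1I_expo.
by move=> ->; rewrite /expo mulr0 expR0 addrC subrK.
Qed.

End fundamental_theorem.

(** * The oriented integral over [-x, x] as a kernel operator *)

Lemma pairl_continuous (R : realType) (x : R) : continuous (fun t : R => (x, t)).
Proof.
by move=> t; apply: (@cvg_pair _ _ _ _ (nbhs x) (nbhs t)); [exact: cvg_cst|exact: cvg_id].
Qed.

Lemma pairr_continuous (R : realType) (x : R) : continuous (fun t : R => (t, x)).
Proof.
by move=> t; apply: (@cvg_pair _ _ _ _ (nbhs t) (nbhs x)); [exact: cvg_id|exact: cvg_cst].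
Qed.

Section transmutation_kernel_operator.
Context {R : realType} (l : R).
Local Notation mu := (@lebesgue_measure R).
Local Notation I := (`]- l, l[%classic : set R).
Implicit Types (f g : R -> R) (x y C : R).

(** The sign of x turns the integral over [-|x|, |x|] into the oriented integral from -x to x. *)
Definition J_kernel (k : R -> R -> R) (x t : R) : R :=
  Num.sg x * k x t * \1_(`[- `|x|, `|x|]) t.

Lemma ae_neq (x : R) : {ae mu, forall t : R, t != x}.
Proof.
exists [set x]; split; first exact: measurable_set1.
  exact: lebesgue_measure_set1.
by move=> t /negP; rewrite negbK => /eqP.
Qed.

Lemma measurable_section (k : R -> R -> R) x (D : set R) :
  continuous (fun z : R * R => k z.1 z.2) -> measurable_fun D (k x).
Proof.
move=> ck; apply: measurable_funTS; apply: continuous_measurable_fun => t.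
apply: (@continuous_comp _ _ _ (fun t => (x, t)) (fun z : R * R => k z.1 z.2)).
  exact: pairl_continuous.
exact: ck.
Qed.

(** Only t = x and t = -x are exceptional. If |t| < |x|, then x is nonzero and both the sign and the
    indicator are constant near x; if |t| > |x|, the kernel vanishes near x. *)
Lemma good_J_kernel (k : R -> R -> R) :
  (exists C, forall x t, `|k x t| <= C) ->
  continuous (fun z : R * R => k z.1 z.2) -> good_kernel l (J_kernel k).
Proof.
move=> [C kC] ck; split.
- exists C => x t; rewrite /J_kernel !normrM.
  rewrite -[leRHS]mulr1 ler_pM//; last first.
    by rewrite indicE; case: (_ \in _); rewrite ?normr1 ?normr0.
  rewrite -[leRHS]mul1r ler_pM// normr_sg.
  by case: (_ != _).
- move=> x; apply: measurable_funM; last exact: measurable_indic.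
  by apply: measurable_funM => //; exact: measurable_section.
- move=> x Ix; have := ae_neq x; have := ae_neq (- x).
  apply: filterS2; first exact: (ae_filter_ringOfSetsType mu).
  move=> t tNx tx _.
  have ntx : `|t| != `|x|.
    by apply/negP; rewrite eqr_norm2 (negbTE tx) (negbTE tNx).
  have cn : (fun y : R => `|y|) @ x --> `|x| by apply: cvg_norm; exact: cvg_id.
  have [tltx|xltt|/eqP] := ltgtP `|t| `|x|; last by rewrite (negbTE ntx).
  + have x0 : x != 0 by apply/eqP => x0; move: tltx; rewrite x0 normr0 normr_lt0.
    have sgx : \forall y \near x, Num.sg y = Num.sg x.
      have [xn|xp|/eqP] := ltgtP x 0; last by rewrite (negbTE x0).
      * near=> y; rewrite !ltr0_sg//; near: y.
        exact: (@cvgr_lt _ _ (nbhs x) _ id x).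
      * near=> y; rewrite !gtr0_sg//; near: y.
        exact: (@cvgr_gt _ _ (nbhs x) _ id x).
    rewrite /prop_for /continuous_at /J_kernel.
    have JE (y : R) : `|t| < `|y| -> \1_(`[- `|y|, `|y|]) t = 1 :> R.
      by move=> ty; rewrite indicE mem_setE in_itv/= -ler_norml ltW.
    rewrite JE// mulr1.
    have : Num.sg x * k y t @[y --> x] --> Num.sg x * k x t.
      apply: cvgMr.
      apply: (@continuous_comp _ _ _ (fun y => (y, t)) (fun z : R * R => k z.1 z.2)).
        exact: pairr_continuous.
      exact: ck.
    apply: cvg_trans; apply: near_eq_cvg; near=> y.
    rewrite JE ?mulr1; last by near: y; exact: (cvgr_gt _ cn).
    by congr (_ * _); symmetry; near: y.
  + apply: cvg_near_cst; near=> y.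
    rewrite /J_kernel indicE mem_setE in_itv/= -ler_norml.
    have -> : (`|t| <= `|y|) = false.
      by apply/negbTE; rewrite -ltNge; near: y; exact: (cvgr_lt _ cn).
    rewrite mulr0 indicE mem_setE in_itv/= -ler_norml.
    by rewrite leNgt xltt mulr0.
Unshelve. all: by end_near. Qed.

Definition oint (a b : R) f : R :=
  if a <= b then \int[mu]_(t in `[a, b]) f t else - \int[mu]_(t in `[b, a]) f t.

Lemma J_kernelE (k : R -> R -> R) f x :
  (exists C, forall x t, `|k x t| <= C) ->
  continuous (fun z : R * R => k z.1 z.2) -> L1I l f -> I x ->
  kop l (J_kernel k) f x = oint (- x) x (fun t => k x t * f t).
Proof.
move=> [C kC] ck If; rewrite /= in_itv/= => /andP[lx xl].
have sub : `[- `|x|, `|x|] `<=` I.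
  move=> t; rewrite /= !in_itv/= -ler_norml => tx.
  have : `|x| < l by rewrite ltr_norml lx xl.
  by move=> /(le_lt_trans tx); rewrite ltr_norml.
have kE : kop l (J_kernel k) f x =
    Num.sg x * \int[mu]_(t in `[- `|x|, `|x|]) (k x t * f t).
  have Ikf : mu.-integrable `[- `|x|, `|x|] (EFin \o (fun t => k x t * f t)).
    apply: (@integrableS _ _ _ mu I) => //.
    rewrite (_ : (fun t => k x t * f t) = (fun t => f t * k x t)).
      by apply: (@L1IM _ l _ _ C) => //; exact: measurable_section.
    by apply/funext => t; rewrite mulrC.
  rewrite -RintegralZl//.
  rewrite -[in RHS](setIidr sub) Rintegral_mkcondr.
  apply: eq_Rintegral => t _; rewrite /J_kernel indicE patchE.
  by case: ifPn => _; rewrite ?mulr1 ?mulr0 ?mul0r// mulrA.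
rewrite kE /oint; have [x0|x0|->] := ltgtP x 0.
- by rewrite ltr0_norm// ltr0_sg// mulN1r opprK; case: ifPn => //; lra.
- by rewrite gtr0_norm// gtr0_sg// mul1r; case: ifPn => //; lra.
- by rewrite sgr0 mul0r oppr0 lexx set_itv1 Rintegral_set1.
Qed.

End transmutation_kernel_operator.

(** * The transmutation identity for real data *)

Section transmutation_identity.
Context {R : realType} (l : R) (l0 : 0 < l).
Local Notation mu := (@lebesgue_measure R).
Local Notation I := (`]- l, l[%classic : set R).
Variables (b m : R -> R) (k : R -> R -> R) (eps : R).
Hypotheses (Ib : L1I l b) (Im : L1I l m).
Hypothesis kC : exists C : R, forall x t, `|k x t| <= C.
Hypothesis ck : continuous (fun z : R * R => k z.1 z.2).
Implicit Types (f g w : R -> R).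

Local Notation P := (prim l).
Local Notation J := (kop l (J_kernel k)).

(** For b = a^-2 and m = a^2 this is the right inverse of L_a whose values have zero value and zero
    quasi-derivative at 0. *)
Definition double_prim f : R -> R :=
  P (fun t => b t * P (fun r => m r * f r) t).
Local Notation B := double_prim.

Let bP : bounded_operator l P := kop_bounded_operator (good_prim_kernel l).
Let bJ : bounded_operator l J := kop_bounded_operator (good_J_kernel l kC ck).

Lemma bounded_operator_lin Q c d f g x : bounded_operator l Q ->
  L1I l f -> L1I l g ->
  Q (fun t => c * f t + d * g t) x = c * Q f x + d * Q g x.
Proof.
by move=> [QD QZ _ _] If Ig; rewrite QD ?QZ//; exact: L1IZ.
Qed.

Lemma double_prim_lin c d f g x :
  L1I l (fun t => m t * f t) -> L1I l (fun t => m t * g t) ->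
  B (fun t => c * f t + d * g t) x = c * B f x + d * B g x.
Proof.
move=> If Ig; rewrite /B.
have L h : L1I l (fun t => m t * h t) -> L1I l (fun t => b t * P (fun r => m r * h r) t).
  by move=> Ih; exact: bounded_operator_L1IM.
rewrite -(bounded_operator_lin c d x bP (L _ If) (L _ Ig)).
congr (P _ x); apply/funext => t.
rewrite mulrCA (mulrCA d) -mulrDr -(bounded_operator_lin c d t bP If Ig).
congr (_ * P _ t); apply/funext => r; ring.
Qed.

Lemma double_prim_eq f g : (forall x, I x -> f x = g x) -> B f = B g.
Proof.
move=> fg; rewrite /B; congr P; apply/funext => t; congr (_ * _).
by congr (_ t); apply: kop_eq => r Ir; rewrite fg.
Qed.

Let I1 : L1I l (cst 1) := L1I_cst l 1.
Let PL f : L1I l f -> L1I l (P f) := bounded_operator_L1I bP.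
Let mPL f : L1I l f -> L1I l (fun t => m t * P f t).
Proof. exact: bounded_operator_L1IM. Qed.
Let mJL f : L1I l f -> L1I l (fun t => m t * J f t).
Proof. exact: bounded_operator_L1IM. Qed.
Let m1L : L1I l (fun t => m t * cst 1 t).
Proof. by under eq_fun do rewrite mulr1. Qed.

(** Write u = c0 + P U1 with U1 = c1 + P U2 and U2 = c2 + P w. In the difference of the two sides of
    the integral equation c0 cancels, [D1] and [D2] are the coefficients of c1 and c2, and [M] is
    the part depending on w. The explicit factors 1 and -1 give [M] the shape of
    [bounded_operator_lincomb]. *)
Let D1 x := eps * P (cst 1) x - J (cst 1) x - eps * P b x.
Let D2 x := eps * P (P (cst 1)) x - J (P (cst 1)) x - eps * B (cst 1) x.
Let M x w := 1 * (eps * P (P (P w)) x + -1 * J (P (P w)) x) +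
             1 * ((- eps) * B (P w) x + 1 * B (J w) x).

Lemma bounded_operator_comp1 Q S : bounded_operator l Q ->
  bounded_operator l S -> bounded_operator l (fun f => Q (S f)).
Proof.
move=> bQ bS; have := bounded_operator_comp bQ bS I1.
rewrite (_ : (fun f => Q (fun t => cst 1 t * S f t)) = (fun f => Q (S f)))//.
apply/funext => f; congr Q; apply/funext => t; exact: mul1r.
Qed.

Let bM x : bounded_functional l (M x).
Proof.
apply: (@bounded_operator_at _ l (fun w y => M y w) x).
apply: (bounded_operator_lincomb 1 1); apply: bounded_operator_lincomb.
- by do 2 apply: bounded_operator_comp1 => //.
- by do 2 apply: bounded_operator_comp1 => //.
- by apply: bounded_operator_comp => //; apply: bounded_operator_comp.
- by apply: bounded_operator_comp => //; apply: bounded_operator_comp.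
Qed.

(** The integrated eigenvalue equation, with value [eps] and quasi-derivative [eps * s] at 0. The
    factor s before [J] comes from the derivative of e^{st}. *)
Hypothesis Texpo : forall s x, I x ->
  let e := fun y => eps * expo s y - s * J (expo s) y in
  e x = eps * (1 + s * P b x) + s ^+ 2 * B e x.

(** The relation e^{st} = 1 + s P e^{st} is substituted in each term until every remaining
    exponential carries s^3: three times in the term without [J], twice under [J], once under [B];
    the term B J e^{st} already carries s^3. *)
Let expansion x s : I x -> s * D1 x + s ^+ 2 * D2 x + s ^+ 3 * M x (expo s) = 0.
Proof.
move=> Ix; have IE : L1I l (expo s) by exact: L1I_expo.
have EP y : I y -> expo s y = 1 * cst 1 y + s * P (expo s) y.
  by rewrite /= in_itv/= => Iy; rewrite (expo_prim s Iy) mul1r.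
have kE kap y : good_kernel l kap ->
    kop l kap (expo s) y = kop l kap (cst 1) y + s * kop l kap (P (expo s)) y.
  move=> /kop_bounded_operator gk.
  rewrite (kop_eq kap EP) (bounded_operator_lin _ _ _ gk)//; last exact: PL.
  by rewrite mul1r.
have PE y : P (expo s) y = P (cst 1) y + s * P (P (expo s)) y.
  exact: kE (good_prim_kernel l).
have QPE Q y : bounded_operator l Q ->
    Q (P (expo s)) y = Q (P (cst 1)) y + s * Q (P (P (expo s))) y.
  move=> bQ.
  transitivity (Q (fun y => 1 * P (cst 1) y + s * P (P (expo s)) y) y).
    by congr (Q _ y); apply/funext => z; rewrite PE mul1r.
  rewrite (bounded_operator_lin _ _ _ bQ) ?mul1r//; first exact: PL.
  by do 2 apply: PL.
have mE : L1I l (fun t => m t * expo s t).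
  apply: (@L1IM _ _ _ _ (expR (`|s| * l))) => //; first exact: measurable_expo.
  by move=> y Iy; exact: expo_le.
have BE : B (expo s) x = B (cst 1) x + s * B (P (expo s)) x.
  by rewrite (double_prim_eq EP) double_prim_lin ?mul1r//; exact: mPL.
have Ex : expo s x =
    1 + s * (P (cst 1) x + s * (P (P (cst 1)) x + s * P (P (P (expo s))) x)).
  by rewrite (EP x Ix) PE (QPE P)// mul1r.
have JEx : J (expo s) x =
    J (cst 1) x + s * (J (P (cst 1)) x + s * J (P (P (expo s))) x).
  by rewrite (kE (J_kernel k)) ?(QPE J)//; exact: good_J_kernel.
pose e y := eps * expo s y + (- s) * J (expo s) y.
have h : e x = eps * (1 + s * P b x) + s ^+ 2 * B e x.
  have := Texpo s Ix; rewrite /= (_ : (fun y => _ - _) = e).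
    by rewrite /e mulNr.
  by apply/funext => y; rewrite /e mulNr.
rewrite /e double_prim_lin ?BE in h => //; last exact: mJL.
rewrite Ex JEx in h.
move: h; rewrite /D1 /D2 /M.
move: (P (P (P (expo s))) x) (J (P (P (expo s))) x) (B (P (expo s)) x)
  (B (J (expo s)) x) (P (P (cst 1)) x) (J (P (cst 1)) x) (B (cst 1) x)
  (P (cst 1) x) (J (cst 1) x) (P b x) => p3 j2 bp bj p2 j1 b1 p1 j0 pb /eqP.
by rewrite -subr_eq0 => /eqP h; rewrite -[RHS]h; ring.
Qed.

(** [U1] and [U2] stand for u' and u''. By linearity the difference of the two sides is c1 [D1] + c2
    [D2] + [M] w, and [expansion] makes each of the three vanish. *)
Lemma transmutation_identity c0 c1 c2 w x : L1I l w -> I x ->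
  let U2 := fun y => c2 + P w y in
  let U1 := fun y => c1 + P U2 y in
  eps * (c0 + P U1 x) - J U1 x =
  eps * (c0 + c1 * P b x) + B (fun y => eps * U2 y - J w y) x.
Proof.
move=> Iw Ix U2 U1.
have [d1 d2 /(_ w Iw)] := functional_expansion_eq0 l0 (bM x) (fun s => expansion s Ix).
rewrite /D1 in d1; rewrite /D2 in d2; rewrite /M => m0.
have U2E : U2 = fun y => c2 * cst 1 y + 1 * P w y.
  by apply/funext => y; rewrite /U2 mulr1 mul1r.
have P1 := PL I1; have Pw := PL Iw; have PP1 := PL P1; have PPw := PL Pw.
have U1E : U1 = fun y => 1 * (c1 * cst 1 y + c2 * P (cst 1) y) + 1 * P (P w) y.
  apply/funext => y; rewrite /U1 U2E (bounded_operator_lin _ _ _ bP)//.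
  by rewrite mulr1; ring.
have QU1 Q : bounded_operator l Q ->
    Q U1 x = c1 * Q (cst 1) x + c2 * Q (P (cst 1)) x + Q (P (P w)) x.
  move=> bQ; rewrite U1E (bounded_operator_lin _ _ _ bQ)//; last first.
    by apply: L1ID; exact: L1IZ.
  by rewrite (bounded_operator_lin _ _ _ bQ)//; ring.
rewrite !QU1//.
have mU : L1I l (fun t => m t * ((eps * c2) * cst 1 t + eps * P w t)).
  rewrite (_ : (fun t => _) = fun t => (eps * c2) * (m t * cst 1 t) + eps * (m t * P w t)).
    by apply: L1ID; apply: L1IZ => //; exact: mPL.
  by apply/funext => t; move: (P w t) => ?; ring.
have -> : (fun y => eps * U2 y - J w y) =
    fun y => 1 * ((eps * c2) * cst 1 y + eps * P w y) + (- 1) * J w y.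
  by apply/funext => y; rewrite /U2 mulr1; ring.
rewrite double_prim_lin; [|exact: mU|exact: mJL].
rewrite double_prim_lin//; last exact: mPL.
move: d1 d2 m0.
move: (P (P (P w)) x) (J (P (P w)) x) (B (P w) x)
  (B (J w) x) (P (P (cst 1)) x) (J (P (cst 1)) x) (B (cst 1) x)
  (P (cst 1) x) (J (cst 1) x) (P b x) => p3 j2 bp bj p2 j1 b1 p1 j0 pb d1 d2 m0.
have {}d1 : c1 * (eps * p1 - j0 - eps * pb) = 0 by rewrite d1 mulr0.
have {}d2 : c2 * (eps * p2 - j1 - eps * b1) = 0 by rewrite d2 mulr0.
lra.
Qed.

End transmutation_identity.

(** * Smooth approximations of indicators of intervals *)

Section smooth_step.
Context {R : realType}.
Implicit Types (f g : R -> R) (x y : R).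

(** Everywhere differentiable n times, with the derivative as a witness: this form is stable under
    sums, products and composition by induction on n. *)
Fixpoint times_differentiable (n : nat) f : Prop :=
  if n is n'.+1 then
    exists2 g, (forall x, is_derive x 1 f (g x)) & times_differentiable n' g
  else True.
Local Notation Dn := times_differentiable.

Lemma times_differentiableW n f : Dn n.+1 f -> Dn n f.
Proof.
elim: n f => [//|n IH] f [g dg Dg]; exists g => //; exact: IH.
Qed.

Lemma times_differentiable_cst n c : Dn n (cst c).
Proof.
elim: n c => [//|n IH] c; exists (cst 0) => // x; exact: is_derive_cst.
Qed.

Lemma times_differentiableD n f g : Dn n f -> Dn n g -> Dn n (fun x => f x + g x).
Proof.
elim: n f g => [//|n IH] f g [f' df Df] [g' dg Dg].
exists (fun x => f' x + g' x); last exact: IH.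
by move=> x; apply: is_deriveD.
Qed.

Lemma times_differentiableM n f g : Dn n f -> Dn n g -> Dn n (fun x => f x * g x).
Proof.
elim: n f g => [//|n IH] f g Hf Hg.
have [f' df Df] := Hf; have [g' dg Dg] := Hg.
exists (fun x => f' x * g x + f x * g' x).
  move=> x; refine (is_derive_eq (is_deriveM (df x) (dg x)) _).
  by rewrite /GRing.scale/= addrC mulrC.
by apply: times_differentiableD; apply: IH => //; exact: times_differentiableW.
Qed.

Lemma times_differentiable_comp n f g :
  Dn n f -> Dn n g -> Dn n (fun x => f (g x)).
Proof.
elim: n f g => [//|n IH] f g Hf Hg.
have [f' df Df] := Hf; have [g' dg Dg] := Hg.
exists (fun x => f' (g x) * g' x).
  by move=> x; apply: is_derive1_comp.
by apply: times_differentiableM => //; apply: IH => //; exact: times_differentiableW.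
Qed.

Lemma times_differentiable_affine n c d : Dn n (fun x => c * x + d).
Proof.
case: n => [//|n]; exists (cst c); last exact: times_differentiable_cst.
move=> x; have := @is_deriveD _ _ _ (fun y => c * y) (cst d) x 1 c 0.
rewrite addr0; apply.
have := @is_deriveZ R R R id c x 1 1 (is_derive_id x 1).
by rewrite /GRing.scale/= mulr1.
Qed.

(** The functions x^{-n} e^{-1/x} on x > 0, extended by 0. Differentiation sends [flat n] to a
    combination of [flat n.+1] and [flat n.+2], so the whole family is treated in one induction. *)
Definition flat (n : nat) x : R :=
  if 0 < x then x^-1 ^+ n * expR (- x^-1) else 0.

(** From e^y >= y^{n+2} / (n+2)! at y = 1/x. The order x^2 makes the difference quotient at 0 tend
    to 0. *)
Lemma flat_bound n x : 0 < x -> `|flat n x| <= (n.+2)`!%:R * x ^+ 2.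
Proof.
move=> x0; rewrite /flat x0 ger0_norm; last first.
  by rewrite mulr_ge0 ?exprn_ge0 ?expR_ge0// invr_ge0 ltW.
have := @expR_ge1Dxn R x^-1 n.+1.
rewrite invr_ge0 (ltW x0) => /(_ isT) h.
have {}h : x^-1 ^+ n.+2 <= n.+2`!%:R * expR x^-1.
  rewrite mulrC -ler_pdivrMr ?ltr0n ?fact_gt0//; apply: le_trans h; lra.
rewrite expRN ler_pdivrMr ?expR_gt0// mulrAC -ler_pdivrMr ?exprn_gt0//.
by rewrite -exprVn -exprD addn2.
Qed.

Lemma is_derive_flat n x :
  is_derive x 1 (flat n) (- n%:R * flat n.+1 x + flat n.+2 x).
Proof.
have [x0|x0|->] := ltgtP x 0.
- have -> : - n%:R * flat n.+1 x + flat n.+2 x = 0.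
    by rewrite /flat ltNge (ltW x0)/= mulr0 addr0.
  have E : \forall y \near x, cst 0 y = flat n y.
    near=> y; rewrite /flat ltNge; suff -> : y <= 0 by [].
    by apply: ltW; near: y; exact: (@cvgr_lt _ _ (nbhs x) _ id x).
  apply: DeriveDef; first exact: (near_eq_derivable E).
  by rewrite -(near_eq_derive _ E) derive_cst.
- pose h y := y^-1 ^+ n * expR (- y^-1).
  have E : \forall y \near x, h y = flat n y.
    near=> y; rewrite /flat; suff -> : 0 < y by [].
    by near: y; exact: (@cvgr_gt _ _ (nbhs x) _ id x).
  have x0' : x != 0 by rewrite gt_eqF.
  have dV : is_derive x 1 (fun y : R => y^-1) (- x ^- 2).
    have := @is_deriveV R id x 1 1 x0' _.
    by rewrite /GRing.scale/= mulr1; apply.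
  have dh : is_derive x 1 h (- n%:R * flat n.+1 x + flat n.+2 x).
    have dX := @is_deriveX R R (fun y : R => y^-1) n x 1 _ dV.
    have dN := is_deriveN dV.
    have dE := @is_derive1_comp R expR (fun y => - y^-1) x _ _
      (is_derive_expR (- x^-1)) dN.
    have -> : h = (fun y : R => y^-1) ^+ n * (expR \o (fun y => - y^-1)).
      by apply/funext => y; rewrite /h !fctE.
    refine (is_derive_eq (is_deriveM dX dE) _).
    rewrite /GRing.scale/= /flat x0 -exprVn.
    have -> : ((fun y : R => y^-1) ^+ n) x = x^-1 ^+ n by rewrite fctE.
    move: (expR (- x^-1)) (x^-1) => e y.
    by case: n {E h dX} => [|n]; rewrite /= ?mulrS !exprS ?expr0; ring.
  apply: DeriveDef; first by apply: (near_eq_derivable E); exact: ex_derive.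
  by rewrite -(near_eq_derive _ E) derive_val.
- have -> : - n%:R * flat n.+1 0 + flat n.+2 0 = 0.
    by rewrite /flat ltxx mulr0 addr0.
  have cv : h^-1 *: (flat n (h *: 1 + 0) - flat n 0) @[h --> 0^'] --> (0:R).
    apply/norm_cvg0P.
    apply: (@squeeze_cvgr _ _ _ _ (fun=> 0) (fun h => (n.+2)`!%:R * `|h|)).
    + near=> h; rewrite normr_ge0/= addr0 /flat ltxx subr0 /GRing.scale/= mulr1.
      rewrite -/(flat n h) normrM.
      have h0 : h != 0 by near: h; exact: nbhs_dnbhs_neq.
      rewrite normfV ler_pdivrMl ?normr_gt0//.
      have [hp|hn|/eqP] := ltgtP 0 h; last by rewrite eq_sym (negbTE h0).
        rewrite (le_trans (flat_bound n hp))// expr2 (gtr0_norm hp).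
        by rewrite mulrCA.
      by rewrite /flat ltNge (ltW hn)/= normr0 mulr_ge0// mulr_ge0.
    + exact: cvg_cst.
    + rewrite -[X in _ --> X](mulr0 (n.+2)`!%:R); apply: cvgMr.
      rewrite -[X in _ --> X](normr0 R).
      by apply: cvg_norm; apply: nbhs_dnbhs.
  by apply: DeriveDef; [apply/cvg_ex; exists 0|apply/cvg_lim].
Unshelve. all: by end_near. Qed.

Lemma times_differentiable_flat k n : Dn k (flat n).
Proof.
elim: k n => [//|k IH] n; exists (fun x => - n%:R * flat n.+1 x + flat n.+2 x).
  exact: is_derive_flat.
apply: times_differentiableD => //; apply: times_differentiableM => //.
exact: times_differentiable_cst.
Qed.

Local Notation F := (flat 0).

Lemma flat0_le x y : x <= y -> F x <= F y.
Proof.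
move=> xy; rewrite /flat; case: ifPn => x0; case: ifPn => y0.
- by rewrite !expr0 !mul1r ler_expR lerN2 lef_pV2.
- by move: y0; rewrite (lt_le_trans x0 xy).
- by rewrite expr0 mul1r expR_ge0.
- by [].
Qed.

Lemma flat0_ge0 x : 0 <= F x.
Proof. by rewrite /flat; case: ifPn => // _; rewrite expr0 mul1r expR_ge0. Qed.

Lemma flat0_gt0 x : 0 < x -> 0 < F x.
Proof. by rewrite /flat => ->; rewrite expr0 mul1r expR_gt0. Qed.

Lemma flat0_eq0 x : x <= 0 -> F x = 0.
Proof. by rewrite /flat leNgt => /negbTE ->. Qed.

(** With F = [flat 0], the inner argument F 1 - F (1 - x) is nonpositive for x <= 0 and equals F 1
    for x >= 1. Composing with F once more gives a step whose only division is by a constant, so no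
    quotient rule is needed. *)
Definition smooth_step x : R := F (F 1 - F (1 - x)) / F (F 1).

Let c0 : 0 < F (F 1). Proof. by do 2 apply: flat0_gt0. Qed.

Lemma smooth_step_eq0 x : x <= 0 -> smooth_step x = 0.
Proof.
move=> x0; rewrite /smooth_step flat0_eq0 ?mul0r// subr_le0 flat0_le//; lra.
Qed.

Lemma smooth_step_eq1 x : 1 <= x -> smooth_step x = 1.
Proof.
move=> x1; rewrite /smooth_step (@flat0_eq0 (1 - x)); last lra.
by rewrite subr0 divff// gt_eqF.
Qed.

Lemma smooth_step_ge0 x : 0 <= smooth_step x.
Proof. by rewrite divr_ge0// flat0_ge0. Qed.

Lemma smooth_step_le1 x : smooth_step x <= 1.
Proof.
by rewrite ler_pdivrMr// mul1r flat0_le// gerBl flat0_ge0.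
Qed.

Lemma times_differentiable_smooth_step n : Dn n smooth_step.
Proof.
apply: times_differentiableM; last exact: times_differentiable_cst.
apply: (@times_differentiable_comp n F (fun x => F 1 - F (1 - x))).
  exact: times_differentiable_flat.
rewrite (_ : (fun x => _) = fun x => cst (F 1) x + cst (-1) x * F (-1 * x + 1)).
  apply: times_differentiableD; first exact: times_differentiable_cst.
  apply: times_differentiableM; first exact: times_differentiable_cst.
  apply: times_differentiable_comp; first exact: times_differentiable_flat.
  exact: times_differentiable_affine.
by apply/funext => x; rewrite /cst !mulN1r (addrC (- x)).
Qed.

(** On the line a directional derivative is v times the ordinary one, so each application costs
    exactly one order of differentiability. *)
Lemma times_differentiable_smooth f : (forall n, Dn n f) -> smooth f.
Proof.
move=> Df vs x; suff : forall n, Dn n (foldr (fun v (g : R -> R) => 'D_v g) f vs).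
  move=> /(_ 1%N) [g dg _]; apply/derivable1_diffP; exact: ex_derive.
elim: vs => [//|v vs IH] n /=.
have [g dg Dg] := IH n.+1.
rewrite (_ : 'D_v _ = fun x => cst v x * g x).
  by apply: times_differentiableM => //; exact: times_differentiable_cst.
apply/funext => y; have dy := dg y.
have diff : differentiable (foldr (fun v (g : R -> R) => 'D_v g) f vs) y.
  by apply/derivable1_diffP; exact: ex_derive.
rewrite deriveE// -[v in LHS]mulr1 -[v * 1]/(v *: 1) linearZ/= -deriveE//.
by rewrite derive_val.
Qed.

End smooth_step.

Section smooth_step_derivative.
Context {R : realType}.

Lemma smooth_step_derivative : exists th : R -> R,
  [/\ forall x : R, is_derive x 1 smooth_step (th x), continuous th,
      forall x, ~~ (0 <= x <= 1) -> th x = 0 &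
      exists2 C, 0 < C & forall x, `|th x| <= C].
Proof.
have [th dth [th' dth' _]] := times_differentiable_smooth_step (R := R) 2.
have cth : continuous th.
  move=> x; apply: differentiable_continuous; apply/derivable1_diffP.
  exact: ex_derive.
have th0 x : ~~ (0 <= x <= 1) -> th x = 0.
  have dx := dth x.
  rewrite -(@derive_val _ _ _ _ _ _ _ dx) negb_and -!ltNge => /orP[x0|x1].
    rewrite -(@near_eq_derive _ _ _ (cst (0 : R)) smooth_step) ?derive_cst//.
    near=> y; rewrite smooth_step_eq0//; apply: ltW.
    by near: y; exact: (@cvgr_lt _ _ (nbhs x) _ id x).
  rewrite -(@near_eq_derive _ _ _ (cst (1 : R)) smooth_step) ?derive_cst//.
  near=> y; rewrite smooth_step_eq1//; apply: ltW.
  by near: y; exact: (@cvgr_gt _ _ (nbhs x) _ id x).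
exists th; split => //.
have [|c _ hc] := @EVT_max R (fun x => `|th x|) 0 1 ler01.
  apply: continuous_subspaceT => x.
  by apply: cvg_norm; exact: cth.
exists (`|th c| + 1); first by rewrite ltr_wpDl.
move=> x; have [x01|/th0 ->] := boolP (0 <= x <= 1).
  by rewrite ler_wpDr// hc.
by rewrite normr0 addr_ge0.
Unshelve. all: by end_near. Qed.

End smooth_step_derivative.

Section step_test_functions.
Context {R : realType} (l : R).
Local Notation mu := (@lebesgue_measure R).
Local Notation I := (`]- l, l[%classic : set R).
Implicit Types (f g h : R -> R) (x y c : R).

(** It rises on [al, al + 1/c] and falls on [be, be + 1/c]; as c grows it tends at every point to
    the indicator of ]al, be]. *)
Definition step_test (al be c x : R) : R :=
  smooth_step (c * (x - al)) - smooth_step (c * (x - be)).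

Lemma step_test_eq0 al be c x : 0 < c -> al < be ->
  ~~ (al <= x <= be + c^-1) -> step_test al be c x = 0.
Proof.
move=> c0 ab; rewrite negb_and -!ltNge /step_test => /orP[xa|bx].
  by rewrite !smooth_step_eq0 ?subrr// pmulr_rle0//; lra.
rewrite !smooth_step_eq1 ?subrr//.
  by rewrite -ler_pdivrMl// mulr1; lra.
by rewrite -ler_pdivrMl// mulr1; have := invr_gt0 c; rewrite c0; lra.
Qed.

Lemma step_test_le1 al be c x : `|step_test al be c x| <= 1.
Proof.
have := smooth_step_ge0 (c * (x - al)); have := smooth_step_le1 (c * (x - al)).
have := smooth_step_ge0 (c * (x - be)); have := smooth_step_le1 (c * (x - be)).
rewrite /step_test; move: (smooth_step _) (smooth_step _) => y z ? ? ? ?.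
by rewrite ler_norml; apply/andP; split; lra.
Qed.

Lemma times_differentiable_step_test n al be c :
  times_differentiable n (step_test al be c).
Proof.
have D a : times_differentiable n (fun x => smooth_step (c * (x - a))).
  apply: times_differentiable_comp; first exact: times_differentiable_smooth_step.
  rewrite (_ : (fun x => _) = fun x => c * x + (- (c * a))).
    exact: times_differentiable_affine.
  by apply/funext => x; rewrite mulrBr.
rewrite (_ : step_test al be c = fun x => smooth_step (c * (x - al)) +
    cst (-1) x * smooth_step (c * (x - be))).
  apply: times_differentiableD => //; apply: times_differentiableM => //.
  exact: times_differentiable_cst.
by apply/funext => x; rewrite /step_test mulN1r.
Qed.

Lemma step_test_test_function al be c : 0 < c -> - l < al -> al < be ->
  be + c^-1 < l -> test_function I (step_test al be c).
Proof.
move=> c0 la ab bl; split.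
  apply: times_differentiable_smooth => n; exact: times_differentiable_step_test.
exists `[al, be + c^-1]%classic; split; first exact: segment_compact.
  by move=> x; rewrite /= !in_itv/= => /andP[ax xb]; apply/andP; split; lra.
by move=> x; rewrite /= in_itv/= => /negP; exact: step_test_eq0.
Qed.

(** The step vanishes at 0, whence the strict inequality in the limit. The offset [c0] keeps the
    supports inside the interval from n = 0 on. *)
Lemma smooth_step_cvg (a c0 x : R) : 0 < c0 ->
  smooth_step ((c0 + n%:R) * (x - a)) @[n --> \oo] --> ((a < x)%R%:R : R).
Proof.
move=> c0p; have [ax|xa] := ltP a x; apply: cvg_near_cst; last first.
  by apply: nearW => n; rewrite smooth_step_eq0// pmulr_rle0 ?subr_le0// ltr_wpDr.
near=> n; rewrite smooth_step_eq1//.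
rewrite -ler_pdivrMr ?subr_gt0// mul1r.
rewrite (@le_trans _ _ n%:R)//; last by rewrite lerDr ltW.
by near: n; exact: nbhs_infty_ger.
Unshelve. all: by end_near. Qed.

Lemma Rintegral_dominated (f_ : (R -> R)^nat) f g :
  (forall n, measurable_fun I (f_ n)) -> measurable_fun I f ->
  {ae mu, forall x, I x -> f_ ^~ x @ \oo --> f x} -> L1I l g ->
  (forall n x, I x -> `|f_ n x| <= g x) ->
  \int[mu]_(x in I) f_ n x @[n --> \oo] --> \int[mu]_(x in I) f x.
Proof.
move=> mf_ mf ff Ig fg.
have [If cvf] := normL1_dominated mf_ mf ff Ig fg.
have If_ n : L1I l (f_ n) by apply: L1I_le (fg n) Ig.
apply/subr_cvg0; apply: norm_cvg0.
apply: (@squeeze_cvgr _ _ _ _ (fun=> 0) (fun n => normL1 l (fun x => f_ n x - f x))).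
- apply: nearW => n; rewrite normr_ge0/= -RintegralB//; last exact: If_.
  have Id : L1I l (fun x => f_ n x - f x) by exact: L1IB.
  by rewrite (le_trans (le_normr_Rintegral _ Id)).
- exact: cvg_cst.
- exact: cvf.
Qed.

Lemma locally_integrable_itv h (al be : R) : locally_integrable I h ->
  - l < al -> be < l -> L1I l (fun x => \1_(`[al, be]) x * h x).
Proof.
move=> [mh oI ih] la bl.
have sub : `[al, be] `<=` I.
  by move=> x; rewrite /= !in_itv/= => /andP[ax xb]; apply/andP; split; lra.
rewrite (_ : (fun x => _) = h \_ `[al, be]).
  rewrite /L1I -restrict_EFin; apply: (integrable_restrict _ _ _ _).1 => //.
  rewrite setIidr//.
  apply/integrableP; split.
    by apply/measurable_EFinP; apply: measurable_funS mh => //; exact: measurable_itv.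
  by apply: ih; [exact: sub|exact: segment_compact].
apply/funext => x; rewrite indicE patchE.
by case: ifPn => _; rewrite ?mul1r ?mul0r.
Qed.

Lemma step_test_cvg h (al be c0 : R) : locally_integrable I h -> - l < al ->
  al < be -> 0 < c0 -> be + c0^-1 < l ->
  \int[mu]_(x in I) (h x * step_test al be (c0 + n%:R) x) @[n --> \oo] -->
  \int[mu]_(x in I) (h x * \1_(`]al, be]) x).
Proof.
move=> hh la ab c0p bl; have [mh _ _] := hh.
have cnp n : 0 < c0 + n%:R by rewrite ltr_wpDr.
have mst n : measurable_fun I (step_test al be (c0 + n%:R)).
  apply: measurable_funTS; apply: continuous_measurable_fun => x.
  apply: differentiable_continuous.
  exact: (times_differentiable_smooth
    (fun k => times_differentiable_step_test k al be (c0 + n%:R)) [::]).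
(* The supports shrink as n grows, so the one for n = 0 contains all of them; [h] is integrable
   there though only locally integrable on the whole interval. *)
apply: (Rintegral_dominated (g := fun x => `|\1_(`[al, be + c0^-1]) x * h x|)).
- by move=> n; exact: measurable_funM.
- by apply: measurable_funM => //; exact: measurable_indic.
- apply: nearW => x _; apply: cvgMr.
  have -> : \1_(`]al, be]) x = (al < x)%R%:R - (be < x)%R%:R :> R.
    rewrite indicE mem_setE in_itv/=.
    have [ax|xa] := ltP al x; have [bx|xb] := ltP be x => /=; rewrite ?(subr0,subrr)//.
    lra.
  by apply: cvgB; exact: smooth_step_cvg.
- by apply: integrable_norm; exact: locally_integrable_itv.
- move=> n x Ix; rewrite !normrM mulrC.
  rewrite ler_wpM2r//.
  have [xin|xnot] := boolP (al <= x <= be + c0^-1).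
    by rewrite indicE mem_setE in_itv/= xin normr1 step_test_le1.
  rewrite step_test_eq0 ?normr0// negb_and -!ltNge.
  move: xnot; rewrite negb_and -!ltNge => /orP[->//|h1].
  apply/orP; right; apply: le_lt_trans h1; rewrite lerD2l lef_pV2//.
    by rewrite lerDl.
  exact: cnp.
Qed.

End step_test_functions.

(** * One-sided approximate identities *)

Section step_kernel.
Context {R : realType} (l : R) (l0 : 0 < l).
Local Notation mu := (@lebesgue_measure R).
Local Notation I := (`]- l, l[%classic : set R).
Implicit Types (f g h : R -> R) (x y c : R).
Variables (th : R -> R) (C : R).
Hypothesis dth : forall x : R, is_derive x 1 smooth_step (th x).
Hypothesis cth : continuous th.
Hypothesis th0 : forall x, ~~ (0 <= x <= 1) -> th x = 0.
Hypothesis C0 : 0 < C.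
Hypothesis thC : forall x, `|th x| <= C.

(** The derivative of the rescaled step: a bump of mass 1 on [al, al + 1/c], bounded by a multiple
    of c. *)
Definition step_kernel c (al x : R) : R := c * th (c * (x - al)).

Lemma is_derive_step c al x :
  is_derive x 1 (fun y => smooth_step (c * (y - al))) (step_kernel c al x).
Proof.
rewrite /step_kernel mulrC.
have d : is_derive x 1 (fun y : R => c * (y - al)) c.
  have := @is_deriveZ R R R (fun y => y - al) c x 1 1.
  rewrite /GRing.scale/= mulr1; apply.
  have := @is_deriveB R R R id (cst al) x 1 1 0 (is_derive_id x 1) _.
  by rewrite subr0; apply.
exact: (@is_derive1_comp R smooth_step (fun y => c * (y - al)) x _ _ (dth _) d).
Qed.

Lemma continuous_step_kernel c al : continuous (step_kernel c al).
Proof.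
move=> x; apply: cvgMr.
apply: (@continuous_comp _ _ _ (fun y => c * (y - al)) th); last exact: cth.
by apply: cvgMr; apply: cvgB; [exact: cvg_id|exact: cvg_cst].
Qed.

Lemma step_kernel_eq0 c al x : 0 < c -> ~~ (al <= x <= al + c^-1) ->
  step_kernel c al x = 0.
Proof.
move=> c0 nx; rewrite /step_kernel th0 ?mulr0//; apply: contra nx.
by rewrite pmulr_rge0// -ler_pdivlMl// mulr1 => /andP[h1 h2]; apply/andP; split; lra.
Qed.

Lemma step_kernel_le c al x : 0 < c -> `|step_kernel c al x| <= c * C.
Proof. by move=> c0; rewrite normrM gtr0_norm// ler_wpM2l// ltW. Qed.

Lemma measurable_step_kernel c al (D : set R) : measurable_fun D (step_kernel c al).
Proof.
apply: measurable_funTS; apply: continuous_measurable_fun.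
exact: continuous_step_kernel.
Qed.

Lemma step_kernel_integral c al : 0 < c -> - l < al -> al + c^-1 < l ->
  \int[mu]_(x in I) step_kernel c al x = 1.
Proof.
move=> c0 la al_l; have ci : 0 < c^-1 by rewrite invr_gt0.
have sub : `[al, al + c^-1] `<=` I.
  by move=> x; rewrite /= !in_itv/= => /andP[ax xb]; apply/andP; split; lra.
transitivity (\int[mu]_(x in `[al, al + c^-1]) step_kernel c al x).
  rewrite -[in RHS](setIidr sub) Rintegral_mkcondr; apply: eq_Rintegral => x _.
  rewrite patchE; case: ifPn => //; rewrite mem_setE in_itv/= => nx.
  exact: step_kernel_eq0.
transitivity (smooth_step (c * (al + c^-1 - al)) - smooth_step (c * (al - al))).
  apply: (@Rintegral_derive R (fun y => smooth_step (c * (y - al)))).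
  - by rewrite lerDl ltW.
  - by move=> x _; exact: is_derive_step.
  - by move=> x _; exact: continuous_step_kernel.
rewrite smooth_step_eq1; last by rewrite addrC addKr mulfV// gt_eqF.
by rewrite smooth_step_eq0 ?subr0// subrr mulr0.
Qed.

(** Since the bump has mass 1, is bounded by c C and lives at distance at most 1/c from [al], the
    error is at most a constant times the mean oscillation of [f] on a ball of radius comparable to
    1/c, which tends to 0 at a Lebesgue point. *)
Lemma step_kernel_cvg f al c0 : L1I l f -> lebesgue_pt (f \_ I) al ->
  - l < al -> 0 < c0 -> al + c0^-1 < l ->
  \int[mu]_(x in I) (f x * step_kernel (c0 + n%:R) al x) @[n --> \oo] --> f al.
Proof.
move=> If lf la c0p al_l.
have cnp n : 0 < c0 + n%:R by rewrite ltr_wpDr.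
have cni n : (c0 + n%:R)^-1 <= c0^-1.
  by rewrite lef_pV2 ?posrE// lerDl.
have Ial : I al.
  have : 0 < c0^-1 by rewrite invr_gt0.
  by rewrite /= in_itv/= la/= => ?; lra.
(* The radius 2/c puts the closed support [al, al + 1/c] inside the open ball. That ball has length
   4/c, whence the factor 4 C below. *)
pose r n : R := 2 / (c0 + n%:R).
have r0 n : 0 < r n by rewrite divr_gt0.
have cvr : r @ \oo --> (0:R).
  apply: (@squeeze_cvgr _ _ _ _ (fun=> 0) (fun n => 4 * harmonic n)).
  - near=> n; rewrite ltW//= /r ler_pdivrMr// mulrAC -ler_pdivrMr ?invr_gt0//.
    rewrite invrK -natr1; have : 1 <= n%:R :> R.
      by rewrite ler1n; near: n; exact: nbhs_infty_gt.
    by lra.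
  - exact: cvg_cst.
  - by rewrite -[X in _ --> X](mulr0 4); apply: cvgMr; exact: cvg_harmonic.
have Ik n : L1I l (fun x => f x * step_kernel (c0 + n%:R) al x).
  apply: (@L1IM _ _ _ _ ((c0 + n%:R) * C)) => //; first exact: measurable_step_kernel.
  by move=> x _; exact: step_kernel_le.
have I1k n : L1I l (step_kernel (c0 + n%:R) al).
  apply: (@L1I_bounded _ _ _ ((c0 + n%:R) * C)); first exact: measurable_step_kernel.
  by move=> x _; exact: step_kernel_le.
have dav : davg (f \_ I) al (r n) @[n --> \oo] --> 0%E.
  by move/cvge_at_rightP : lf; apply; split => //.
have mf : measurable_fun setT (f \_ I).
  by apply/(measurable_restrictT _ _).1 => //; exact: L1I_measurable.
have bound n : ((`|\int[mu]_(x in I) (f x * step_kernel (c0 + n%:R) al x) - f al|)%:E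
    <= (4 * C)%:E * davg (f \_ I) al (r n))%E.
  set c := c0 + n%:R.
  have -> : \int[mu]_(x in I) (f x * step_kernel c al x) - f al =
     \int[mu]_(x in I) ((f x - f al) * step_kernel c al x).
    transitivity (\int[mu]_(x in I) (f x * step_kernel c al x - f al * step_kernel c al x)).
      rewrite RintegralB//; [|exact: Ik|by apply: L1IZ; exact: I1k].
      rewrite RintegralZl//; last exact: I1k.
      rewrite step_kernel_integral ?mulr1//; first exact: cnp.
      by have := cni n; rewrite -/c; lra.
    by apply: eq_Rintegral => x _; rewrite mulrBl.
  have Idk : L1I l (fun x => (f x - f al) * step_kernel c al x).
    rewrite (_ : (fun x => _) = fun x => f x * step_kernel c al x - f al * step_kernel c al x).
      by apply: L1IB; [exact: Ik|apply: L1IZ; exact: I1k].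
    by apply/funext => x; rewrite mulrBl.
  rewrite EFin_normr_Rintegral//.
  apply: (le_trans (le_abse_integral _ _ _)) => //.
    by apply/measurable_EFinP; apply: (@L1I_measurable _ l).
  rewrite /davg /iavg lebesgue_measure_ball; last exact: ltW.
  rewrite inver; case: ifPn => [/eqP r2|r2]; first by exfalso; have := r0 n; lra.
  rewrite muleA -EFinM.
  have -> : 4 * C * (r n *+ 2)^-1 = c * C.
    have c0' : c != 0 by rewrite gt_eqF ?cnp.
    by rewrite /r -/c -mulr_natr; field.
  have cn0 : 0 < c by exact: cnp.
  have mfc : measurable_fun setT (fun x => `|(f \_ I) x - (f \_ I) al|).
    by apply: measurableT_comp => //; exact: measurable_funB.
  rewrite -ge0_integralZl//; last 2 first.
    by apply/measurable_EFinP; exact: measurable_funTS.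
    by rewrite lee_fin mulr_ge0// ltW.
  rewrite [leLHS]integral_mkcond [leRHS]integral_mkcond.
  apply: ge0_le_integral => //.
  - by move=> x _; apply: erestrict_ge0 => y _; rewrite lee_fin.
  - apply/(measurable_restrictT _ _).1 => //.
    apply/measurable_EFinP; apply: measurableT_comp => //.
    exact: (@L1I_measurable _ l).
  - apply/(measurable_restrictT _ _).1; first exact: measurable_ball.
    apply/measurable_EFinP; apply: measurable_funM => //.
    exact: measurable_funTS.
  move=> x _; set rhs := (leRHS).
  have rhs0 : (0 <= rhs)%E.
    by apply: erestrict_ge0 => y _; rewrite lee_fin mulr_ge0// mulr_ge0// ltW.
  rewrite [leLHS]patchE.
  case: ifPn => // /set_mem Ix.
  have [xin|xnot] := boolP (al <= x <= al + c^-1); last first.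
    by rewrite /= step_kernel_eq0// mulr0 normr0.
  rewrite /rhs patchE mem_set; last first.
    rewrite /ball/= ltr_norml; have : 0 < c^-1 by rewrite invr_gt0.
    by move: xin => /andP[h1 h2]; rewrite /r -/c => ?; apply/andP; split; lra.
  have fI y : I y -> (f \_ I) y = f y by move=> Iy; rewrite patchE mem_set.
    have : `|(f x - f al) * step_kernel c al x| <= c * C * `|(f \_ I) x - (f \_ I) al|.
      by rewrite (fI al Ial) (fI x Ix) normrM mulrC ler_wpM2r// step_kernel_le.
    by rewrite -lee_fin EFinM.
  exact: measurable_ball.
apply/subr_cvg0; apply: norm_cvg0.
have : (`|\int[mu]_(x in I) (f x * step_kernel (c0 + n%:R) al x) - f al|)%:E
    @[n --> \oo] --> 0%:E.
  apply: (@squeeze_cvge _ _ _ _ (cst 0%E) _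
    (fun n => (4 * C)%:E * davg (f \_ I) al (r n))%E).
  - by apply: nearW => n; rewrite lee_fin normr_ge0/= bound.
  - exact: cvg_cst.
  - rewrite -[X in _ --> X](mule0 (4 * C)%:E).
    by apply: cvgeZl => //.
by move=> h; have [] := (fine_cvgP _ _).1 h.
Unshelve. all: by end_near. Qed.

End step_kernel.

(** * Weak derivatives on an interval *)

Section weak_derivatives.
Context {R : realType} (l : R) (l0 : 0 < l).
Local Notation mu := (@lebesgue_measure R).
Local Notation I := (`]- l, l[%classic : set R).
Implicit Types (f g h : R -> R) (x y c : R).

Definition wder f g : Prop :=
  [/\ locally_integrable I f, locally_integrable I g &
    forall phi : R -> R, test_function I phi ->
      \int[mu]_(x in I) (f x * 'D_1 phi x) = - \int[mu]_(x in I) (g x * phi x)].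

(** Testing against [step_test] puts the bump at [al] minus the bump at [be] against [f]; these
    converge to the values at the two Lebesgue points, while the side with [g] converges to its
    integral over ]al, be]. *)
Lemma wder_increment f g (al be : R) : wder f g -> L1I l f ->
  lebesgue_pt (f \_ I) al -> lebesgue_pt (f \_ I) be ->
  - l < al -> al < be -> be < l ->
  \int[mu]_(x in I) (g x * \1_(`]al, be]) x) = f be - f al.
Proof.
move=> [_ lg fg] If lal lbe la ab bl.
have [th [dth cth th0 [C C0 thC]]] := @smooth_step_derivative R.
(* Then be + 1/c0 is the midpoint of be and l, so all the test functions are supported inside. *)
pose c0 := 2 / (l - be).
have c0p : 0 < c0 by rewrite divr_gt0// subr_gt0.
have c0i : c0^-1 = (l - be) / 2 by rewrite invf_div.
have c0l : be + c0^-1 < l by rewrite c0i; lra.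
have c0l' : al + c0^-1 < l by lra.
have cnp n : 0 < c0 + n%:R by rewrite ltr_wpDr.
have cni n : (c0 + n%:R)^-1 <= c0^-1 by rewrite lef_pV2 ?posrE// lerDl.
have Ik c a : 0 < c -> L1I l (fun x => f x * step_kernel th c a x).
  move=> c1; apply: (@L1IM _ _ _ _ (c * C)) => //.
    exact: measurable_step_kernel.
  by move=> x _; exact: step_kernel_le.
have eqn n : \int[mu]_(x in I) (f x * step_kernel th (c0 + n%:R) be x) -
    \int[mu]_(x in I) (f x * step_kernel th (c0 + n%:R) al x) =
    \int[mu]_(x in I) (g x * step_test al be (c0 + n%:R) x).
  set c := c0 + n%:R.
  have tst : test_function I (step_test al be c).
    apply: step_test_test_function => //; first exact: cnp.
    by have := cni n; rewrite -/c; lra.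
  have := fg _ tst => /(congr1 -%R); rewrite opprK => <-.
  rewrite [X in _ = - X](_ : _ = \int[mu]_(x in I)
    (f x * step_kernel th c al x - f x * step_kernel th c be x)).
    by rewrite RintegralB; [rewrite opprB| |apply: Ik; exact: cnp|apply: Ik; exact: cnp].
  apply: eq_Rintegral => x _; rewrite -mulrBr; congr (_ * _).
  have da := is_derive_step dth c al x; have db := is_derive_step dth c be x.
  by have := is_deriveB da db => h; rewrite -[RHS](@derive_val _ _ _ _ _ _ _ h).
have l1 := step_kernel_cvg dth cth th0 C0 thC If lbe (lt_trans la ab) c0p c0l.
have l2 := step_kernel_cvg dth cth th0 C0 thC If lal la c0p c0l'.
have l4 := step_test_cvg lg la ab c0p c0l.
have l5 : \int[mu]_(x in I) (g x * step_test al be (c0 + n%:R) x) @[n --> \oo] -->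
    f be - f al.
  by rewrite -(funext eqn); exact: cvgB l1 l2.
exact: (cvg_unique _ l4 l5).
Qed.

Lemma ae_I_exists (P : R -> Prop) : {ae mu, forall x, P x} -> exists2 x, I x & P x.
Proof.
move=> [N [mN N0 PN]]; apply: contrapT => h.
have sub : I `<=` N.
  by move=> x Ix; apply: PN => Px; apply: h; exists x.
have : (mu I <= mu N)%E.
  by apply: le_measure; [apply/mem_set; exact: measurable_itv|exact/mem_set|exact: sub].
by rewrite N0 measure_oitv// lee_fin leNgt mulr_gt0.
Qed.

(** Almost every point is a Lebesgue point of [f], and between two such points [f] and [prim l g]
    have the same increment; one of them, [x0], fixes the constant. *)
Lemma wder_prim f g : wder f g -> L1I l f -> L1I l g ->
  exists c, {ae mu, forall x, I x -> f x = c + prim l g x}.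
Proof.
move=> fg If Ig.
have lp : {ae mu, forall x, lebesgue_pt (f \_ I) x}.
  by apply: lebesgue_differentiation; apply: integrable_locally.
have [x0 Ix0 lx0] := ae_I_exists lp.
have incr x y : I x -> I y -> lebesgue_pt (f \_ I) x -> lebesgue_pt (f \_ I) y ->
    x < y -> prim l g y - prim l g x = f y - f x.
  rewrite /= !in_itv/= => /andP[lx xl] /andP[ly yl] px py xy.
  rewrite -(wder_increment fg If px py)// prim_diff//; last exact: ltW.
  by apply: eq_Rintegral => t _; rewrite mulrC.
exists (f x0 - prim l g x0); move: lp; apply: filterS.
  exact: (ae_filter_ringOfSetsType mu).
move=> x lx Ix; have [xx0|x0x|->] := ltgtP x x0.
- by have := incr _ _ Ix Ix0 lx lx0 xx0; lra.
- by have := incr _ _ Ix0 Ix lx0 lx x0x; lra.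
- by rewrite subrK.
Qed.

(** The fundamental lemma of the calculus of variations: [step_test] shows that all integrals of [h]
    over ]al, be] vanish, and Lebesgue differentiation then gives h = 0. As [h] is only locally
    integrable, this is done on an exhausting sequence of intervals. *)
Lemma test_integral_eq0 h : locally_integrable I h ->
  (forall phi, test_function I phi -> \int[mu]_(x in I) (h x * phi x) = 0) ->
  {ae mu, forall x, I x -> h x = 0}.
Proof.
move=> lh h0.
have inc (al be : R) : - l < al -> al < be -> be < l ->
    \int[mu]_(x in I) (h x * \1_(`]al, be]) x) = 0.
  move=> la ab bl.
  pose c0 := 2 / (l - be).
  have c0p : 0 < c0 by rewrite divr_gt0// subr_gt0.
  have c0i : c0^-1 = (l - be) / 2 by rewrite invf_div.
  have c0l : be + c0^-1 < l by rewrite c0i; lra.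
  have l4 := step_test_cvg lh la ab c0p c0l.
  suff l5 : \int[mu]_(x in I) (h x * step_test al be (c0 + n%:R) x) @[n --> \oo] -->
      (0 : R) by exact: (cvg_unique _ l4 l5).
  apply: cvg_near_cst; apply: nearW => n; apply: h0.
  apply: step_test_test_function => //; first by rewrite ltr_wpDr.
  have : (c0 + n%:R)^-1 <= c0^-1 by rewrite lef_pV2 ?posrE ?ltr_wpDr// lerDl.
  lra.
(* With n + 2 instead of n + 1, [m n] is already positive at n = 0. *)
pose m n : R := l * (1 - (n.+2)%:R^-1).
have m0 n : 0 < m n.
  rewrite mulr_gt0// subr_gt0 invf_lt1// ltr1n//.
have ml n : m n < l by rewrite gtr_pMr// gtrBl invr_gt0.
have step n : {ae mu, forall x, - m n < x < m n -> h x = 0}.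
  pose g := h \_ `]- m n, m n].
  have [mh _ ih] := lh.
  have lm : - l < - m n by rewrite ltrN2.
  have sub : `[- m n, m n] `<=` I.
    move=> x; rewrite /= !in_itv/= => /andP[h1 h2].
    by rewrite (lt_le_trans lm h1) (le_lt_trans h2 (ml n)).
  have Ihm : mu.-integrable `]- m n, m n] (EFin \o h).
    apply: (@integrableS _ _ _ mu `[- m n, m n]) => //; last first.
      apply/integrableP; split.
        by apply/measurable_EFinP; apply: measurable_funS mh => //; exact: measurable_itv.
      by apply: ih; [exact: sub|exact: segment_compact].
    by apply: subset_itvr; rewrite bnd_simp.
  have lg : locally_integrable setT g by exact: integrable_locally.
  have Ig y : mu.-integrable `]-oo, y] (EFin \o g).
    apply: (@integrableS _ _ _ mu setT) => //.
    by rewrite /g -restrict_EFin; apply: (integrable_mkcond _ _).1.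
  have := FTC1Ny Ig lg; apply: filterS; first exact: (ae_filter_ringOfSetsType mu).
  move=> x [_] + xm.
  rewrite {2}/g patchE mem_set ?/=; last first.
    by rewrite in_itv/=; case/andP: xm => -> /ltW.
  (* At such a point h x is the derivative of the integral of [h] from -m n to y, which by [inc]
     vanishes for all y near x. *)
  move=> <-; rewrite derive1E.
  rewrite -(@near_eq_derive _ _ _ (cst (0 : R))) ?derive_cst//.
  have : x \in `]- m n, m n[ by rewrite in_itv.
  move=> /near_in_itvoo; apply: filterS => y; rewrite /= in_itv/= => /andP[my ym].
  rewrite -Rintegral_mkcondr -[LHS](inc (- m n) y)//; last exact: lt_trans ym _.
  rewrite -[in RHS](setIidl (_ : `]-oo, y] `&` `]- m n, m n] `<=` I)); last first.
    move=> t [_]; rewrite /= !in_itv/= => /andP[h1 h2].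
    by rewrite (lt_trans lm h1) (le_lt_trans h2 (ml n)).
  rewrite Rintegral_mkcondl; apply: eq_Rintegral => t _.
  rewrite indicE patchE in_setI !mem_setE !in_itv/=.
  have -> : (t <= y) && (- m n < t <= m n) = (- m n < t <= y).
    have [ty|ty] := leP t y; rewrite /= ?andbF ?andbT//.
    by rewrite (le_trans ty (ltW ym)) andbT.
  by case: ifPn => _; rewrite ?mulr1 ?mulr0.
have : {ae mu, forall x, forall n, - m n < x < m n -> h x = 0}.
  by apply: ae_foralln.
apply: filterS; first exact: (ae_filter_ringOfSetsType mu).
move=> x hx; rewrite /= in_itv/= => lxl.
have xl : `|x| < l by rewrite ltr_norml.
have : m n @[n --> \oo] --> l.
  rewrite -[X in _ --> X]mulr1; apply: cvgMr.
  rewrite -[X in _ --> X]subr0; apply: cvgB; first exact: cvg_cst.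
  apply: (@squeeze_cvgr _ _ _ _ (fun=> 0) harmonic) => //.
  - by apply: nearW => n; rewrite invr_ge0 ler0n/= lef_pV2 ?posrE// ler_nat.
  - exact: cvg_cst.
  - exact: cvg_harmonic.
move=> /cvgr_gt/(_ _ xl) => -[n _ /(_ n (leqnn _)) /= xn].
by apply: (hx n); rewrite -ltr_norml.
Qed.

End weak_derivatives.

Section weak_derivative_of_C1.
Context {R : realType} (l : R) (l0 : 0 < l).
Local Notation mu := (@lebesgue_measure R).
Local Notation I := (`]- l, l[%classic : set R).
Implicit Types (f g h phi : R -> R) (x y c : R).

(** The bounds are the midpoints between the extreme points of the compact set and the ends of the
    interval. The slack makes [phi] vanish at [al] and [be] themselves, as needed for boundary
    terms. *)
Lemma test_function_support phi : test_function I phi ->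
  exists al be, [/\ - l < al, al < be, be < l &
    forall x, ~~ (al < x < be) -> phi x = 0].
Proof.
move=> [_ [K [cK KI phi0]]].
have [K0|/set0P K0] := eqVneq K set0.
  exists (- (l / 2)), (l / 2); split; [move: l0; lra|move: l0; lra|move: l0; lra|].
  by move=> x _; apply: phi0; rewrite K0.
have cid : {within K, continuous (id : R -> R)}.
  by apply: continuous_subspaceT => x; exact: cvg_id.
have [b /set_mem Kb hb] := compact_EVT_max K0 cK cid.
have [a /set_mem Ka ha] := compact_EVT_min K0 cK cid.
have := KI _ Ka; have := KI _ Kb; rewrite /= !in_itv/= => /andP[lb bl] /andP[la al].
have ab : a <= b by apply: ha; exact/mem_set.
exists ((a - l) / 2), ((b + l) / 2); split; [lra|lra|lra|].
move=> x xnot; apply: phi0 => Kx; move/negP : xnot; apply.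
have ax : a <= x by apply: ha; exact/mem_set.
have xb : x <= b by apply: hb; exact/mem_set.
by apply/andP; split; lra.
Qed.

Lemma test_function_is_derive phi x : test_function I phi ->
  is_derive x 1 phi ('D_1 phi x).
Proof.
move=> [sphi _]; apply: DeriveDef => //; apply/derivable1_diffP.
exact: (sphi [::]).
Qed.

Lemma test_function_continuous phi : test_function I phi -> continuous phi.
Proof. by move=> [sphi _] x; apply: differentiable_continuous; exact: (sphi [::]). Qed.

Lemma test_function_continuousD phi : test_function I phi -> continuous ('D_1 phi).
Proof.
by move=> [sphi _] x; apply: differentiable_continuous; exact: (sphi [:: 1]).
Qed.

Lemma derive_eq0_outside phi (al be : R) :
  (forall x, ~~ (al < x < be) -> phi x = 0) ->
  forall x, ~~ (al <= x <= be) -> 'D_1 phi x = 0.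
Proof.
move=> phi0 x; rewrite negb_and -!ltNge => xnot.
rewrite -(@near_eq_derive _ _ _ (cst (0 : R))) ?derive_cst//.
case/orP : xnot => [xa|bx].
- near=> y; rewrite phi0// negb_and -!leNgt; apply/orP; left; apply: ltW.
  by near: y; exact: (@cvgr_lt _ _ (nbhs x) _ id x).
- near=> y; rewrite phi0// negb_and -!leNgt; apply/orP; right; apply: ltW.
  by near: y; exact: (@cvgr_gt _ _ (nbhs x) _ id x).
Unshelve. all: by end_near. Qed.

Lemma continuous_support_bounded phi (al be : R) : al <= be -> continuous phi ->
  (forall x, ~~ (al <= x <= be) -> phi x = 0) ->
  exists C, forall x, `|phi x| <= C.
Proof.
move=> ab cphi phi0.
have [|c _ hc] := @EVT_max R (fun x => `|phi x|) al be ab.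
  by apply: continuous_subspaceT => x; apply: cvg_norm; exact: cphi.
exists `|phi c| => x; have [xin|/phi0 ->] := boolP (al <= x <= be).
  exact: hc.
by rewrite normr0.
Qed.

Lemma L1IM_support f phi (al be : R) : locally_integrable I f ->
  - l < al -> al <= be -> be < l -> continuous phi ->
  (forall x, ~~ (al <= x <= be) -> phi x = 0) ->
  L1I l (fun x => f x * phi x).
Proof.
move=> lf la ab bl cphi phi0.
have [C hC] := continuous_support_bounded ab cphi phi0.
rewrite (_ : (fun x => _) = fun x => (\1_(`[al, be]) x * f x) * phi x).
  apply: (@L1IM _ _ _ _ C) => //; first exact: locally_integrable_itv.
  by apply: measurable_funTS; exact: continuous_measurable_fun.
apply/funext => x; have [xin|/phi0 ->] := boolP (al <= x <= be).
  by rewrite indicE mem_setE in_itv/= xin mul1r.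
by rewrite !mulr0.
Qed.

Lemma L1IM_test f phi : locally_integrable I f -> test_function I phi ->
  L1I l (fun x => f x * phi x).
Proof.
move=> lf tphi; have [al [be [la ab bl phi0]]] := test_function_support tphi.
apply: (L1IM_support lf la (ltW ab) bl (test_function_continuous tphi)).
move=> x; rewrite negb_and -!ltNge => h; apply: phi0.
by rewrite negb_and -!leNgt; case/orP : h => /ltW ->; rewrite ?orbT.
Qed.

Lemma wder_unique f g1 g2 : wder l f g1 -> wder l f g2 ->
  {ae mu, forall x, I x -> g1 x = g2 x}.
Proof.
move=> [_ lg1 fg1] [_ lg2 fg2].
have : {ae mu, forall x, I x -> g1 x - g2 x = 0}.
  apply: test_integral_eq0 => //; first exact: locally_integrableB.
  move=> phi tphi.
  transitivity (\int[mu]_(x in I) (g1 x * phi x - g2 x * phi x)).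
    by apply: eq_Rintegral => x _; rewrite mulrBl.
  rewrite RintegralB//; [|exact: L1IM_test|exact: L1IM_test].
  apply/eqP; rewrite subr_eq0; apply/eqP/oppr_inj.
  by rewrite -fg1// -fg2.
apply: filterS; first exact: (ae_filter_ringOfSetsType mu).
by move=> x + Ix => /(_ Ix)/eqP; rewrite subr_eq0 => /eqP.
Qed.

(** Integration by parts: the derivative of f phi is continuous on [al, be], and f phi vanishes at
    both ends. *)
Lemma wder_of_derivative f g : L1I l f -> L1I l g ->
  (forall x, I x -> is_derive x 1 f (g x)) ->
  (forall x, I x -> {for x, continuous g}) -> wder l f g.
Proof.
move=> If Ig df cg.
have lf : locally_integrable I f by apply: open_integrable_locally => //; exact: interval_open.
have lg : locally_integrable I g by apply: open_integrable_locally => //; exact: interval_open.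
split => // phi tphi.
have [al [be [la ab bl phi0]]] := test_function_support tphi.
have phi0' x : ~~ (al <= x <= be) -> phi x = 0.
  rewrite negb_and -!ltNge => h; apply: phi0.
  by rewrite negb_and -!leNgt; case/orP : h => /ltW ->; rewrite ?orbT.
have cphi := test_function_continuous tphi.
have cD := test_function_continuousD tphi.
have D0 := derive_eq0_outside phi0.
have If' := L1IM_support lf la (ltW ab) bl cD D0.
have Ig' := L1IM_support lg la (ltW ab) bl cphi phi0'.
apply/eqP; rewrite -subr_eq0 opprK; apply/eqP.
rewrite -RintegralD//.
have sub : `[al, be] `<=` I.
  by move=> x; rewrite /= !in_itv/= => /andP[ax xb]; apply/andP; split; lra.
transitivity (\int[mu]_(x in `[al, be]) (f x * 'D_1 phi x + g x * phi x)).
  rewrite -[in RHS](setIidr sub) Rintegral_mkcondr; apply: eq_Rintegral => x _.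
  rewrite patchE; case: ifPn => //; rewrite mem_setE in_itv/= => nx.
  by rewrite D0// phi0'// !mulr0 addr0.
have Iin x : al <= x <= be -> I x.
  by move=> xin; apply: sub; rewrite /= in_itv.
transitivity (f be * phi be - f al * phi al); last first.
  by rewrite (phi0 be) ?ltxx ?andbF// (phi0 al) ?ltxx// !mulr0 subrr.
apply: (@Rintegral_derive R (fun x => f x * phi x)).
- exact: ltW.
- move=> x /Iin Ix.
  refine (is_derive_eq (is_deriveM (df x Ix) (test_function_is_derive x tphi)) _).
  by rewrite /GRing.scale/= [phi x * _]mulrC.
- move=> x /Iin Ix; apply: cvgD; apply: cvgM; [|exact: cD|exact: cg|exact: cphi].
  apply: differentiable_continuous; apply/derivable1_diffP.
  have := df x Ix => ?; exact: ex_derive.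
Qed.

End weak_derivative_of_C1.

Local Notation Re := complex.Re.
Local Notation Im := complex.Im.

(** * Modification on null sets *)

Section ae_modification.
Context {R : realType} (l : R) (l0 : 0 < l).
Local Notation mu := (@lebesgue_measure R).
Local Notation I := (`]- l, l[%classic : set R).
Implicit Types (f g h phi : R -> R) (x y c : R).

Definition aeI f g : Prop := {ae mu, forall x, I x -> f x = g x}.

Lemma aeI_sym f g : aeI f g -> aeI g f.
Proof.
apply: filterS; first exact: (ae_filter_ringOfSetsType mu).
by move=> x + Ix => /(_ Ix).
Qed.

Lemma aeI_trans f g h : aeI f g -> aeI g h -> aeI f h.
Proof.
apply: filterS2; first exact: (ae_filter_ringOfSetsType mu).
by move=> x + + Ix => /(_ Ix) -> /(_ Ix).
Qed.

Lemma aeI2 (op : R -> R -> R -> R) f f' g g' : aeI f f' -> aeI g g' ->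
  aeI (fun x => op x (f x) (g x)) (fun x => op x (f' x) (g' x)).
Proof.
apply: filterS2; first exact: (ae_filter_ringOfSetsType mu).
by move=> x + + Ix => /(_ Ix) -> /(_ Ix) ->.
Qed.

Lemma aeI_eq f g : (forall x, I x -> f x = g x) -> aeI f g.
Proof. by move=> fg; exact: nearW. Qed.

Lemma aeI_Rintegral (D : set R) f g : measurable D -> D `<=` I ->
  measurable_fun I f -> measurable_fun I g -> aeI f g ->
  \int[mu]_(x in D) f x = \int[mu]_(x in D) g x.
Proof.
move=> mD DI mf mg fg; rewrite /Rintegral; congr fine.
apply: ae_eq_integral => //.
- by apply/measurable_EFinP; apply: measurable_funS mf => //; exact: measurable_itv.
- by apply/measurable_EFinP; apply: measurable_funS mg => //; exact: measurable_itv.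
- move: fg; apply: filterS; first exact: (ae_filter_ringOfSetsType mu).
  by move=> x fg Dx; rewrite fg//; exact: DI.
Qed.

(** Measurability of the modified function is a hypothesis here and below: measurable means Borel,
    which equality almost everywhere does not preserve. *)
Lemma L1I_ae f g : L1I l f -> measurable_fun I g -> aeI f g -> L1I l g.
Proof.
move=> /integrableP[mf fi] mg fg; apply/integrableP; split; first exact/measurable_EFinP.
apply: le_lt_trans fi; rewrite le_eqVlt; apply/orP; left; apply/eqP.
apply: ae_eq_integral => //.
- by apply: measurableT_comp => //; exact/measurable_EFinP.
- exact: measurableT_comp.
- move: fg; apply: filterS; first exact: (ae_filter_ringOfSetsType mu).
  by move=> x fg Ix /=; rewrite fg.
Qed.

Lemma locally_integrable_ae f g : locally_integrable I f -> measurable_fun I g ->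
  aeI f g -> locally_integrable I g.
Proof.
move=> [mf oI fi] mg fg; split => // K KI cK.
have mK := compact_measurable cK.
apply: le_lt_trans (fi K KI cK); rewrite le_eqVlt; apply/orP; left; apply/eqP.
apply: ae_eq_integral => //.
- apply/measurable_EFinP; apply: measurableT_comp => //.
  by apply: measurable_funS mg => //; exact: measurable_itv.
- apply/measurable_EFinP; apply: measurableT_comp => //.
  by apply: measurable_funS mf => //; exact: measurable_itv.
- move: fg; apply: filterS; first exact: (ae_filter_ringOfSetsType mu).
  by move=> x fg Kx /=; rewrite fg//; exact: KI.
Qed.

Lemma wder_ae f f' g g' : wder l f g -> measurable_fun I f' ->
  measurable_fun I g' -> aeI f f' -> aeI g g' -> wder l f' g'.
Proof.
move=> [lf lg fg] mf' mg' ff' gg'; split.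
- exact: locally_integrable_ae ff'.
- exact: locally_integrable_ae gg'.
move=> phi tphi; have [mf _ _] := lf; have [mg _ _] := lg.
have mphi : measurable_fun I phi.
  by apply: measurable_funTS; apply: continuous_measurable_fun;
    exact: test_function_continuous tphi.
have mD : measurable_fun I ('D_1 phi).
  by apply: measurable_funTS; apply: continuous_measurable_fun;
    exact: test_function_continuousD tphi.
rewrite (@aeI_Rintegral I _ (fun x => f x * 'D_1 phi x))//.
- rewrite fg//; congr (- _); apply: aeI_Rintegral => //.
  + exact: measurable_funM.
  + exact: measurable_funM.
  + exact: (aeI2 (fun _ a b => a * b)) gg' (aeI_eq (fun _ _ => erefl)).
- exact: measurable_funM.
- exact: measurable_funM.
- exact: (aeI2 (fun _ a b => a * b)) (aeI_sym ff') (aeI_eq (fun _ _ => erefl)).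
Qed.

Lemma kop_ae kap f g : good_kernel l kap -> measurable_fun I f ->
  measurable_fun I g -> aeI f g -> kop l kap f = kop l kap g.
Proof.
move=> [_ mk _] mf mg fg; apply/funext => x; apply: aeI_Rintegral => //.
- exact: measurable_funM.
- exact: measurable_funM.
- exact: (aeI2 (fun _ a b => a * b)) (aeI_eq (fun _ _ => erefl)) fg.
Qed.

(** If two continuous functions differ at a point they differ on a ball, which has positive
    measure. *)
Lemma aeI_continuous f g : (forall x, I x -> {for x, continuous f}) ->
  (forall x, I x -> {for x, continuous g}) -> aeI f g ->
  forall x, I x -> f x = g x.
Proof.
move=> cf cg fg x Ix; apply/eqP; rewrite -subr_eq0; apply: contrapT => /negP d0.
pose d y := `|f y - g y|.
have d0' : 0 < d x by rewrite normr_gt0.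
have cd : d @ x --> d x by apply: cvg_norm; apply: cvgB; [exact: cf|exact: cg].
have [e /= e0 he] : \forall y \near x, I y /\ 0 < d y.
  near=> y; split; near: y; last exact: (cvgr_gt _ cd).
  exact: near_in_itvoo.
have [N [mN N0 hN]] := fg.
have sub : ball x e `<=` N.
  move=> y /he[Iy dy]; apply: hN => /(_ Iy) fgy.
  by move: dy; rewrite /d fgy subrr normr0 ltxx.
have : (mu (ball x e) <= mu N)%E.
  by apply: le_measure; [apply/mem_set; exact: measurable_ball|exact/mem_set|exact: sub].
rewrite N0 lebesgue_measure_ball; last exact: ltW.
by rewrite lee_fin leNgt pmulrn_lgt0// e0.
Unshelve. all: by end_near. Qed.

End ae_modification.

(** * Real and imaginary parts *)

Section complex_facts.
Context {R : realType} (l : R) (l0 : 0 < l).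
Local Notation mu := (@lebesgue_measure R).
Local Notation I := (`]- l, l[%classic : set R).
Implicit Types (f g : R -> R[i]).

Lemma Re_mulr (z : R[i]) (r : R) : Re (z * r%:C) = Re z * r.
Proof. by case: z => x y /=; rewrite mulr0 subr0. Qed.

Lemma Im_mulr (z : R[i]) (r : R) : Im (z * r%:C) = Im z * r.
Proof. by case: z => x y /=; rewrite mulr0 add0r. Qed.

(** Test functions are real, so the complex identity splits into its two components. *)
Lemma weak_derivativeP f g : weak_derivative l f g <->
  wder l (fun x => Re (f x)) (fun x => Re (g x)) /\
  wder l (fun x => Im (f x)) (fun x => Im (g x)).
Proof.
have E (h : R -> R[i]) (phi : R -> R) : Cint mu I (fun x => h x * (phi x)%:C) =
    (\int[mu]_(x in I) (Re (h x) * phi x)) +i* (\int[mu]_(x in I) (Im (h x) * phi x)).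
  by rewrite /Cint; congr (_ +i* _); apply: eq_Rintegral => x _;
    rewrite ?Re_mulr ?Im_mulr.
split.
- move=> [l1 l2 l3 l4 h]; split; split => // phi tphi.
    by have := congr1 (@complex.Re R) (h phi tphi); rewrite !E.
  by have := congr1 (@complex.Im R) (h phi tphi); rewrite !E.
- move=> [[l1 l3 h1] [l2 l4 h2]]; split => // phi tphi.
  by rewrite !E h1// h2.
Qed.

Lemma weakDP f : weakly_differentiable l f -> weak_derivative l f (weakD l f).
Proof. by move=> [g fg]; rewrite /weakD; apply: (xgetPex (fun=> 0)); exists g. Qed.

Lemma weakD_wder f : weakly_differentiable l f ->
  wder l (fun x => Re (f x)) (fun x => Re (weakD l f x)) /\
  wder l (fun x => Im (f x)) (fun x => Im (weakD l f x)).
Proof. by move=> /weakDP/weak_derivativeP. Qed.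

Lemma Cmod_le (z : R[i]) : Cmod z <= `|Re z| + `|Im z|.
Proof.
case: z => x y; rewrite /Cmod /=.
rewrite -[leRHS]ger0_norm ?addr_ge0// -sqrtr_sqr ler_sqrt ?sqr_ge0//.
by rewrite sqrrD !real_normK ?num_real// lerD2r lerDl mulrn_wge0// mulr_ge0.
Qed.

Lemma Re_le_Cmod (z : R[i]) : `|Re z| <= Cmod z.
Proof.
by case: z => x y; rewrite /Cmod /= -sqrtr_sqr ler_wsqrtr// lerDl sqr_ge0.
Qed.

Lemma Im_le_Cmod (z : R[i]) : `|Im z| <= Cmod z.
Proof.
by case: z => x y; rewrite /Cmod /= -sqrtr_sqr ler_wsqrtr// lerDr sqr_ge0.
Qed.

Lemma Cmod_ge0 (z : R[i]) : 0 <= Cmod z.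
Proof. by case: z => x y; exact: sqrtr_ge0. Qed.

Lemma measurable_Cmod f : Cmeasurable_fun I f -> measurable_fun I (fun x => Cmod (f x)).
Proof.
move=> [mr mi].
rewrite (_ : (fun x => _) = fun x => Num.sqrt (Re (f x) ^+ 2 + Im (f x) ^+ 2)).
  apply: (measurableT_comp (f := fun y : R => Num.sqrt y)).
    by apply: continuous_measurable_fun; exact: sqrt_continuous.
  by apply: measurable_funD; apply: measurable_funX.
by apply/funext => x; case: (f x).
Qed.

Lemma LpC_integrable (p : R) f : 1 <= p -> LpC mu I p%:E f ->
  L1I l (fun x => Cmod (f x) `^ p).
Proof.
move=> p1 [mf Np]; have p0 : p != 0 by rewrite gt_eqF// (lt_le_trans _ p1).
have mC := measurable_Cmod mf.
apply/integrableP; split.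
  by apply/measurable_EFinP; apply: (measurableT_comp (measurable_powR p)).
have := poweR_lty p Np; rewrite poweR_Lnorm// => h.
apply: le_lt_trans h; rewrite [leLHS]integral_mkcond.
rewrite le_eqVlt; apply/orP; left; apply/eqP; apply: eq_integral => x _.
rewrite !patchE; case: ifPn => _ /=.
  by rewrite ger0_norm ?powR_ge0// ger0_norm// Cmod_ge0.
by rewrite normr0 powR0.
Qed.

(** From |z| <= 1 + |z|^p and the finite length of the interval; it reduces every exponent p to
    L^1. *)
Lemma LpC_L1I (p : R) f : 1 <= p -> LpC mu I p%:E f ->
  L1I l (fun x => Re (f x)) /\ L1I l (fun x => Im (f x)).
Proof.
move=> p1 hf; have Ip := LpC_integrable p1 hf; have [[mr mi] _] := hf.
have I1 : L1I l (fun x => 1 + Cmod (f x) `^ p).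
  by apply: L1ID => //; exact: (L1I_cst l 1).
have le1 x : Cmod (f x) <= 1 + Cmod (f x) `^ p.
  have [c1|/ltW c1] := leP (Cmod (f x)) 1.
    by rewrite ler_wpDr// powR_ge0.
  rewrite -[leLHS]powRr1 ?Cmod_ge0//.
  by rewrite ler_wpDl// ler_powR.
split; apply: (L1I_le _ _ I1) => // x _.
  exact: le_trans (Re_le_Cmod _) (le1 x).
exact: le_trans (Im_le_Cmod _) (le1 x).
Qed.

Lemma LpC1 f : L1I l (fun x => Re (f x)) -> L1I l (fun x => Im (f x)) ->
  LpC mu I 1%:E f.
Proof.
move=> Ir Ii; split; first by split; exact: (@L1I_measurable _ l).
rewrite Lnorm1.
have /integrableP[_] : L1I l (fun x => `|Re (f x)| + `|Im (f x)|).
  by apply: L1ID; exact: integrable_norm.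
apply: le_lt_trans.
rewrite [leRHS]integral_mkcond.
apply: ge0_le_integral => //.
- apply: measurableT_comp => //; apply/(measurable_restrictT _ _).1 => //.
  apply/measurable_EFinP; apply: measurable_Cmod.
  by split; exact: (@L1I_measurable _ l).
- apply/(measurable_restrictT _ _).1 => //.
  apply: measurableT_comp => //; apply/measurable_EFinP.
  by apply: measurable_funD; apply: measurableT_comp => //; exact: (@L1I_measurable _ l).
- move=> x _; rewrite !patchE; case: ifPn => _ /=; last by rewrite normr0.
  by rewrite lee_fin ger0_norm ?Cmod_ge0// ger0_norm ?addr_ge0// Cmod_le.
Qed.

End complex_facts.

(** * From the eigenfunctions to the transmutation identity *)

Section clamped_kernel.
Context {R : realType} (l : R) (l0 : 0 < l).
Local Notation mu := (@lebesgue_measure R).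
Local Notation I := (`]- l, l[%classic : set R).

(* Composing with [clamp] extends a kernel on the closed square to a bounded
   continuous kernel on the plane. *)
Definition clamp (y : R) : R := Num.max (- l) (Num.min l y).

Lemma clamp_itv y : - l <= clamp y <= l.
Proof.
by rewrite /clamp le_max lexx/= ge_max ge_min lexx/= andbT; move: l0; lra.
Qed.

Lemma clamp_id y : - l <= y <= l -> clamp y = y.
Proof. by move=> /andP[ly yl]; rewrite /clamp min_r// max_r. Qed.

Lemma continuous_clamp : continuous clamp.
Proof.
move=> y; apply: (@continuous_max _ _ (cst (- l)) (cst l \min id)).
  exact: cvg_cst.
by apply: (@continuous_min _ _ (cst l) id); [exact: cvg_cst|exact: cvg_id].
Qed.

Lemma continuous_clamped (f : R * R -> R) :
  {within closed_square l, continuous f} ->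
  continuous (fun z : R * R => f (clamp z.1, clamp z.2)).
Proof.
move=> /subspace_continuousP cf z U Uf.
have Az y : closed_square l (clamp y.1, clamp y.2).
  by split; rewrite /= in_itv/= clamp_itv.
have := cf _ (Az z) U Uf; rewrite /= /nbhs/= /within/= => h.
have cg : (fun z : R * R => (clamp z.1, clamp z.2)) @ z --> (clamp z.1, clamp z.2).
  apply: (@cvg_pair _ _ _ _ (nbhs (clamp z.1)) (nbhs (clamp z.2))).
    by apply: (@continuous_comp _ _ _ fst clamp); [exact: cvg_fst|exact: continuous_clamp].
  by apply: (@continuous_comp _ _ _ snd clamp); [exact: cvg_snd|exact: continuous_clamp].
have hz : \forall y \near z, closed_square l (clamp y.1, clamp y.2) ->
    U (f (clamp y.1, clamp y.2)) by exact: (cg _ h).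
by apply: filterS hz => y; apply; exact: Az.
Qed.

Lemma bounded_clamped (f : R * R -> R) :
  {within closed_square l, continuous f} ->
  exists C, forall x t, `|f (clamp x, clamp t)| <= C.
Proof.
move=> cf; have cA : compact (closed_square l).
  by apply: compact_setX; exact: segment_compact.
have /compact_bounded[M [Mr hM]] := continuous_compact cf cA.
exists (M + 1) => x t; apply: (hM (M + 1)); first by rewrite ltrDl.
by exists (clamp x, clamp t) => //; split; rewrite /= in_itv/= clamp_itv.
Qed.

Lemma oint_eq (f g : R -> R) x : I x -> (forall t, I t -> f t = g t) ->
  oint (- x) x f = oint (- x) x g.
Proof.
rewrite /= in_itv/= => /andP[lx xl] fg; rewrite /oint.
case: ifPn => _; [|congr (- _)]; apply: eq_Rintegral => t; rewrite mem_setE in_itv/=;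
  move=> /andP[h1 h2]; apply: fg; rewrite in_itv/=; apply/andP; split; lra.
Qed.

Lemma L1I_sub (f : R -> R) (x y : R) : - l < x -> y < l -> L1I l f ->
  mu.-integrable `[x, y] (EFin \o f).
Proof.
move=> lx yl; apply: (@integrableS _ _ _ mu I) => //.
by move=> t; rewrite /= !in_itv/= => /andP[h1 h2]; apply/andP; split; lra.
Qed.

Lemma ointD (f g : R -> R) x : I x -> L1I l f -> L1I l g ->
  oint (- x) x (fun t => f t + g t) = oint (- x) x f + oint (- x) x g.
Proof.
rewrite /= in_itv/= => /andP[lx xl] If Ig; rewrite /oint.
by case: ifPn => _; [|rewrite -opprD; congr (- _)];
  apply: RintegralD => //; apply: L1I_sub => //; lra.
Qed.

Lemma ointB (f g : R -> R) x : I x -> L1I l f -> L1I l g ->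
  oint (- x) x (fun t => f t - g t) = oint (- x) x f - oint (- x) x g.
Proof.
rewrite /= in_itv/= => /andP[lx xl] If Ig; rewrite /oint.
by case: ifPn => _; [|rewrite opprK addrC -opprB; congr (- _)];
  apply: RintegralB => //; apply: L1I_sub => //; lra.
Qed.

Lemma Cint_orientedE (a b : R) (f : R -> R[i]) :
  Cint_oriented a b f = oint a b (fun t => Re (f t)) +i* oint a b (fun t => Im (f t)).
Proof. by rewrite /Cint_oriented /oint; case: ifPn. Qed.

Variable K : R -> R -> R[i].
Hypothesis cK : Ccontinuous_on (closed_square l) (fun z => K z.1 z.2).

Definition ReK (x t : R) : R := Re (K (clamp x) (clamp t)).
Definition ImK (x t : R) : R := Im (K (clamp x) (clamp t)).

Lemma ReK_bounded : exists C : R, forall x t, `|ReK x t| <= C.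
Proof. by have [+ _] := cK; exact: bounded_clamped. Qed.

Lemma ImK_bounded : exists C : R, forall x t, `|ImK x t| <= C.
Proof. by have [_] := cK; exact: bounded_clamped. Qed.

Lemma ReK_continuous : continuous (fun z : R * R => ReK z.1 z.2).
Proof. by have [+ _] := cK; exact: continuous_clamped. Qed.

Lemma ImK_continuous : continuous (fun z : R * R => ImK z.1 z.2).
Proof. by have [_] := cK; exact: continuous_clamped. Qed.

Lemma L1I_section (k : R -> R -> R) f x : (exists C : R, forall x t, `|k x t| <= C) ->
  continuous (fun z : R * R => k z.1 z.2) -> L1I l f -> L1I l (fun t => k x t * f t).
Proof.
move=> [C kC] ck If.
rewrite (_ : (fun t => _) = fun t => f t * k x t).
  by apply: (@L1IM _ _ _ _ C) => //; exact: measurable_section.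
by apply/funext => t; rewrite mulrC.
Qed.

Lemma Cint_oriented_kernel (f : R -> R[i]) x : I x ->
  L1I l (fun t => Re (f t)) -> L1I l (fun t => Im (f t)) ->
  Cint_oriented (- x) x (fun t => K x t * f t) =
    (kop l (J_kernel ReK) (fun t => Re (f t)) x -
     kop l (J_kernel ImK) (fun t => Im (f t)) x) +i*
    (kop l (J_kernel ReK) (fun t => Im (f t)) x +
     kop l (J_kernel ImK) (fun t => Re (f t)) x).
Proof.
move=> Ix Ir Ii; rewrite Cint_orientedE.
have KE t : I t -> K x t = ReK x t +i* ImK x t.
  move: (Ix); rewrite /= !in_itv/= => /andP[lx xl] /andP[lt tl].
  by rewrite /ReK /ImK !clamp_id ?ltW ?lx ?lt//; case: (K x t).
have kR := ReK_bounded; have kI := ImK_bounded.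
have cR := ReK_continuous; have cI := ImK_continuous.
rewrite !J_kernelE// -ointB; [|exact: Ix|exact: L1I_section|exact: L1I_section].
rewrite -ointD; [|exact: Ix|exact: L1I_section|exact: L1I_section].
congr (_ +i* _); apply: oint_eq => // t /KE ->; case: (f t) => p q //=.
Qed.

End clamped_kernel.

(** * The weights a^2 and a^-2 *)

Section coefficient.
Context {R : realType} (l : R) (l0 : 0 < l).
Local Notation mu := (@lebesgue_measure R).
Local Notation I := (`]- l, l[%classic : set R).
Variables (a : R -> R) (ha : admissible l a).

Definition weight (x : R) : R := a x ^+ 2.
Definition inv_weight (x : R) : R := (a x ^+ 2)^-1.

Lemma oitv_inner (f : R -> R) : {within `[- l, l], continuous f} ->
  forall x, I x -> {for x, continuous f}.
Proof.
have ll : - l < l by move: l0; lra.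
by move=> /(continuous_within_itvP _ ll)[cf _ _] x Ix; apply: cf.
Qed.

Lemma admissible_gt0 x : I x -> 0 < a x.
Proof. by case: ha => _ + _ _ _; exact. Qed.

Lemma weight_continuous x : I x -> {for x, continuous weight}.
Proof.
move=> Ix; have [[_ ca] _ _ _ _] := ha.
apply: (@continuous_comp _ _ _ a (fun y => y ^+ 2)); last exact: exprn_continuous.
exact: oitv_inner Ix.
Qed.

Lemma inv_weight_continuous x : I x -> {for x, continuous inv_weight}.
Proof.
move=> Ix; apply: cvgV; last exact: weight_continuous.
by rewrite expf_neq0// gt_eqF// admissible_gt0.
Qed.

Lemma weightK x : I x -> weight x * inv_weight x = 1.
Proof. by move=> Ix; rewrite divff// expf_neq0// gt_eqF// admissible_gt0. Qed.

Lemma measurable_I (f : R -> R) : (forall x, I x -> {for x, continuous f}) ->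
  measurable_fun I f.
Proof.
move=> cf; apply: open_continuous_measurable_fun; first exact: interval_open.
by move=> x /set_mem; exact: cf.
Qed.

Lemma weight_bounded : exists C : R, forall x, I x -> `|weight x| <= C.
Proof.
have [[_ ca] _ _ _ _] := ha.
have cA : compact `[- l, l]%classic by exact: segment_compact.
have /compact_bounded[M [Mr hM]] := continuous_compact ca cA.
exists ((M + 1) ^+ 2) => x Ix.
have : `|a x| <= M + 1.
  apply: (hM (M + 1)); first by rewrite ltrDl.
  by exists x => //; move: Ix; rewrite /= !in_itv/= => /andP[/ltW -> /ltW ->].
by move=> h; rewrite /weight normrX lerXn2r// nnegrE// (le_trans _ h).
Qed.

Lemma L1I_weight : L1I l weight.
Proof.
have [C hC] := weight_bounded.
by apply: (@L1I_bounded _ _ _ C) => //; apply: measurable_I; exact: weight_continuous.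
Qed.

(** This is 1/a in L^2, read through the exponent 2. *)
Lemma L1I_inv_weight : L1I l inv_weight.
Proof.
have [_ _ _ h _] := ha.
have h2 : (1 : R) <= 2 by rewrite ler1n.
have := LpC_integrable h2 h; apply: L1I_le.
  by apply: measurable_I; exact: inv_weight_continuous.
move=> x Ix; have ax := admissible_gt0 Ix.
rewrite /Cmod/= expr0n/= addr0 sqrtr_sqr powR_mulrn ?normr_ge0//.
by rewrite real_normK ?num_real// /inv_weight -exprVn ger0_norm// sqr_ge0.
Qed.

End coefficient.

(** * Second-order equations in integrated form *)

Section solution_equation.
Context {R : realType} (l : R) (l0 : 0 < l).
Local Notation mu := (@lebesgue_measure R).
Local Notation I := (`]- l, l[%classic : set R).
Implicit Types (f g : R -> R) (x y c : R).

Lemma prim_continuous f x : L1I l f -> I x -> {for x, continuous (prim l f)}.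
Proof. by move=> If Ix; apply: kop_continuous => //; exact: good_prim_kernel. Qed.

Lemma prim_lin c d f g x : L1I l f -> L1I l g ->
  prim l (fun t => c * f t + d * g t) x = c * prim l f x + d * prim l g x.
Proof.
by move=> If Ig; apply: (bounded_operator_lin _ _ _ (kop_bounded_operator (good_prim_kernel l))).
Qed.

(** The continuous representative satisfies the primitive formula at every point, so the constant is
    its value at 0. *)
Lemma wder_prim_continuous f f' g : wder l f g -> L1I l f -> L1I l g ->
  aeI l f f' -> (forall x, I x -> {for x, continuous f'}) ->
  forall x, I x -> f' x = f' 0 + prim l g x.
Proof.
move=> fg If Ig ff' cf'.
have I0 : I 0 by rewrite /= in_itv/=; apply/andP; split; move: l0; lra.
have [c fc] := wder_prim l0 fg If Ig.
have eqc x : I x -> f' x = c + prim l g x.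
  apply: (@aeI_continuous _ l f' (fun x => c + prim l g x)) => //.
    move=> y Iy; apply: cvgD; first exact: cvg_cst.
    exact: prim_continuous.
  exact: aeI_trans (aeI_sym ff') fc.
by move=> x Ix; rewrite (eqc x Ix) (eqc 0 I0) prim0 addr0.
Qed.

Lemma abs_continuous_within (v : R -> R[i]) : abs_continuous l v ->
  (forall x, I x -> {for x, continuous (fun y => Re (v y))}) /\
  (forall x, I x -> {for x, continuous (fun y => Im (v y))}).
Proof.
move=> acv.
suff key (x : R) : I x -> forall eps : R, 0 < eps ->
    \forall y \near x, Cmod (v y - v x) < eps.
  split=> x Ix; apply/cvgrPdist_lt => e e0; have := key x Ix e e0;
    apply: filterS => y; apply: le_lt_trans.
    by rewrite distrC (le_trans _ (Re_le_Cmod _))//; case: (v y); case: (v x).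
  by rewrite distrC (le_trans _ (Im_le_Cmod _))//; case: (v y); case: (v x).
move=> Ix e e0; have [d d0 hd] := acv e e0.
(* Absolute continuity is used with a single subinterval. *)
have acd s t : - l <= s -> s <= t -> t <= l -> t - s < d -> Cmod (v t - v s) < e.
  move=> ls st tl std.
  have := hd 1%N (fun=> s) (fun=> t); rewrite !big_ord1; apply => //.
  by move=> i j _ _ _; rewrite !ord1.
have CmodN (z w : R[i]) : Cmod (z - w) = Cmod (w - z).
  case: z => p q; case: w => p' q'; rewrite /Cmod/=.
  by congr Num.sqrt; ring.
near=> y.
have Iy : I y by near: y; exact: near_in_itvoo.
have yd : `|x - y| < d.
  by near: y; apply: (@cvgr_dist_lt _ _ _ (nbhs x) _ id x) => //; exact: cvg_id.
move: (Ix) (Iy) (yd); rewrite /= !in_itv/= ltr_norml => /andP[lx xl] /andP[ly yl] /andP[h1 h2].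
have [xy|/ltW yx] := leP x y; first by apply: acd; lra.
by rewrite CmodN; apply: acd; lra.
Unshelve. all: by end_near. Qed.

Variables (b m : R -> R).
Hypotheses (Ib : L1I l b) (mm : measurable_fun I m).
Hypothesis mC : exists C : R, forall x, I x -> `|m x| <= C.
Hypothesis mb : forall x, I x -> m x * b x = 1.

(** Here [g] is the weak derivative of [e], [v] the continuous representative of m g, and [d] its
    weak derivative. Integrating d = s2 m e gives v = v(0) + s2 P(m e), and integrating g = b v
    gives the claim. *)
Lemma solution_component (e g d v : R -> R) (s2 : R) :
  wder l e g -> L1I l e -> L1I l g ->
  (forall x, I x -> {for x, continuous e}) ->
  wder l (fun x => m x * g x) d ->
  aeI l (fun x => m x * g x) v -> (forall x, I x -> {for x, continuous v}) ->
  aeI l (fun x => b x * d x) (fun x => s2 * e x) ->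
  forall x, I x ->
    e x = e 0 + v 0 * prim l b x + s2 * double_prim l b m e x.
Proof.
move=> eg Ie Ig ce qd qv cv bd x Ix.
have [C hC] := mC.
have [[lq _ _] [md _ _] _] := qd.
have Ime : L1I l (fun x => m x * e x).
  rewrite (_ : (fun x => _) = fun x => e x * m x); last first.
    by apply/funext => t; rewrite mulrC.
  exact: L1IM hC.
have Img : L1I l (fun x => m x * g x).
  rewrite (_ : (fun x => _) = fun x => g x * m x); last first.
    by apply/funext => t; rewrite mulrC.
  exact: L1IM hC.
(* The equation itself supplies the integrability of [d], which as a weak derivative is only locally
   integrable. *)
have dme : aeI l d (fun x => s2 * (m x * e x)).
  move: bd; apply: filterS; first exact: (ae_filter_ringOfSetsType mu).
  move=> y + Iy => /(_ Iy) h.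
  by rewrite mulrCA -h mulrA mb// mul1r.
have Id : L1I l d.
  by apply: L1I_ae (aeI_sym dme) => //; exact: L1IZ.
have primd : prim l d = prim l (fun x => s2 * (m x * e x)).
  apply: kop_ae => //; first exact: good_prim_kernel.
  by apply: (@L1I_measurable _ l); exact: L1IZ.
have vE := wder_prim_continuous qd Img Id qv cv.
have primZ f y : L1I l f -> prim l (fun t => s2 * f t) y = s2 * prim l f y.
  by move=> If; have [_ + _ _] := kop_bounded_operator (good_prim_kernel l); exact.
have gE : aeI l g (fun x => v 0 * b x + s2 * (b x * prim l (fun y => m y * e y) x)).
  move: qv; apply: filterS; first exact: (ae_filter_ringOfSetsType mu).
  move=> y + Iy => /(_ Iy) h.
  have -> : g y = b y * v y by rewrite -h mulrA (mulrC (b y)) mb// mul1r.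
  rewrite (vE y Iy) primd primZ//; ring.
have IbP : L1I l (fun x => b x * prim l (fun y => m y * e y) x).
  exact: bounded_operator_L1IM (kop_bounded_operator (good_prim_kernel l)) _ _.
have eE := wder_prim_continuous eg Ie Ig (aeI_eq (fun _ _ => erefl)) ce Ix.
rewrite eE (_ : prim l g =
  prim l (fun x => v 0 * b x + s2 * (b x * prim l (fun y => m y * e y) x))).
  by rewrite prim_lin// addrA.
apply: kop_ae => //; first exact: good_prim_kernel.
- exact: (@L1I_measurable _ l).
- by apply: (@L1I_measurable _ l); apply: L1ID; exact: L1IZ.
Qed.

End solution_equation.

Section eigenfunction.
Context {R : realType} (l : R) (l0 : 0 < l).
Local Notation mu := (@lebesgue_measure R).
Local Notation I := (`]- l, l[%classic : set R).
Variables (a : R -> R) (ha : admissible l a).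
Variables (e : R[i] -> R -> R[i]) (he : forall rho : R[i], is_ea l a rho (e rho)).
Variables (K : R -> R -> R[i]) (hK : transmutation_kernel l a e K).
Local Notation b := (inv_weight a).
Local Notation m := (weight a).
Local Notation JR := (kop l (J_kernel (ReK l K))).
Local Notation JI := (kop l (J_kernel (ImK l K))).

Lemma kernel_continuous : Ccontinuous_on (closed_square l) (fun z => K z.1 z.2).
Proof. by case: hK. Qed.

Lemma kop0 kap : kop l kap (fun=> 0) = (fun=> 0).
Proof.
apply/funext => x; rewrite /kop.
rewrite (_ : \int[mu]_(t in I) _ = \int[mu]_(t in I) 0).
  by rewrite Rintegral_cst// mul0r.
by apply: eq_Rintegral => t _; rewrite mulr0.
Qed.

(** The spectral parameter -is, for which i rho = s and -rho^2 = s^2 are real. *)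
Let rho (s : R) : R[i] := 0 +i* (- s).

Let irho (s : R) : 'i%C * rho s = s%:C :> R[i].
Proof. by apply/eqP; rewrite eq_complex /=; apply/andP; split; apply/eqP; ring. Qed.

Let rho2 (s : R) : rho s ^+ 2 = (- s ^+ 2)%:C.
Proof. by apply/eqP; rewrite eq_complex /=; apply/andP; split; apply/eqP; ring. Qed.

Let Cexp_real (s t : R) : Cexp ('i%C * rho s * t%:C) = (expo s t)%:C.
Proof.
rewrite irho -rmorphM /Cexp /= cos0 sin0.
by apply/eqP; rewrite eq_complex /=; apply/andP; split; apply/eqP; rewrite /expo; ring.
Qed.

(** The factors 1 and 0 are the values of [eps]: both components have the form eps e^{sx} - s J
    e^{sx} required by [Texpo]. *)
Let e_repr (s x : R) : I x ->
  e (rho s) x = (1 * expo s x - s * JR (expo s) x) +i*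
                (0 * expo s x - s * JI (expo s) x).
Proof.
move=> Ix; have [_ _ hrep _ _] := hK.
have Ibx : `[- l, l]%classic x.
  by move: Ix; rewrite /= !in_itv/= => /andP[/ltW -> /ltW ->].
rewrite hrep//.
under [X in Cint_oriented _ _ X]eq_fun do rewrite Cexp_real.
rewrite Cexp_real irho.
rewrite (Cint_oriented_kernel l0 kernel_continuous)//=; last 2 first.
- exact: L1I_expo.
- exact: (L1I_cst l 0).
rewrite !kop0; apply/eqP; rewrite eq_complex /=.
by apply/andP; split; apply/eqP; ring.
Qed.

Let wb x (Ix : I x) := weightK ha Ix.

(** The equation has real coefficients, so the components solve it separately. From e(0) = 1 and
    quasi-derivative i rho = s at 0, the initial data are (1, s) and (0, 0). *)
Lemma solution_parts (s : R) :
  (forall x, I x -> Re (e (rho s) x) = 1 + s * prim l b x +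
     s ^+ 2 * double_prim l b m (fun y => Re (e (rho s) y)) x) /\
  (forall x, I x -> Im (e (rho s) x) = 0 + 0 * prim l b x +
     s ^+ 2 * double_prim l b m (fun y => Im (e (rho s) y)) x).
Proof.
have [[Sd Sl] [ceR ceI] e0 [v [acv qv wdq] v0] ode] := he (rho s).
have [wR wI] := weakD_wder (Sd 0%N isT).
have one1 : (1 : R) <= 1 by [].
have [eR eI] := LpC_L1I one1 (Sl 0%N isT).
have [gR gI] := LpC_L1I one1 (Sl 1%N isT).
have [qR qI] := weakD_wder wdq.
have [cvR cvI] := abs_continuous_within acv.
have QR : (fun x => Re (quasiD l a (e (rho s)) x)) =
    fun x => m x * Re (weakD l (e (rho s)) x).
  by apply/funext => x; rewrite /quasiD mulrC Re_mulr mulrC.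
have QI : (fun x => Im (quasiD l a (e (rho s)) x)) =
    fun x => m x * Im (weakD l (e (rho s)) x).
  by apply/funext => x; rewrite /quasiD mulrC Im_mulr mulrC.
rewrite QR in qR; rewrite QI in qI.
have mm : measurable_fun I m by apply: measurable_I; exact: weight_continuous.
have Ib := L1I_inv_weight l0 ha.
have mC := weight_bounded ha.
have qvR : aeI l (fun x => m x * Re (weakD l (e (rho s)) x)) (fun y => Re (v y)).
  rewrite -QR; move: qv; apply: filterS; first exact: (ae_filter_ringOfSetsType mu).
  by move=> y + Iy => /(_ Iy) ->.
have qvI : aeI l (fun x => m x * Im (weakD l (e (rho s)) x)) (fun y => Im (v y)).
  rewrite -QI; move: qv; apply: filterS; first exact: (ae_filter_ringOfSetsType mu).
  by move=> y + Iy => /(_ Iy) ->.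
have bdR : aeI l (fun x => b x * Re (weakD l (quasiD l a (e (rho s))) x))
    (fun x => s ^+ 2 * Re (e (rho s) x)).
  move: ode; apply: filterS; first exact: (ae_filter_ringOfSetsType mu).
  move=> y + Iy => /(_ Iy); rewrite rho2 /opL => /(congr1 (@complex.Re R)).
  rewrite mulrC [in X in _ = X -> _]mulrC Re_mulr.
  case: (weakD l (quasiD l a (e (rho s))) y) => p q /=; rewrite /inv_weight.
  by move: (Re (e (rho s) y)) (_^-1) => r c h; lra.
have bdI : aeI l (fun x => b x * Im (weakD l (quasiD l a (e (rho s))) x))
    (fun x => s ^+ 2 * Im (e (rho s) x)).
  move: ode; apply: filterS; first exact: (ae_filter_ringOfSetsType mu).
  move=> y + Iy => /(_ Iy); rewrite rho2 /opL => /(congr1 (@complex.Im R)).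
  rewrite mulrC [in X in _ = X -> _]mulrC Im_mulr.
  case: (weakD l (quasiD l a (e (rho s))) y) => p q /=; rewrite /inv_weight.
  by move: (Im (e (rho s) y)) (_^-1) => r c h; lra.
split=> x Ix.
- have := solution_component l0 Ib mm mC wb wR eR gR (oitv_inner l0 ceR) qR qvR cvR bdR Ix.
  by rewrite /= e0 v0 irho.
- have := solution_component l0 Ib mm mC wb wI eI gI (oitv_inner l0 ceI) qI qvI cvI bdI Ix.
  by rewrite /= e0 v0 irho.
Qed.

Lemma expo_equation_Re s x : I x ->
  let E := fun y => 1 * expo s y - s * JR (expo s) y in
  E x = 1 * (1 + s * prim l b x) + s ^+ 2 * double_prim l b m E x.
Proof.
move=> Ix E; have [+ _] := solution_parts s => /(_ x Ix).
rewrite (e_repr s Ix) /= -/(E x) => ->; rewrite mul1r.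
congr (_ + _ * _ x); apply: double_prim_eq => y Iy.
by rewrite (e_repr s Iy).
Qed.

Lemma expo_equation_Im s x : I x ->
  let E := fun y => 0 * expo s y - s * JI (expo s) y in
  E x = 0 * (1 + s * prim l b x) + s ^+ 2 * double_prim l b m E x.
Proof.
move=> Ix E; have [_] := solution_parts s => /(_ x Ix).
rewrite (e_repr s Ix) /= -/(E x) => ->; rewrite !mul0r addr0.
congr (_ + _ * _ x); apply: double_prim_eq => y Iy.
by rewrite (e_repr s Iy).
Qed.

End eigenfunction.

(** * Transmutation of a Sobolev function *)

Section sobolev_representation.
Context {R : realType} (l : R) (l0 : 0 < l).
Local Notation mu := (@lebesgue_measure R).
Local Notation I := (`]- l, l[%classic : set R).
Implicit Types (f g F : R -> R) (x y c : R).
Local Notation P := (prim l).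

Lemma L1I_prim f : L1I l f -> L1I l (P f).
Proof.
move=> If; exact: bounded_operator_L1I (kop_bounded_operator (good_prim_kernel l)) If.
Qed.

Lemma L1I_cst_prim c f : L1I l f -> L1I l (fun y => c + P f y).
Proof. by move=> If; apply: L1ID; [exact: (L1I_cst l c)|exact: L1I_prim]. Qed.

Lemma prim_ae f g : L1I l f -> L1I l g -> aeI l f g -> P f = P g.
Proof.
move=> If Ig fg; apply: kop_ae => //; first exact: good_prim_kernel.
- exact: (@L1I_measurable _ l).
- exact: (@L1I_measurable _ l).
Qed.

(** Primitives are taken from the top derivative down, each almost everywhere identity being
    integrated into the next. Since primitives vanish at 0, the constants are the values at 0 of the
    continuous representatives. *)
Lemma sobolev3_representation f0 f1 f2 f3 :
  wder l f0 f1 -> wder l f1 f2 -> wder l f2 f3 ->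
  L1I l f0 -> L1I l f1 -> L1I l f2 -> L1I l f3 ->
  exists c0 c1 c2, let U2 := fun y => c2 + P f3 y in
    let U1 := fun y => c1 + P U2 y in
    [/\ aeI l f2 U2, aeI l f1 U1 & aeI l f0 (fun y => c0 + P U1 y)].
Proof.
move=> w01 w12 w23 I0 I1 I2 I3.
have [c2 h2] := wder_prim l0 w23 I2 I3.
have [c1 h1] := wder_prim l0 w12 I1 I2.
have [c0 h0] := wder_prim l0 w01 I0 I1.
have IU2 : L1I l (fun y => c2 + P f3 y) by exact: L1I_cst_prim.
have IU1 : L1I l (fun y => c1 + P (fun z => c2 + P f3 z) y) by exact: L1I_cst_prim.
have e1 : aeI l f1 (fun y => c1 + P (fun z => c2 + P f3 z) y).
  by rewrite -(prim_ae I2 IU2 h2).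
exists c0, c1, c2; split; [exact: h2|exact: e1|].
by rewrite -(prim_ae I1 IU1 e1); exact: h0.
Qed.

Variables (b m : R -> R).
Hypothesis Ib : L1I l b.
Hypothesis cb : forall x, I x -> {for x, continuous b}.
Hypothesis cm : forall x, I x -> {for x, continuous m}.
Hypothesis mC : exists C : R, forall x, I x -> `|m x| <= C.

(** Continuity of [b], [m] and [F] makes the derivatives of [Y] and [V] classical, hence weak. For b
    = a^-2, [V] is the quasi-derivative of [Y]; boundedness of [m] and [F] makes it Lipschitz. *)
Lemma double_prim_regular F c0 c1 : (forall x, I x -> {for x, continuous F}) ->
  (exists C : R, forall x, I x -> `|F x| <= C) ->
  let V := fun x => c1 + P (fun t => m t * F t) x in
  let Y := fun x => c0 + P (fun t => b t * V t) x in
  [/\ wder l Y (fun x => b x * V x), wder l V (fun x => m x * F x),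
      L1I l Y /\ L1I l (fun x => b x * V x),
      forall x, I x -> Y x = c0 + c1 * P b x + double_prim l b m F x &
      exists2 C : R, 0 <= C & forall x y, x <= y -> `|V y - V x| <= C * (y - x)].
Proof.
move=> cF [C hC] V Y; have [M hM] := mC.
have mF : measurable_fun I F by exact: measurable_I.
have cmF x : I x -> {for x, continuous (fun t => m t * F t)}.
  by move=> Ix; apply: cvgM; [exact: cm|exact: cF].
have bmF x : I x -> `|m x * F x| <= `|M| * `|C|.
  move=> Ix; rewrite normrM; apply: ler_pM; rewrite ?normr_ge0//.
    exact: le_trans (hM _ Ix) (ler_norm _).
  exact: le_trans (hC _ Ix) (ler_norm _).
have ImF : L1I l (fun t => m t * F t).
  by apply: (@L1I_bounded _ _ _ (`|M| * `|C|)) => //; exact: measurable_I.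
have IbP : L1I l (fun t => b t * P (fun r => m r * F r) t).
  exact: bounded_operator_L1IM (kop_bounded_operator (good_prim_kernel l)) _ _.
have cV x : I x -> {for x, continuous V}.
  by move=> Ix; apply: cvgD; [exact: cvg_cst|exact: prim_continuous].
have EbV : (fun t => b t * V t) =
    (fun t => c1 * b t + 1 * (b t * P (fun r => m r * F r) t)).
  by apply/funext => t; rewrite /V; ring.
have IbV : L1I l (fun t => b t * V t) by rewrite EbV; apply: L1ID; exact: L1IZ.
have cbV x : I x -> {for x, continuous (fun t => b t * V t)}.
  by move=> Ix; apply: cvgM; [exact: cb|exact: cV].
have dprim c f x : L1I l f -> I x -> {for x, continuous f} ->
    is_derive x 1 (fun y => c + P f y) (f x).
  move=> If Ix cf.
  have := is_deriveD (is_derive_cst c x (1 : R)) (prim_derive If Ix cf).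
  by rewrite add0r.
split.
- apply: wder_of_derivative => //; first exact: L1I_cst_prim.
  by move=> x Ix; apply: dprim => //; exact: cbV.
- apply: wder_of_derivative => //; first exact: L1I_cst_prim.
  by move=> x Ix; apply: dprim => //; exact: cmF.
- by split => //; exact: L1I_cst_prim.
- by move=> x Ix; rewrite /Y EbV prim_lin// mul1r addrA.
- exists (`|M| * `|C|); first by rewrite mulr_ge0.
  move=> x y xy; rewrite /V opprD addrACA subrr add0r.
  by apply: prim_lipschitz => //; rewrite mulr_ge0.
Qed.

End sobolev_representation.

(** * Reassembly of complex functions and the domain of L_a *)

Section complex_assembly.
Context {R : realType} (l : R) (l0 : 0 < l).
Local Notation mu := (@lebesgue_measure R).
Local Notation I := (`]- l, l[%classic : set R).
Local Notation P := (prim l).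
Variables (a : R -> R) (ha : admissible l a).
Local Notation b := (inv_weight a).
Local Notation m := (weight a).

Lemma complex_eqP (z w : R[i]) : Re z = Re w -> Im z = Im w -> z = w.
Proof. by case: z => p q; case: w => p' q' /= -> ->. Qed.

Lemma ae_eq_IP (f g : R -> R[i]) : aeI l (fun x => Re (f x)) (fun x => Re (g x)) ->
  aeI l (fun x => Im (f x)) (fun x => Im (g x)) -> ae_eq_I l f g.
Proof.
apply: filterS2; first exact: (ae_filter_ringOfSetsType mu).
by move=> x h1 h2 Ix; apply: complex_eqP; [exact: h1|exact: h2].
Qed.

(** [weakD] is a choice among representatives; uniqueness of weak derivatives identifies it almost
    everywhere with any computed one. *)
Lemma weakD_ae (f : R -> R[i]) (f1 f2 g1 g2 : R -> R) :
  measurable_fun I (fun x => Re (f x)) -> measurable_fun I (fun x => Im (f x)) ->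
  aeI l (fun x => Re (f x)) f1 -> aeI l (fun x => Im (f x)) f2 ->
  wder l f1 g1 -> wder l f2 g2 ->
  [/\ weakly_differentiable l f,
      aeI l (fun x => Re (weakD l f x)) g1 & aeI l (fun x => Im (weakD l f x)) g2].
Proof.
move=> mR mI fR fI w1 w2.
have [[mg1 _ _] [mg2 _ _]] : locally_integrable I g1 /\ locally_integrable I g2.
  by case: w1 => _ ? _; case: w2.
have w1' := wder_ae w1 mR mg1 (aeI_sym fR) (aeI_eq (fun _ _ => erefl)).
have w2' := wder_ae w2 mI mg2 (aeI_sym fI) (aeI_eq (fun _ _ => erefl)).
have wd : weakly_differentiable l f.
  by exists (fun x => g1 x +i* g2 x); apply/weak_derivativeP.
have [wR wI] := weakD_wder wd.
by split; [exact: wd|exact: wder_unique wR w1'|exact: wder_unique wI w2'].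
Qed.

Lemma abs_continuous_lipschitz (v : R -> R[i]) (C1 C2 : R) : 0 <= C1 -> 0 <= C2 ->
  (forall x y, x <= y -> `|Re (v y) - Re (v x)| <= C1 * (y - x)) ->
  (forall x y, x <= y -> `|Im (v y) - Im (v x)| <= C2 * (y - x)) ->
  abs_continuous l v.
Proof.
move=> C10 C20 h1 h2 e e0; have D0 : 0 < C1 + C2 + 1 by lra.
(* The 1 keeps the denominator positive when both Lipschitz constants are 0. *)
exists (e / (C1 + C2 + 1)); first by rewrite divr_gt0.
move=> n s t st _ sm.
apply: (@le_lt_trans _ _ ((C1 + C2 + 1) * \sum_(i < n) (t i - s i))).
  rewrite mulr_sumr; apply: ler_sum => i _; have [_ [sti _]] := st i.
  rewrite (le_trans (Cmod_le _))//.
  have := h1 _ _ sti; have := h2 _ _ sti.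
  have -> : (C1 + C2 + 1) * (t i - s i) =
    C1 * (t i - s i) + C2 * (t i - s i) + (t i - s i) by ring.
  have : 0 <= t i - s i by rewrite subr_ge0.
  case: (v (t i)) => p q; case: (v (s i)) => p' q' /=.
  move: (t i - s i) (C1 * _) (C2 * _) => d A B ? ? ?; lra.
by rewrite mulrC -ltr_pdivlMr.
Qed.

(* The hypotheses on [T] are the integrated form of [L_a T = F1 + i F2]. *)
Lemma domL_of_double_prim (p : R) (hp : 1 <= p) (T : R -> R[i]) (F1 F2 : R -> R)
    (c0 c1 d0 d1 : R) :
  measurable_fun I (fun x => Re (T x)) -> measurable_fun I (fun x => Im (T x)) ->
  (forall x, I x -> {for x, continuous F1}) ->
  (forall x, I x -> {for x, continuous F2}) ->
  (exists C : R, forall x, I x -> `|F1 x| <= C) ->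
  (exists C : R, forall x, I x -> `|F2 x| <= C) ->
  aeI l (fun x => Re (T x)) (fun x => c0 + c1 * P b x + double_prim l b m F1 x) ->
  aeI l (fun x => Im (T x)) (fun x => d0 + d1 * P b x + double_prim l b m F2 x) ->
  domL l a p T /\ ae_eq_I l (opL l a T) (fun x => F1 x +i* F2 x).
Proof.
move=> mR mI cF1 cF2 bF1 bF2 TR TI.
have Ib := L1I_inv_weight l0 ha.
have cb := inv_weight_continuous l0 ha; have cm := weight_continuous l0 ha.
have mC := weight_bounded ha.
have mm : measurable_fun I m by exact: measurable_I.
have mb : measurable_fun I b by exact: measurable_I.
have [wY1 wV1 [IY1 IbV1] EY1 [C1 C10 L1]] :=
  double_prim_regular l0 Ib cb cm mC c0 c1 cF1 bF1.
have [wY2 wV2 [IY2 IbV2] EY2 [C2 C20 L2]] :=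
  double_prim_regular l0 Ib cb cm mC d0 d1 cF2 bF2.
set V1 := (fun x => c1 + _) in wY1 wV1 IY1 IbV1 EY1 L1.
set V2 := (fun x => d1 + _) in wY2 wV2 IY2 IbV2 EY2 L2.
set Y1 := (fun x => c0 + P _ x) in wY1 IY1 EY1.
set Y2 := (fun x => d0 + P _ x) in wY2 IY2 EY2.
have TR1 : aeI l (fun x => Re (T x)) Y1.
  by apply: aeI_trans TR _; apply: aeI_eq => x Ix; exact: esym (EY1 x Ix).
have TI2 : aeI l (fun x => Im (T x)) Y2.
  by apply: aeI_trans TI _; apply: aeI_eq => x Ix; exact: esym (EY2 x Ix).
have [wdT DR DI] := weakD_ae mR mI TR1 TI2 wY1 wY2.
have [[_ [mDR _ _] _] [_ [mDI _ _] _]] := weakD_wder wdT.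
have QRe x : Re (quasiD l a T x) = m x * Re (weakD l T x).
  by rewrite /quasiD mulrC Re_mulr mulrC.
have QIm x : Im (quasiD l a T x) = m x * Im (weakD l T x).
  by rewrite /quasiD mulrC Im_mulr mulrC.
have mQR : measurable_fun I (fun x => Re (quasiD l a T x)).
  have -> : (fun x => Re (quasiD l a T x)) = fun x => m x * Re (weakD l T x) by apply/funext.
  exact: measurable_funM.
have mQI : measurable_fun I (fun x => Im (quasiD l a T x)).
  have -> : (fun x => Im (quasiD l a T x)) = fun x => m x * Im (weakD l T x) by apply/funext.
  exact: measurable_funM.
have QV1 : aeI l (fun x => Re (quasiD l a T x)) V1.
  move: DR; apply: filterS; first exact: (ae_filter_ringOfSetsType mu).
  by move=> x + Ix => /(_ Ix) h; rewrite QRe h mulrA (weightK ha Ix) mul1r.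
have QV2 : aeI l (fun x => Im (quasiD l a T x)) V2.
  move: DI; apply: filterS; first exact: (ae_filter_ringOfSetsType mu).
  by move=> x + Ix => /(_ Ix) h; rewrite QIm h mulrA (weightK ha Ix) mul1r.
have [wdQ LR LI] := weakD_ae mQR mQI QV1 QV2 wV1 wV2.
have [[_ [mLR _ _] _] [_ [mLI _ _] _]] := weakD_wder wdQ.
have LRe x : Re (opL l a T x) = b x * Re (weakD l (quasiD l a T) x).
  by rewrite /opL mulrC Re_mulr mulrC.
have LIm x : Im (opL l a T x) = b x * Im (weakD l (quasiD l a T) x).
  by rewrite /opL mulrC Im_mulr mulrC.
have oR : aeI l (fun x => Re (opL l a T x)) F1.
  move: LR; apply: filterS; first exact: (ae_filter_ringOfSetsType mu).
  by move=> x + Ix => /(_ Ix) h; rewrite LRe h mulrA (mulrC (b x)) (weightK ha Ix) mul1r.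
have oI : aeI l (fun x => Im (opL l a T x)) F2.
  move: LI; apply: filterS; first exact: (ae_filter_ringOfSetsType mu).
  by move=> x + Ix => /(_ Ix) h; rewrite LIm h mulrA (mulrC (b x)) (weightK ha Ix) mul1r.
have mo : Cmeasurable_fun I (opL l a T).
  split.
    have -> : (fun x => Re (opL l a T x)) = fun x => b x * Re (weakD l (quasiD l a T) x).
      by apply/funext.
    exact: measurable_funM.
  have -> : (fun x => Im (opL l a T x)) = fun x => b x * Im (weakD l (quasiD l a T) x).
    by apply/funext.
  exact: measurable_funM.
split; last exact: ae_eq_IP.
split.
- split=> -[|[|//]]//= _.
  + by apply: LpC1; [exact: L1I_ae IY1 mR (aeI_sym TR1)|exact: L1I_ae IY2 mI (aeI_sym TI2)].
  + by apply: LpC1; [exact: L1I_ae IbV1 mDR (aeI_sym DR)|exact: L1I_ae IbV2 mDI (aeI_sym DI)].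
- exists (fun x => V1 x +i* V2 x); split => //.
  + exact: (abs_continuous_lipschitz C10 C20).
  + exact: ae_eq_IP.
- split => //.
  (* [opL l a T] equals almost everywhere the bounded function F1 + i F2, and the weight is bounded,
     so the weighted integral is finite for each p. *)
  have [B1 hB1] := bF1; have [B2 hB2] := bF2; have [M hM] := mC.
  have mF : Cmeasurable_fun I (fun x => F1 x +i* F2 x).
    by split; exact: measurable_I.
  have IF : L1I l (fun x => (Cmod (F1 x +i* F2 x)) `^ p * m x).
    apply: (@L1IM _ _ _ _ M) => //.
    apply: (@L1I_bounded _ _ _ ((`|B1| + `|B2|) `^ p)).
      by apply: (measurableT_comp (measurable_powR p)); exact: measurable_Cmod.
    move=> x Ix; rewrite ger0_norm ?powR_ge0//; apply: ge0_ler_powR.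
    + exact: le_trans hp.
    + by rewrite nnegrE Cmod_ge0.
    + by rewrite nnegrE addr_ge0.
    + rewrite (le_trans (Cmod_le _))//= lerD//.
        exact: le_trans (hB1 _ Ix) (ler_norm _).
      exact: le_trans (hB2 _ Ix) (ler_norm _).
  have Io : L1I l (fun x => (Cmod (opL l a T x)) `^ p * m x).
    apply: (L1I_ae IF).
      apply: measurable_funM => //.
      by apply: (measurableT_comp (measurable_powR p)); exact: measurable_Cmod.
    move: oR oI; apply: filterS2; first exact: (ae_filter_ringOfSetsType mu).
    move=> x h1 h2 Ix; congr ((Cmod _) `^ p * _); symmetry.
    by apply: complex_eqP; [exact: h1|exact: h2].
  have /integrableP[_] := Io; apply: le_lt_trans.
  rewrite le_eqVlt; apply/orP; left; apply/eqP; apply: eq_integral => x _ /=.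
  by rewrite ger0_norm// mulr_ge0 ?powR_ge0// sqr_ge0.
Qed.

End complex_assembly.

Section transmuted_function.
Context {R : realType} (l : R) (l0 : 0 < l).
Local Notation mu := (@lebesgue_measure R).
Local Notation I := (`]- l, l[%classic : set R).
Variables (a : R -> R) (ha : admissible l a).
Variables (e : R[i] -> R -> R[i]) (he : forall rho : R[i], is_ea l a rho (e rho)).
Variables (K : R -> R -> R[i]) (hK : transmutation_kernel l a e K).
Local Notation b := (inv_weight a).
Local Notation m := (weight a).
Local Notation P := (prim l).
Local Notation B := (double_prim l b m).
Local Notation JR := (kop l (J_kernel (ReK l K))).
Local Notation JI := (kop l (J_kernel (ImK l K))).

Let cK := kernel_continuous hK.
Let Ib := L1I_inv_weight l0 ha.
Let Im' := L1I_weight l0 ha.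

Lemma good_JR : good_kernel l (J_kernel (ReK l K)).
Proof.
by apply: good_J_kernel; [exact: (ReK_bounded l0 cK)|exact: (ReK_continuous l0 cK)].
Qed.

Lemma good_JI : good_kernel l (J_kernel (ImK l K)).
Proof.
by apply: good_J_kernel; [exact: (ImK_bounded l0 cK)|exact: (ImK_continuous l0 cK)].
Qed.

Lemma L1I_kop kap f : good_kernel l kap -> L1I l f -> L1I l (kop l kap f).
Proof. by move=> gk If; exact: bounded_operator_L1I (kop_bounded_operator gk) If. Qed.

Lemma L1I_weightM f : L1I l f -> L1I l (fun t => m t * f t).
Proof.
move=> If; have [C hC] := weight_bounded ha.
have -> : (fun t => m t * f t) = (fun t => f t * m t).
  by apply/funext => t; rewrite mulrC.
apply: (@L1IM _ _ _ _ C) => //.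
by apply: measurable_I; exact: weight_continuous.
Qed.

(** One component of the complex product K u': [sg] is 1 for the real part and -1 for the imaginary
    part. The identity with eps = 1 and kernel Re K is combined with -sg times the one with eps = 0
    and kernel Im K. *)
Lemma transmuted_part (sg c0 c1 c2 d1 d2 : R) (w1 w2 : R -> R) x :
  L1I l w1 -> L1I l w2 -> I x ->
  c0 + P (fun y => c1 + P (fun z => c2 + P w1 z) y) x -
    (JR (fun y => c1 + P (fun z => c2 + P w1 z) y) x -
     sg * JI (fun y => d1 + P (fun z => d2 + P w2 z) y) x) =
  c0 + c1 * P b x + B (fun y => (c2 + P w1 y) - (JR w1 y - sg * JI w2 y)) x.
Proof.
move=> I1 I2 Ix.
have h1 := transmutation_identity l0 Ib Im' (ReK_bounded l0 cK)
  (ReK_continuous l0 cK) (fun s x => @expo_equation_Re R l l0 a ha e he K hK s x)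
  c0 c1 c2 I1 Ix.
have h2 := transmutation_identity l0 Ib Im' (ImK_bounded l0 cK)
  (ImK_continuous l0 cK) (fun s x => @expo_equation_Im R l l0 a ha e he K hK s x)
  0 d1 d2 I2 Ix.
rewrite /= !mul1r in h1; rewrite /= !mul0r !add0r in h2.
pose G y := 1 * (c2 + P w1 y) - JR w1 y.
pose H y := 0 * (d2 + P w2 y) - JI w2 y.
have IG : L1I l G.
  apply: L1IB; last exact: L1I_kop good_JR I1.
  by apply: L1IZ; exact: L1I_cst_prim.
have IH : L1I l H.
  apply: L1IB; last exact: L1I_kop good_JI I2.
  by apply: L1IZ; exact: L1I_cst_prim.
have -> : (fun y => (c2 + P w1 y) - (JR w1 y - sg * JI w2 y)) =
    (fun y => 1 * G y + (- sg) * H y).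
  by apply/funext => y; rewrite /G /H mul1r mul0r sub0r mulrNN mul1r opprB addrCA addrC.
rewrite (double_prim_lin Ib); [|exact: L1I_weightM|exact: L1I_weightM].
move: h1 h2; rewrite -/G -/H.
move: (P (fun y => c1 + P (fun z => c2 + P w1 z) y) x)
  (JR (fun y => c1 + P (fun z => c2 + P w1 z) y) x)
  (JI (fun y => d1 + P (fun z => d2 + P w2 z) y) x) (B G x) (B H x) (P b x).
move=> p jr ji bg bh pb h1 h2.
have -> : ji = - bh by rewrite -h2 opprK.
by rewrite mul1r mulrN opprK mulNr opprD addrA h1; ring.
Qed.

Lemma opT_parts (f : R -> R[i]) x : I x ->
  L1I l (fun t => Re (weakD l f t)) -> L1I l (fun t => Im (weakD l f t)) ->
  Re (opT l K f x) = Re (f x) - (JR (fun t => Re (weakD l f t)) x -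
                                 1 * JI (fun t => Im (weakD l f t)) x) /\
  Im (opT l K f x) = Im (f x) - (JR (fun t => Im (weakD l f t)) x -
                                 (-1) * JI (fun t => Re (weakD l f t)) x).
Proof.
move=> Ix Ir Ii; rewrite /opT (Cint_oriented_kernel l0 cK Ix Ir Ii).
by case: (f x) => p q /=; rewrite mul1r mulN1r opprK.
Qed.

Lemma kop_sup kap f : good_kernel l kap -> L1I l f ->
  exists C : R, forall x, `|kop l kap f x| <= C.
Proof.
move=> /kop_bounded_operator[_ _ [C hC] _] If.
by exists (C * normL1 l f) => x; exact: hC.
Qed.

Lemma transmuted_continuous (sg c2 : R) (w1 w2 : R -> R) x :
  L1I l w1 -> L1I l w2 -> I x ->
  {for x, continuous (fun y => (c2 + P w1 y) - (JR w1 y - sg * JI w2 y))}.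
Proof.
move=> I1 I2 Ix; apply: cvgB.
  by apply: cvgD; [exact: cvg_cst|exact: prim_continuous].
apply: cvgB; first exact: (kop_continuous good_JR I1 Ix).
by apply: cvgMr; exact: (kop_continuous good_JI I2 Ix).
Qed.

Lemma transmuted_bounded (sg c2 : R) (w1 w2 : R -> R) : L1I l w1 -> L1I l w2 ->
  exists C : R, forall x, I x ->
    `|(c2 + P w1 x) - (JR w1 x - sg * JI w2 x)| <= C.
Proof.
move=> I1 I2; have [C1 h1] := kop_sup (good_prim_kernel l) I1.
have [C2 h2] := kop_sup good_JR I1; have [C3 h3] := kop_sup good_JI I2.
exists ((`|c2| + C1) + (C2 + `|sg| * C3)) => x _.
rewrite (le_trans (ler_normB _ _))// lerD//.
  by rewrite (le_trans (ler_normD _ _))// lerD// h1.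
by rewrite (le_trans (ler_normB _ _))// lerD// normrM ler_wpM2l.
Qed.

End transmuted_function.

Theorem theorem27 (R : realType) (l : R) (hl : 0 < l)
  (a : R -> R) (ha : admissible l a)
  (e : R[i] -> R -> R[i]) (he : forall rho : R[i], is_ea l a rho (e rho))
  (K : R -> R -> R[i]) (hK : transmutation_kernel l a e K)
  (p : R) (hp : 1 <= p)
  (u : R -> R[i]) (hu : Sobolev l 3 p%:E u) :
  domL l a p (opT l K u) /\
  ae_eq_I l (opL l a (opT l K u)) (opT l K (weakD l (weakD l u))).
Proof.
have [Sd Sl] := hu.
have [I0r I0i] := LpC_L1I hp (Sl 0%N isT).
have [I1r I1i] := LpC_L1I hp (Sl 1%N isT).
have [I2r I2i] := LpC_L1I hp (Sl 2%N isT).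
have [I3r I3i] := LpC_L1I hp (Sl 3%N isT).
have [w0r w0i] := weakD_wder (Sd 0%N isT).
have [w1r w1i] := weakD_wder (Sd 1%N isT).
have [w2r w2i] := weakD_wder (Sd 2%N isT).
have [c0 [c1 [c2 [u2r u1r u0r]]]] :=
  sobolev3_representation hl w0r w1r w2r I0r I1r I2r I3r.
have [d0 [d1 [d2 [u2i u1i u0i]]]] :=
  sobolev3_representation hl w0i w1i w2i I0i I1i I2i I3i.
have mRI f g : L1I l f -> L1I l g -> measurable_fun `]- l, l[ f /\ measurable_fun `]- l, l[ g.
  by move=> If Ig; split; exact: (@L1I_measurable _ l).
have IU1 : L1I l (fun y => c1 + prim l (fun z => c2 +
    prim l (fun x => complex.Re (iter 3 (weakD l) u x)) z) y).
  by do 2 apply: L1I_cst_prim.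
have IV1 : L1I l (fun y => d1 + prim l (fun z => d2 +
    prim l (fun x => complex.Im (iter 3 (weakD l) u x)) z) y).
  by do 2 apply: L1I_cst_prim.
have gR := good_JR hl hK; have gI := good_JI hl hK.
have [mr1 mU1] := mRI _ _ I1r IU1; have [mi1 mV1] := mRI _ _ I1i IV1.
(* The kernel operators do not see null sets, so under them u' becomes its continuous representative
   at every x; u itself is replaced only almost everywhere. *)
have JRr := kop_ae gR mr1 mU1 u1r; have JIr := kop_ae gI mr1 mU1 u1r.
have JRi := kop_ae gR mi1 mV1 u1i; have JIi := kop_ae gI mi1 mV1 u1i.
have partR x : `]- l, l[%classic x -> complex.Re (opT l K u x) =
    complex.Re (u x) -
    (kop l (J_kernel (ReK l K)) (fun t => complex.Re (iter 1 (weakD l) u t)) x -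
     1 * kop l (J_kernel (ImK l K)) (fun t => complex.Im (iter 1 (weakD l) u t)) x).
  by move=> Ix; have [] := @opT_parts R l hl a e K hK u x Ix I1r I1i.
have partI x : `]- l, l[%classic x -> complex.Im (opT l K u x) =
    complex.Im (u x) -
    (kop l (J_kernel (ReK l K)) (fun t => complex.Im (iter 1 (weakD l) u t)) x -
     (-1) * kop l (J_kernel (ImK l K)) (fun t => complex.Re (iter 1 (weakD l) u t)) x).
  by move=> Ix; have [] := @opT_parts R l hl a e K hK u x Ix I1r I1i.
have mJ kap f : good_kernel l kap -> L1I l f -> measurable_fun `]- l, l[ (kop l kap f).
  by move=> gk If; apply: (@L1I_measurable _ l); exact: L1I_kop.
have mT1 : measurable_fun `]- l, l[ (fun x => complex.Re (opT l K u x)).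
  pose g x := complex.Re (u x) -
    (kop l (J_kernel (ReK l K)) (fun t => complex.Re (iter 1 (weakD l) u t)) x -
     1 * kop l (J_kernel (ImK l K)) (fun t => complex.Im (iter 1 (weakD l) u t)) x).
  apply: (eq_measurable_fun g); first by move=> x /set_mem Ix; rewrite partR.
  apply: measurable_funB; first exact: (L1I_measurable I0r).
  by apply: measurable_funB; [|apply: measurable_funM => //]; exact: mJ.
have mT2 : measurable_fun `]- l, l[ (fun x => complex.Im (opT l K u x)).
  pose g x := complex.Im (u x) -
    (kop l (J_kernel (ReK l K)) (fun t => complex.Im (iter 1 (weakD l) u t)) x -
     (-1) * kop l (J_kernel (ImK l K)) (fun t => complex.Re (iter 1 (weakD l) u t)) x).
  apply: (eq_measurable_fun g); first by move=> x /set_mem Ix; rewrite partI.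
  apply: measurable_funB; first exact: (L1I_measurable I0i).
  by apply: measurable_funB; [|apply: measurable_funM => //]; exact: mJ.
have TR : aeI l (fun x => complex.Re (opT l K u x)) (fun x => c0 +
    c1 * prim l (inv_weight a) x + double_prim l (inv_weight a) (weight a) (fun y =>
      (c2 + prim l (fun x => complex.Re (iter 3 (weakD l) u x)) y) -
      (kop l (J_kernel (ReK l K)) (fun x => complex.Re (iter 3 (weakD l) u x)) y -
       1 * kop l (J_kernel (ImK l K)) (fun x => complex.Im (iter 3 (weakD l) u x)) y)) x).
  move: u0r; apply: filterS; first exact: (ae_filter_ringOfSetsType lebesgue_measure).
  move=> x + Ix => /(_ Ix) h.
  rewrite (partR x Ix) JRr JIi -[complex.Re (u x)]/(complex.Re (iter 0 (weakD l) u x)) h.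
  exact: (transmuted_part hl ha he hK).
have TI : aeI l (fun x => complex.Im (opT l K u x)) (fun x => d0 +
    d1 * prim l (inv_weight a) x + double_prim l (inv_weight a) (weight a) (fun y =>
      (d2 + prim l (fun x => complex.Im (iter 3 (weakD l) u x)) y) -
      (kop l (J_kernel (ReK l K)) (fun x => complex.Im (iter 3 (weakD l) u x)) y -
       (-1) * kop l (J_kernel (ImK l K)) (fun x => complex.Re (iter 3 (weakD l) u x)) y)) x).
  move: u0i; apply: filterS; first exact: (ae_filter_ringOfSetsType lebesgue_measure).
  move=> x + Ix => /(_ Ix) h.
  rewrite (partI x Ix) JRi JIr -[complex.Im (u x)]/(complex.Im (iter 0 (weakD l) u x)) h.
  exact: (transmuted_part hl ha he hK).
have [dom Lu] := domL_of_double_prim hl ha hp mT1 mT2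
  (fun x => @transmuted_continuous R l hl a e K hK 1 c2 _ _ x I3r I3i)
  (fun x => @transmuted_continuous R l hl a e K hK (-1) d2 _ _ x I3i I3r)
  (transmuted_bounded hl hK 1 c2 I3r I3i) (transmuted_bounded hl hK (-1) d2 I3i I3r)
  TR TI.
split; first exact: dom.
(* The value obtained for L_a T_a u contains c2 + P u''' and d2 + P u''' in place of the parts of
   u''; these agree almost everywhere. *)
move: Lu u2r u2i; apply: filterS3; first exact: (ae_filter_ringOfSetsType lebesgue_measure).
move=> x hL hr hi Ix; rewrite (hL Ix).
have [pR pI] := @opT_parts R l hl a e K hK (weakD l (weakD l u)) x Ix I3r I3i.
apply: complex_eqP; rewrite ?pR ?pI /=.
  by rewrite -(hr Ix).
by rewrite -(hi Ix).
Qed.
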